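(* Let $V(x,\varepsilon)$ be a one-parameter family of $C^2$ vector fields, $x\in\mathbb{R}^n$, $\varepsilon\in\mathbb{R}$, defined near $(x_0,\varepsilon_0)\in\mathbb{R}^n\times\mathbb{R}$, with $V(x_0,\varepsilon_0)=0$, satisfying: (P0) $V(\cdot,\varepsilon_0)$ has $x_0$ as an isolated simple non-hyperbolic equilibrium with non-zero index; (P1) $\frac{\partial V}{\partial\varepsilon}(x_0,\varepsilon_0)\in \operatorname{image}(D_xV(x_0,\varepsilon_0))$; (P2) there exists $\omega=(\omega_1,\dots,\omega_{n+1})^{\top}\in\mathbb{R}^{n+1}$ such that $DV(x_0,\varepsilon_0)\,\omega=0$, $\omega_{n+1}\neq 0$, and $D(\det(D_xV))(x_0,\varepsilon_0)\,\omega\neq 0$. Then $V$ undergoes a pitchfork-type bifurcation at $(x_0,\varepsilon_0)$, i.e. it undergoes a $1\to k$ or a $k\to 1$ bifurcation at $(x_0,\varepsilon_0)$ with $3\le k\le +\infty$.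
   Context: $D_xV$ is the $n\times n$ Jacobian in $x$; $DV$ is the full $n\times(n+1)$ derivative in $(x,\varepsilon)$; $D(\det(D_xV))$ is the derivative in $(x,\varepsilon)$ of the scalar function $(x,\varepsilon)\mapsto\det D_xV(x,\varepsilon)$. The point $(x_0,\varepsilon_0)$ is simple non-hyperbolic if $D_xV(x_0,\varepsilon_0)$ has $0$ as a simple eigenvalue and all its other eigenvalues are off the imaginary axis. An equilibrium is non-hyperbolic if the Jacobian in $x$ has an eigenvalue on the imaginary axis there. The index of an isolated zero $z$ of a vector field $W$ on $\mathbb{R}^n$ is the degree of $W/|W|:\partial D\to S^{n-1}$, where $D$ is a closed disk centred at $z$ containing no other zero of $W$. A $1\to k$ bifurcation at $(x_0,\varepsilon_0)$ with $3\le k\le+\infty$: there is a neighborhood $U$ of $x_0$ and $\delta>0$ such that $V(\cdot,\varepsilon)$ has exactly one zero in $U$ for every $\varepsilon\in(\varepsilon_0-\delta,\varepsilon_0]$, and at least three (possibly infinitely many) zeros in $U$ for every $\varepsilon\in(\varepsilon_0,\varepsilon_0+\delta)$; the number of zeros for $\varepsilon>\varepsilon_0$ is not required to be the same for all $\varepsilon$. A $k\to1$ bifurcation is the same with the direction of $\varepsilon$ reversed (at least three zeros in $U$ for $\varepsilon\in(\varepsilon_0-\delta,\varepsilon_0)$, exactly one for $\varepsilon\in[\varepsilon_0,\varepsilon_0+\delta)$). The bifurcation is of pitchfork-type if, after possibly reversing the direction of $\varepsilon$, there are a neighborhood $U$ of $x_0$ and $\delta>0$ such that: for $\varepsilon\in(\varepsilon_0-\delta,\varepsilon_0]$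 there is exactly one zero in $U$, which at $\varepsilon=\varepsilon_0$ is $x_0$, and $(x_0,\varepsilon_0)$ is the only non-hyperbolic zero in $U$ for these parameters; $x_0$ continues smoothly to a zero $x_\varepsilon\in U$ of $V(\cdot,\varepsilon)$ for $\varepsilon\in[\varepsilon_0,\varepsilon_0+\delta)$; and for $\varepsilon\in(\varepsilon_0,\varepsilon_0+\delta)$ the number of zeros in $U$ is at least three. *)

(* Defs.v *)
From HB Require Import structures.
From mathcomp Require Import all_boot all_order all_algebra.
From mathcomp Require Import complex.
From mathcomp Require Import all_classical all_reals all_analysis.
Set Implicit Arguments.
Unset Strict Implicit.
Unset Printing Implicit Defensive.
Import Order.TTheory GRing.Theory Num.Theory.
Import numFieldNormedType.Exports.
Local Open Scope classical_set_scope.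
Local Open Scope ring_scope.

(* Class C^k on an open set A.  Continuity of the derivatives is asked
   direction by direction, which is the usual notion since it is only used on
   finite-dimensional U. *)
Fixpoint class_C (R : realType) (U W : normedModType R) (k : nat) (A : set U)
    (f : U -> W) : Prop :=
  if k is j.+1 then
    (forall x, A x -> differentiable f x) /\
    (forall v, class_C j A (fun x => 'd f x v))
  else forall x, A x -> {for x, continuous f}.

Section Degree.
Variables (R : realType) (n : nat).
Implicit Types (f g W : 'rV[R]_n -> 'rV[R]_n) (x y z u : 'rV[R]_n).

(* The norm `|x| of 'rV[R]_n is the sup norm. *)
Definition enorm x : R := Num.sqrt (\sum_i x ord0 i ^+ 2).

Definition sphere : set 'rV[R]_n := [set u | enorm u = 1].

Definition sphere_homotopic f g : Prop :=
  exists H : R * 'rV[R]_n -> 'rV[R]_n,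
    [/\ {within `[0, 1]%classic `*` sphere, continuous H},
        (forall t u, 0 <= t <= 1 -> sphere u -> sphere (H (t, u))),
        (forall u, sphere u -> H (0, u) = f u) &
        (forall u, sphere u -> H (1, u) = g u)].

Definition radial_ext g x : 'rV[R]_n := enorm x *: g ((enorm x)^-1 *: x).

Definition sphere_fiber g y : set 'rV[R]_n := [set u | sphere u /\ g u = y].

(* f : S^(n-1) -> S^(n-1) has degree d: f is homotopic to a C^1 self-map g of
   the sphere having a regular value y whose preimages, counted with their
   orientation signs, add up to d.
   At u on the sphere the differential of the radial extension of g sends u to
   g u and restricts to dg_u on the tangent space, so its determinant has the
   sign of det dg_u for the boundary orientations of the sphere.  The fiber of
   a regular value is finite by compactness.  For n = 1 this gives degree 1 to
   the identity of {-1, 1}, -1 to the antipodal map and 0 to the constants. *)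
Definition has_degree f (d : int) : Prop :=
  exists g y,
    [/\ sphere_homotopic f g,
        class_C 1 [set x | x != 0] (radial_ext g),
        sphere y,
        (forall u, sphere_fiber g y u -> \det ('J (radial_ext g) u) != 0) &
        d = \sum_(u \in sphere_fiber g y) sgz (\det ('J (radial_ext g) u))].

(* d is the index at z of the vector field W defined on A: the degree of W/|W|
   on the boundary of a closed disk centred at z that is contained in A and
   contains no zero of W other than z; the boundary is parametrized by the unit
   sphere. *)
Definition has_index (A : set 'rV[R]_n) W z (d : int) : Prop :=
  exists r : R,
    [/\ 0 < r,
        (forall x, enorm (x - z) <= r -> A x /\ (W x = 0 -> x = z)) &
        has_degree
          (fun u => (enorm (W (z + r *: u)))^-1 *: W (z + r *: u)) d].

(* By classical degree theory a continuous vector field has exactly one index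
   at each isolated zero, so this says that the index is not 0. *)
Definition nonzero_index (A : set 'rV[R]_n) W z : Prop :=
  forall d, has_index A W z d -> d != 0.

End Degree.

Section Families.
Variables (R : realType) (n : nat).
Implicit Types (V : 'rV[R]_n * R -> 'rV[R]_n) (Om : set ('rV[R]_n * R)).
Implicit Types (U : set 'rV[R]_n) (x : 'rV[R]_n) (e : R).

(* Vectors are rows, so this is the transpose of the usual Jacobian matrix; its
   determinant and characteristic polynomial are unaffected. *)
Definition jac_x V (p : 'rV[R]_n * R) : 'M[R]_n :=
  'J (fun x => V (x, p.2)) p.1.

Definition complex_eigenvalue (A : 'M[R]_n) (z : R[i]) : Prop :=
  eigenvalue (map_mx (real_complex R) A) z.

Definition non_hyperbolic V (p : 'rV[R]_n * R) : Prop :=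
  exists2 z, complex_eigenvalue (jac_x V p) z & complex.Re z = 0.

Definition simple_non_hyperbolic V (p : 'rV[R]_n * R) : Prop :=
  mup 0 (char_poly (jac_x V p)) = 1%N /\
  forall z, complex_eigenvalue (jac_x V p) z -> z != 0 -> complex.Re z != 0.

Definition zeros V U e : set 'rV[R]_n := [set x | U x /\ V (x, e) = 0].

(* U is a neighborhood of x0, d > 0, and the family (defined on Om) is defined
   on all of U for the parameters within d of e0. *)
Definition bifurcation_domain Om x0 e0 U (d : R) : Prop :=
  [/\ open_nbhs x0 U, 0 < d &
      forall x e, U x -> e0 - d < e < e0 + d -> Om (x, e)].

Definition one_zero V U e : Prop := exists x, zeros V U e = [set x].

Definition three_zeros V U e : Prop := (`I_3 #<= zeros V U e)%card.

Definition one_to_k Om V x0 e0 : Prop :=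
  exists U d,
    [/\ bifurcation_domain Om x0 e0 U d,
        (forall e, e0 - d < e <= e0 -> one_zero V U e) &
        (forall e, e0 < e < e0 + d -> three_zeros V U e)].

Definition k_to_one Om V x0 e0 : Prop :=
  exists U d,
    [/\ bifurcation_domain Om x0 e0 U d,
        (forall e, e0 - d < e < e0 -> three_zeros V U e) &
        (forall e, e0 <= e < e0 + d -> one_zero V U e)].

(* The smooth continuation xi of x0 is C^1: at e0 a family of class C^2 gives
   no more in general, as e * (x - e * |e|^(1/2)) - x^3 at (0, 0) shows.
   Smoothness on the half-open interval [e0, e0 + d) is that of the restriction
   of a C^1 curve defined on an open interval. *)
Definition forward_pitchfork Om V x0 e0 : Prop :=
  exists U d,
    [/\ bifurcation_domain Om x0 e0 U d,
        (forall e, e0 - d < e <= e0 -> one_zero V U e) /\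
          zeros V U e0 = [set x0],
        (forall x e, e0 - d < e <= e0 -> zeros V U e x ->
           (non_hyperbolic V (x, e) <-> (x, e) = (x0, e0))),
        (exists xi : R -> 'rV[R]_n,
           [/\ class_C 1 `]e0 - d, e0 + d[%classic xi,
               xi e0 = x0 &
               forall e, e0 <= e < e0 + d -> zeros V U e (xi e)]) &
        (forall e, e0 < e < e0 + d -> three_zeros V U e)].

Definition reverse_param (p : 'rV[R]_n * R) : 'rV[R]_n * R := (p.1, - p.2).

Definition pitchfork_type Om V x0 e0 : Prop :=
  forward_pitchfork Om V x0 e0 \/
  forward_pitchfork (reverse_param @^-1` Om) (V \o reverse_param) x0 (- e0).

End Families.

(* Main.v *)
(* Lyapunov-Schmidt reduction.  Let [v] and [c] span the left and right kernels of
   the Jacobian at [(x0, e0)], with [v *m c = 1].  Solving the equation along [v]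
   by the implicit function theorem leaves a surface [gam (s, e)], where [s] is the
   coordinate [(x - x0) *m c], and a scalar function [g] with
   [V (gam (s, e), e0 + e) = g (s, e) *: v]; its zeros are those of [V].
   Condition (P1) gives [dg = 0] at the origin.  If [g (s, 0)] did not change sign
   at [s = 0], then [V (x, e0)] would avoid a direction near [x0] and its index
   would be 0.  So [g (s, 0)] changes sign, which forces [g_ss = 0].  The
   determinant of the Jacobian restricted to the surface is [g_s] times a continuous
   function, so (P2) says that a combination of [g_ss] and [g_se] is not 0, whence
   [g_se <> 0].
   Such a [g] behaves like [s * e - s ^ 3] up to signs: after division by [g_se],
   [g_s] is close to [e] in a cone [|s| <= K |e|], which therefore contains exactly
   one zero [xi e], depending on [e] in a C^1 way and with [g_s <> 0]; outside the
   cone [g (s, e) - g (s, 0)] has the sign of [s * e], so that on one side in [e]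
   there are no other zeros and on the other side the sign of [g (s, 0)] yields one
   more zero on each side of the cone.  Along [xi] the Jacobian is invertible when
   [e <> 0], and no eigenvalue lies on the imaginary axis since the simple eigenvalue
   0 is the only one that could have moved to it. *)
Require Import Defs.
From HB Require Import structures.
From mathcomp Require Import all_boot all_order all_algebra.
From mathcomp Require Import complex.
From mathcomp Require Import all_classical all_reals all_analysis.
From mathcomp Require Import perm ring lra.
Set Implicit Arguments.
Unset Strict Implicit.
Unset Printing Implicit Defensive.
Import Order.TTheory GRing.Theory Num.Theory.
Import numFieldNormedType.Exports.
Local Open Scope classical_set_scope.
Local Open Scope ring_scope.

(** * Linear algebra *)

(** The obstacle is regularity. The implicit function theorem is used in its C^1 form, so [gam] has
    merely continuous derivatives and [g] has no Taylor expansion of order two around the origin.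
    But [dg] is a sum of products of a continuous factor, coming from [d gam], with an entry of
    [D_x V] or of the parameter derivative of [V] along [c]; these entries are differentiable and
    vanish at the origin, which makes [dg] differentiable at that single point. The resulting
    estimates of [g_s] and [g_e] up to o(|s| + |e|) are all that the planar argument receives: even
    the equality of the two mixed second derivatives at 0 is derived from them. There is no cubic
    term either; the sign of [g (s, 0)] stands in for it, so the zeros outside the cone are only
    bounded from below in number. Since [g_s] vanishes at the origin, the branch [xi] cannot come
    from the implicit function theorem there; it is located by signs on the boundary of the cone,
    and its slope at 0 is read off from the estimates. *)

Section LinearAlgebra.
Variables (F : fieldType) (n : nat).
Implicit Types (A : 'M[F]_n) (u v : 'rV[F]_n) (c : 'cV[F]_n).

(** Without row [i] and column [j] the equations form an invertible square system for the other
    coordinates of [u], so coordinate [i] determines a kernel vector. *)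
Lemma cofactor_neq0_ker A (i j : 'I_n) u :
  cofactor A i j != 0 -> u *m A = 0 -> u ord0 i = 0 -> u = 0.
Proof.
rewrite /cofactor mulf_eq0 negb_or => /andP[_ detN0] uA ui0.
have N_unit : row' i (col' j A) \in unitmx by rewrite unitmxE unitfE.
have u'A : col' i u *m row' i (col' j A) = 0.
  apply/rowP => k; rewrite !mxE.
  have /rowP /(_ (lift j k)) := uA.
  rewrite !mxE (bigD1 i) //= ui0 mul0r add0r => sum0; rewrite -[RHS]sum0.
  rewrite [RHS](reindex_omap (lift i) (unlift i)) /=; last first.
    by move=> l; rewrite eq_sym => /unlift_some[l' -> ->].
  apply: eq_big => [l|l _]; last by rewrite !mxE.
  by rewrite eq_sym neq_lift liftK eqxx.
have u'0 : col' i u = 0 by rewrite -(mulmxK N_unit (col' i u)) u'A mul0mx.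
apply/rowP => k; rewrite mxE; case: (unliftP i k) => [k' ->|-> //].
by have /rowP /(_ k') := u'0; rewrite !mxE.
Qed.

Lemma unitmx_inj A : (forall u, u *m A = 0 -> u = 0) -> A \in unitmx.
Proof.
move=> injA; rewrite -row_free_unit -kermx_eq0; apply/eqP/row_matrixP => k.
by rewrite row0; apply: injA; rewrite -row_mul mulmx_ker row0.
Qed.

(** Up to a nonzero scalar, the adjugate of [- A] is the projector onto the kernel. With
    characteristic polynomial [q * 'X], it acts on left kernel vectors as [q.[0] != 0]. Being
    nonzero, it provides a nonzero minor, so the kernel is a line and the adjugate has the form
    [q.[0] *: (c *m v)], from which the relations between [A], [v] and [c] follow. *)
Lemma simple_eigenvalue0_split A :
  mup 0 (char_poly A) = 1%N ->
  exists v c, [/\ v *m A = 0, A *m c = 0, v *m c = 1%:M &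
                  A + c *m v \in unitmx].
Proof.
pose chi : {poly F} := char_poly A; rewrite -/chi => mupA.
have chi0 : chi != 0 by rewrite monic_neq0 ?char_poly_monic.
have [q q0 chiE] : exists2 q : {poly F}, q.[0] != 0 & chi = q * 'X.
  have := @mup_geq F 0 chi 1 chi0; rewrite mupA leqnn expr1 subr0 => /esym.
  move=> /dvdpP[q qE]; exists q => //; apply/negP => /eqP q0.
  have := @mup_geq F 0 chi 2 chi0; rewrite mupA subr0 => /esym/negP; apply.
  have /factor_theorem[r qr] : root q 0 by apply/eqP.
  by apply/dvdpP; exists r; rewrite qE qr subr0 -mulrA.
have detA : \det A = 0.
  have : chi.[0] = 0 by rewrite chiE hornerM hornerX mulr0.
  rewrite horner_coef0 char_poly_det.
  by move/eqP; rewrite mulf_eq0 signr_eq0 => /eqP.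
pose B := \adj (- A).
have XA0 : map_mx (horner_eval 0) (char_poly_mx A) = - A.
  by apply/matrixP => i j;
    rewrite !mxE /horner_eval !hornerE hornerMn hornerX mul0rn add0r.
have BE : map_mx (horner_eval 0) (\adj (char_poly_mx A)) = B.
  by rewrite map_mx_adj XA0.
have detNA : \det (- A) = 0 by rewrite -scaleN1r detZ detA mulr0.
have AB : A *m B = 0.
  have := mul_mx_adj (- A); rewrite detNA mulNmx => /eqP.
  by rewrite raddf0 oppr_eq0 => /eqP.
have BA : B *m A = 0.
  have := mul_adj_mx (- A); rewrite detNA mulmxN => /eqP.
  by rewrite raddf0 oppr_eq0 => /eqP.
have kerB u : u *m A = 0 -> u *m B = q.[0] *: u.
  move=> uA; pose U : 'rV[{poly F}]_n := map_mx polyC u.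
  have UX : U *m char_poly_mx A = 'X *: U.
    rewrite /char_poly_mx mulmxBr mul_mx_scalar -map_mxM uA.
    by rewrite map_mx0 subr0.
  (* Both sides carry the factor X, which has to be cancelled over polynomials before evaluating at
     0. *)
  have : 'X *: (U *m \adj (char_poly_mx A)) = 'X *: (q *: U).
    rewrite scalemxAl -UX -mulmxA mul_mx_adj -/(char_poly A) -/chi chiE.
    by rewrite mul_mx_scalar scalerA mulrC.
  move/(scalemx_inj (negbT (polyX_eq0 F))).
  move/(congr1 (map_mx (horner_eval 0))); rewrite map_mxM BE.
  have -> : map_mx (horner_eval 0) U = u.
    by apply/rowP => k; rewrite !mxE /horner_eval hornerC.
  move=> ->; apply/rowP => k.
  by rewrite !mxE /horner_eval hornerM hornerC.
have /det0P[v v0 vA] : \det A == 0 by apply/eqP.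
have BN0 : B != 0.
  apply/eqP => B00; have := kerB _ vA; rewrite B00 mulmx0 => /esym/eqP.
  by rewrite scaler_eq0 (negbTE q0) (negbTE v0).
have [i [j cofN0]] : exists i j, cofactor (- A) i j != 0.
  apply: contrapT => cof0; move/eqP: BN0; apply.
  apply/matrixP => i j; rewrite !mxE; apply/eqP; apply: contrapT => /negP cofN0.
  by apply: cof0; exists j, i.
have ker0 u : u *m A = 0 -> u ord0 i = 0 -> u = 0.
  by move=> uA; apply: cofactor_neq0_ker cofN0 _; rewrite mulmxN uA oppr0.
have vi0 : v ord0 i != 0 by apply: contraNN v0 => /eqP /(ker0 _ vA) ->.
have kerv u : u *m A = 0 -> u = (u ord0 i / v ord0 i) *: v.
  move=> uA; apply/subr0_eq/ker0.
    by rewrite mulmxBl -scalemxAl uA vA scaler0 subr0.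
  by rewrite !mxE divfK // subrr.
pose c : 'cV[F]_n := q.[0]^-1 *: \col_k (B k i / v ord0 i).
have Bcv : B = q.[0] *: (c *m v).
  rewrite /c -scalemxAl scalerA divff // scale1r; apply/row_matrixP => k.
  rewrite [LHS]kerv; last by rewrite -row_mul BA row0.
  by rewrite row_mul; apply/rowP => l; rewrite !mxE big_ord1 !mxE.
have vc : v *m c = 1%:M.
  have := kerB _ vA; rewrite Bcv -scalemxAr mulmxA => /(scalerI q0).
  rewrite [v *m c]mx11_scalar mul_scalar_mx -[RHS]scale1r => /eqP.
  by rewrite -subr_eq0 -scalerBl scaler_eq0 (negbTE v0) orbF subr_eq0 => /eqP ->.
have Ac : A *m c = 0.
  have : A *m (c *m v) = 0.
    by apply: (scalerI q0); rewrite scalemxAr -Bcv AB scaler0.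
  move/(congr1 (mulmxr c)); rewrite /= mul0mx -!mulmxA vc mulmx1 //.
exists v, c; split => //.
apply: unitmx_inj => u; rewrite mulmxDr mulmxA => uM.
have uc : u *m c = 0.
  move/(congr1 (mulmxr c)): uM.
  by rewrite /= mulmxDl mul0mx -!mulmxA Ac vc mulmx0 add0r mulmx1.
have uA : u *m A = 0 by move: uM; rewrite uc mul0mx addr0.
have uE := kerv _ uA; move: uc; rewrite uE -scalemxAl vc => /matrixP /(_ 0 0).
by rewrite !mxE eqxx mulr1 => ->; rewrite scale0r.
Qed.

End LinearAlgebra.

(** * Differential calculus and the implicit function theorem *)

Section Differentials.
Variables (R : realType).
Implicit Types (E W : normedModType R).

Lemma differentiable_near E W (f : E -> W) x e : differentiable f x -> 0 < e ->
  \forall y \near x, `|f y - f x - 'd f x (y - x)| <= e * `|y - x|.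
Proof.
move=> /diff_locally/eqaddoP dfo e0.
rewrite (near_shift 0); near=> h => /=; rewrite subr0 addrK.
have -> : f (h + x) - f x - 'd f x h = (f \o shift x - (cst (f x) + 'd f x)) h.
  by rewrite !fctE /= opprD addrA.
by near: h; exact: (dfo e e0).
Unshelve. all: by end_near. Qed.

Lemma is_diff_near E W (f : E -> W) (df : {linear E -> W}) x : continuous df ->
  (forall e, 0 < e ->
     \forall y \near x, `|f y - f x - df (y - x)| <= e * `|y - x|) ->
  is_diff x f df.
Proof.
move=> dfc dfe.
have dfo : f \o shift x = cst (f x) + df +o_ 0 id.
  apply/eqaddoP => e e0; have := dfe e e0.
  rewrite (near_shift 0) /= => fe; near=> h.
  have -> : (f \o shift x - (cst (f x) + df)) h = f (h + x) - f x - df h.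
    by rewrite !fctE /= opprD addrA.
  have : `|f (h + (x - 0)) - f x - df (h + (x - 0) - x)| <= e * `|h + (x - 0) - x|.
    by near: h; exact: fe.
  by rewrite subr0 addrK.
have dE := diff_unique dfc dfo.
apply: DiffDef => //; apply/diff_locallyP; rewrite dE; split => //.
Unshelve. all: by end_near. Qed.

Lemma is_derive_line E W (f : E -> W) (x h : E) (t : R) :
  differentiable f (x + t *: h) ->
  is_derive t 1 (fun s : R => f (x + s *: h)) ('d f (x + t *: h) h).
Proof.
move=> df; pose l (s : R) := x + s *: h.
have dsc : is_diff t (fun s : R => s *: h) (fun s : R => s *: h).
  exact: is_diff_scalel.
have lE : l = cst x + (fun s : R => s *: h) by apply/funext.
have dl : differentiable l t.
  rewrite lE; apply: differentiableD; first exact: differentiable_cst.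
  by case: dsc.
have dl1 : 'd l t 1 = h.
  rewrite lE diffD; [|exact: differentiable_cst|by case: dsc].
  have -> : ('d (cst x) t \+ 'd (fun s : R => s *: h) t) 1 =
      'd (cst x) t 1 + 'd (fun s : R => s *: h) t 1 by [].
  have -> : 'd (fun s : R => s *: h) t 1 = h.
    by case: dsc => _ ->; exact: scale1r.
  have -> : 'd (cst x) t 1 = 0 :> E by rewrite diff_cst.
  exact: add0r.
have dfl : differentiable (f \o l) t by exact: differentiable_comp.
apply: DeriveDef; first by apply/derivable1_diffP.
by rewrite deriveE // (diff_comp dl df) /= dl1.
Qed.

Lemma norm_coord_le m n (A : 'M[R]_(m, n)) i j : `|A i j| <= `|A|.
Proof.
by rewrite [leRHS]/Num.Def.normr/= mx_normrE; exact: (le_bigmax _ _ (i, j)).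
Qed.

Lemma norm_mx_le m n (A : 'M[R]_(m, n)) (e : R) : 0 <= e ->
  (forall i j, `|A i j| <= e) -> `|A| <= e.
Proof.
move=> e0 Ae; rewrite [leLHS]/Num.Def.normr/= mx_normrE.
by apply: bigmax_le => // i _; exact: Ae.
Qed.

Lemma norm_mulmx_le n m (h : 'rV[R]_n) (A : 'M[R]_(n, m)) :
  `|h *m A| <= n%:R * `|A| * `|h|.
Proof.
apply: norm_mx_le => [|i j]; first by rewrite !mulr_ge0.
rewrite !mxE; apply: le_trans (ler_norm_sum _ _ _) _.
apply: (@le_trans _ _ (\sum_(l < n) `|A| * `|h|)); last first.
  by rewrite sumr_const card_ord -[leLHS]mulr_natl mulrA.
apply: ler_sum => l _; rewrite normrM mulrC.
by apply: ler_pM => //; exact: norm_coord_le.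
Qed.

Lemma mulmx_bounded n m (A : 'M[R]_(n, m)) :
  exists2 k, 0 < k & forall h : 'rV[R]_n, `|h *m A| <= k * `|h|.
Proof.
exists (1 + n%:R * `|A|); first by rewrite ltr_pwDl // mulr_ge0.
move=> h; apply: le_trans (norm_mulmx_le _ _) _.
by apply: ler_wpM2r => //; rewrite lerDr.
Qed.

(* Coordinatewise mean value theorem along the segment from [q] to [p]. *)
Lemma mean_value_strict E m (f : E -> 'rV[R]_m) (L : {linear E -> 'rV[R]_m})
    x (d e : R) : 0 <= e ->
  (forall z, ball x d z -> differentiable f z) ->
  (forall z, ball x d z -> forall h, `|'d f z h - L h| <= e * `|h|) ->
  forall p q, ball x d p -> ball x d q ->
  `|f p - f q - L (p - q)| <= e * `|p - q|.
Proof.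
move=> e0 df dfL p q xp xq; apply: norm_mx_le => [|i j]; first exact: mulr_ge0.
pose l (t : R) := q + t *: (p - q).
have xl t : t \in `[0, 1]%R -> ball x d (l t).
  rewrite in_itv /= => /andP[t0 t1].
  have -> : l t = t *: p + (1 - t) *: q.
    by rewrite /l scalerBr scalerBl scale1r addrCA.
  move: xp xq; rewrite -!ball_normE /= => xp xq.
  have -> : x - (t *: p + (1 - t) *: q) = t *: (x - p) + (1 - t) *: (x - q).
    by rewrite !scalerBr addrACA -opprD -scalerDl addrCA subrr addr0 scale1r.
  apply: le_lt_trans (ler_normD _ _) _; rewrite !normrZ.
  rewrite (ger0_norm t0) (@ger0_norm _ (1 - t)) ?subr_ge0 //.
  have [->|t0'] := eqVneq t 0; first by rewrite mul0r add0r subr0 mul1r.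
  have tgt0 : 0 < t by rewrite lt_neqAle eq_sym t0' t0.
  rewrite -[ltRHS]mul1r -[X in X * d](subrKC t) [ltRHS]mulrDl.
  apply: (@lt_le_trans _ _ (t * d + (1 - t) * `|x - q|)).
by rewrite ltrD2r ltr_pM2l.
  by rewrite lerD2l; apply: ler_wpM2l; rewrite ?subr_ge0 // ltW.
pose phi (t : R) : R := (f (l t) - t *: L (p - q)) i j.
pose dphi (t : R) : R := ('d f (l t) (p - q) - L (p - q)) i j.
have dphiE (t : R) : t \in `[0, 1]%R -> is_derive t 1 phi (dphi t).
  move=> t01.
  have D : is_derive t 1 (fun s => f (l s) - s *: L (p - q))
      ('d f (l t) (p - q) - L (p - q)).
    have D2 : is_derive t 1 (fun s => s *: L (p - q)) (L (p - q)).
      apply: DeriveDef; first exact/derivable1_diffP.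
      by rewrite deriveE // diff_val scale1r.
    exact: (is_deriveB (is_derive_line (df _ (xl _ t01))) D2).
  have dlD : derivable (fun s : R => f (l s) - s *: L (p - q)) t 1 by case: D.
  have dlE : 'D_1 (fun s : R => f (l s) - s *: L (p - q)) t =
    'd f (l t) (p - q) - L (p - q) by case: D.
  move/derivable_mxP: (dlD) => /(_ i j) dlDij.
  by apply: DeriveDef => //; rewrite /dphi -dlE derive_mx // mxE.
have phi_cont : {within `[0, 1], continuous phi}.
  by apply: derivable_within_continuous => t /dphiE[].
have dphi_oo (t : R) : t \in `]0, 1[%R -> is_derive t 1 phi (dphi t).
  by move=> t01; apply: dphiE; exact: subset_itv_oo_cc.
have [c c01] := MVT_segment ler01 dphi_oo phi_cont.
rewrite subr0 mulr1 => phiE.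
have -> : (f p - f q - L (p - q)) i j = phi 1 - phi 0.
  by rewrite /phi /l !scale1r !scale0r addr0 subr0 subrKC !mxE; lra.
rewrite phiE; apply: le_trans (norm_coord_le _ _ _) _.
exact/dfL/xl.
Qed.

End Differentials.

(** * Continuity and differentiability of matrix-valued functions *)

Section MatrixFunctions.
Variables (R : realType).

Section Continuity.
Variables (T : topologicalType) (x : T).

Lemma continuous_mxP m n (f : T -> 'M[R]_(m, n)) :
  {for x, continuous f} <->
  forall i j, {for x, continuous (fun y => f y i j : R)}.
Proof.
split=> [fc i j|fc].
  exact: (continuous_comp fc (@coord_continuous _ _ _ i j (f x))).
apply/cvgrPdist_le => e e0; near=> y.
apply: norm_mx_le => [|i j]; first exact: ltW.
move: i j; near: y; apply: filter_forall => i; apply: filter_forall => j.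
have /cvgrPdist_le /(_ e e0) := fc i j.
by apply: filterS => y; rewrite !mxE.
Unshelve. all: by end_near. Qed.

Lemma continuous_sum I (r : seq I) (P : pred I) (f : I -> T -> R) :
  (forall i, P i -> {for x, continuous (f i)}) ->
  {for x, continuous (fun y => \sum_(i <- r | P i) f i y)}.
Proof.
move=> fc; elim: r => [|i r IH].
  rewrite (_ : (fun y => _) = cst 0); first exact: cst_continuous.
  by apply/funext => y; rewrite big_nil.
rewrite (_ : (fun y => _) = if P i
  then f i \+ (fun y => \sum_(i <- r | P i) f i y)
  else fun y => \sum_(i <- r | P i) f i y).
  by case: ifP => // Pi; apply: continuousD => //; exact: fc.
by apply/funext => y; rewrite big_cons; case: ifP.
Qed.

Lemma continuous_prod I (r : seq I) (P : pred I) (f : I -> T -> R) :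
  (forall i, P i -> {for x, continuous (f i)}) ->
  {for x, continuous (fun y => \prod_(i <- r | P i) f i y)}.
Proof.
move=> fc; elim: r => [|i r IH].
  rewrite (_ : (fun y => _) = cst 1); first exact: cst_continuous.
  by apply/funext => y; rewrite big_nil.
rewrite (_ : (fun y => _) = if P i
  then f i \* (fun y => \prod_(i <- r | P i) f i y)
  else fun y => \prod_(i <- r | P i) f i y).
  by case: ifP => // Pi; apply: continuousM => //; exact: fc.
by apply/funext => y; rewrite big_cons; case: ifP.
Qed.

Lemma continuous_mulmx m n p (f : T -> 'M[R]_(m, n)) (g : T -> 'M[R]_(n, p)) :
  {for x, continuous f} -> {for x, continuous g} ->
  {for x, continuous (fun y => f y *m g y)}.
Proof.
move=> /continuous_mxP fc /continuous_mxP gc; apply/continuous_mxP => i j.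
rewrite (_ : (fun y => _) = fun y => \sum_k f y i k * g y k j); last first.
  by apply/funext => y; rewrite mxE.
by apply: continuous_sum => k _; apply: continuousM; [exact: fc|exact: gc].
Qed.

Lemma continuous_det n (f : T -> 'M[R]_n) :
  {for x, continuous f} -> {for x, continuous (fun y => \det (f y))}.
Proof.
move=> /continuous_mxP fc; apply: continuous_sum => s _.
apply: continuousM; first exact: cvg_cst.
by apply: continuous_prod => i _; exact: fc.
Qed.

Lemma continuous_adj n (f : T -> 'M[R]_n) :
  {for x, continuous f} -> {for x, continuous (fun y => \adj (f y))}.
Proof.
move=> /continuous_mxP fc; apply/continuous_mxP => i j.
rewrite (_ : (fun y => _) =
    fun y => (-1) ^+ (j + i) * \det (row' j (col' i (f y)))); last first.
  by apply/funext => y; rewrite mxE.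
apply: continuousM; first exact: cvg_cst.
apply: continuous_det; apply/continuous_mxP => k l.
rewrite (_ : (fun y => _) = fun y => f y (lift j k) (lift i l)); first exact: fc.
by apply/funext => y; rewrite !mxE.
Qed.

Lemma continuous_invmx n (f : T -> 'M[R]_n) :
  f x \in unitmx ->
  {for x, continuous f} -> {for x, continuous (fun y => invmx (f y))}.
Proof.
move=> fx fc; have detf : \det (f x) != 0 by rewrite -unitfE -unitmxE.
have fE : \forall y \near x, (\det (f y))^-1 *: \adj (f y) = invmx (f y).
  have := continuous_det fc => /cvgr_neq0 /(_ detf); apply: filterS => y dety.
  by rewrite /invmx unitmxE unitfE dety.
have : (fun y => (\det (f y))^-1 *: \adj (f y)) @ x -->
    (\det (f x))^-1 *: \adj (f x).
  apply: cvgZ; last exact: continuous_adj.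
  by apply: cvgV => //; exact: continuous_det.
rewrite (nbhs_singleton fE); apply: cvg_trans.
by apply: near_eq_cvg; apply: filterS fE => y.
Qed.

End Continuity.

Section Differentiability.
Variables (E : normedModType R) (x : E).

Lemma differentiable_mx m n (f : E -> 'M[R]_(m, n)) :
  (forall i j, differentiable (fun y => f y i j : R) x) -> differentiable f x.
Proof.
move=> df.
pose D h := \matrix_(i, j) 'd (fun y => f y i j : R) x h.
have Dlin : linear D.
  by move=> a u v; apply/matrixP => i j; rewrite !mxE linearP.
pose Dl := GRing.isLinear.Build _ _ _ _ _ Dlin.
pose DL : {linear _ -> _} := HB.pack D Dl.
have := @is_diff_near R E 'M[R]_(m, n) f DL x; case => //.
  move=> y; apply/continuous_mxP => i j; rewrite /= /D.
  rewrite (_ : (fun h => _) = 'd (fun y => f y i j : R) x); last first.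
    by apply/funext => h; rewrite mxE.
  exact: diff_continuous.
move=> e e0; near=> y; apply: norm_mx_le => [|i j]; first by rewrite mulr_ge0 // ltW.
rewrite !mxE; move: i j; near: y.
by apply: filter_forall => i; apply: filter_forall => j; exact: differentiable_near.
Unshelve. all: by end_near. Qed.

Lemma differentiable_coords m n (f : E -> 'M[R]_(m, n)) i j :
  differentiable f x -> differentiable (fun y => f y i j : R) x.
Proof.
move=> df; apply: (@differentiable_comp _ _ _ _ f (fun M => M i j : R)) => //.
exact: differentiable_coord.
Qed.

Lemma diff_coords m n (f : E -> 'M[R]_(m, n)) i j h :
  differentiable f x -> 'd (fun y => f y i j : R) x h = 'd f x h i j.
Proof.
move=> df; rewrite -[LHS]deriveE; last exact: differentiable_coords.
by rewrite -deriveE // derive_mx ?mxE //; exact: diff_derivable.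
Qed.

Lemma differentiable_det n (f : E -> 'M[R]_n) :
  differentiable f x -> differentiable (fun y => \det (f y)) x.
Proof.
move=> df; rewrite /determinant.
have dprod (s : 'I_n -> 'I_n) r :
    differentiable (fun y => \prod_(i <- r) f y i (s i)) x.
  elim: r => [|i r IH].
    rewrite (_ : (fun y => _) = cst 1); first exact: differentiable_cst.
    by apply/funext => y; rewrite big_nil.
  rewrite (_ : (fun y => _) =
    (fun y => f y i (s i)) * (fun y => \prod_(i <- r) f y i (s i))); last first.
    by apply/funext => y; rewrite big_cons.
  by apply: differentiableM => //; exact: differentiable_coords.
elim: (index_enum _) => [|s r IH].
  rewrite (_ : (fun y => _) = cst 0); first exact: differentiable_cst.
  by apply/funext => y; rewrite big_nil.
rewrite (_ : (fun y => _) =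
  cst ((-1) ^+ s) * (fun y => \prod_i f y i (s i)) +
  (fun y => \sum_(s <- r) (-1) ^+ s * \prod_i f y i (s i))); last first.
  by apply/funext => y; rewrite big_cons.
apply: differentiableD => //; apply: differentiableM => //.
Qed.

End Differentiability.

End MatrixFunctions.

(** * Fixed points and the implicit function theorem *)

Section ImplicitFunction.
Variables (R : realType).

Lemma near_norm (E : normedModType R) (x : E) (P : E -> Prop) :
  (\forall y \near x, P y) <->
  exists2 d : R, 0 < d & forall y, `|y - x| < d -> P y.
Proof.
split=> [/nbhs_ballP[d d0 dP]|[d d0 dP]].
  by exists d => // y yx; apply: dP; rewrite -ball_normE /= distrC.
apply/nbhs_ballP; exists d => // y; rewrite -ball_normE /= distrC.
exact: dP.
Qed.

Lemma prod_norm_lt (E W : normedModType R) (a : E) (b : W) (d : R) :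
  (`|(a, b)| < d) = (`|a| < d) && (`|b| < d).
Proof. by rewrite prod_normE gt_max. Qed.

(** The centre moves by at most r / 2 and the contraction adds at most r / 2, so the closed ball is
    stable and Banach's theorem applies on it. *)
Lemma contraction_fixed_point (X : completeNormedModType R) (T : X -> X)
    (x0 : X) (r : R) : 0 < r ->
  (forall x x', `|x - x0| <= r -> `|x' - x0| <= r ->
    `|T x - T x'| <= 2^-1 * `|x - x'|) ->
  `|T x0 - x0| <= r / 2 ->
  exists2 x, `|x - x0| <= r & T x = x.
Proof.
move=> r0 Tlip Tx0; pose U := closed_ball x0 r.
have UE x : U x <-> `|x - x0| <= r.
  by rewrite /U closed_ballE // /closed_ball_ /= distrC.
have TU : isFun _ _ U U T.
  constructor => x /UE Ux; apply/UE.
  rewrite -(subrKA (T x0)); apply: le_trans (ler_normD _ _) _.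
  rewrite [leRHS]splitr; apply: lerD => //.
  apply: le_trans (Tlip _ _ Ux _) _; first by rewrite subrr normr0 ltW.
  by rewrite mulrC ler_pM2r.
pose f : {fun U >-> U} := HB.pack T TU.
have fc : is_contraction f.
  exists 2^-1%:nng; split => /=; first by rewrite invf_lt1 // ltr1n.
  by move=> [x y] [/UE Ux /UE Uy]; exact: Tlip.
have [||x Ux xE] := banach_fixed_point fc.
- exact: closed_ball_closed.
- by exists x0; apply/UE; rewrite subrr normr0 ltW.
- by exists x; [apply/UE|rewrite [RHS]xE].
Qed.

Variables (n : nat) (Y : normedModType R).
Variables (F : 'rV[R]_n * Y -> 'rV[R]_n) (M : 'M[R]_n) (K : R).
Hypotheses (M_unit : M \in unitmx) (K0 : 0 < K).
Hypothesis (invM : forall h : 'rV[R]_n, `|h *m invmx M| <= K * `|h|).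

Lemma norm_mulmx_inv (h : 'rV[R]_n) : `|h| <= K * `|h *m M|.
Proof. by rewrite -{1}[h](mulmxK M_unit). Qed.

(** [M] is a fixed matrix approximating the partial differential in x, not that differential itself.
    The estimate in [x] makes the true partial differential invertible; the estimate along [g] makes
    [g] Lipschitz at [y1], after which its differential can be identified. *)
Lemma implicit_diff (g : Y -> 'rV[R]_n) (y1 : Y) (e : R) : 0 < e ->
  K * e <= 4^-1 ->
  differentiable F (g y1, y1) ->
  (\forall y \near y1, F (g y, y) = 0) ->
  (\forall y \near y1,
    `|F (g y, y) - F (g y1, y) - (g y - g y1) *m M| <= e * `|g y - g y1|) ->
  (\forall x \near g y1,
    `|F (x, y1) - F (g y1, y1) - (x - g y1) *m M| <= e * `|x - g y1|) ->
  differentiable g y1 /\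
  forall k, 'd F (g y1, y1) ('d g y1 k, k) = 0.
Proof.
move=> e0 Ke dF Fg Fy Fx; set D := 'd F (g y1, y1).
have F1 : F (g y1, y1) = 0 by exact: (nbhs_singleton Fg).
have DE h k : D (h, k) = D (h, 0) + D (0, k).
  by rewrite -linearD; congr (D _); rewrite -[RHS]/(h + 0, 0 + k) addr0 add0r.
have D1M h : `|D (h, 0) - h *m M| <= (e + e) * `|h|.
  have [->|h0] := eqVneq h 0.
    by rewrite mul0mx subr0 normr0 mulr0 (_ : D (0, 0) = 0) ?normr0 // linear0.
  have hgt0 : 0 < `|h| by rewrite normr_gt0.
  have /near_norm[d1 d1gt0 Fd1] := differentiable_near dF e0.
  have /near_norm[d2 d2gt0 Fd2] := Fx.
  (* [h] is scaled into the neighborhood where both estimates hold; the bound is homogeneous, so [t]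
     cancels. *)
  pose t := Num.min d1 d2 / 2 / `|h|.
  have t0 : 0 < t by rewrite !divr_gt0 // lt_min d1gt0.
  have th : `|t *: h| < Num.min d1 d2.
    rewrite normrZ gtr0_norm // /t divfK ?gt_eqF //.
    by rewrite ltr_pdivrMr // ltr_pMr ?ltr1n // lt_min d1gt0.
  have := Fd2 (t *: h + g y1); rewrite addrK.
  move: th; rewrite lt_min => /andP[th1 th2] /(_ th2) Fd2'.
  have := Fd1 (t *: h + g y1, y1).
  have -> : (t *: h + g y1, y1) - (g y1, y1) = (t *: h, 0).
    by rewrite -[LHS]/(t *: h + g y1 - g y1, y1 - y1) addrK subrr.
  rewrite prod_normE normr0 max_l // => /(_ th1) Fd1'.
  rewrite -(ler_pM2l t0) -{1}(gtr0_norm t0) -normrZ scalerBr -linearZ /=.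
  have -> : t *: (h, 0) = (t *: h, 0) :> 'rV[R]_n * Y.
    by rewrite -[LHS]/(t *: h, t *: 0) scaler0.
  rewrite scalemxAl.
  rewrite -(subrKA (F (t *: h + g y1, y1) - F (g y1, y1))).
  apply: le_trans (ler_normD _ _) _.
  have tE : t * `|h| = `|t *: h| by rewrite normrZ gtr0_norm.
  by rewrite mulrCA mulrDl tE; apply: lerD => //; rewrite distrC.
pose D1 h := D (h, 0).
have D1lin : linear D1.
  move=> a h k; rewrite /D1 -linearP; congr (D _).
  by rewrite -[RHS]/(a *: h + k, a *: 0 + 0) scaler0 addr0.
pose D1l := GRing.isLinear.Build _ _ _ _ _ D1lin.
pose D1L : {linear 'rV[R]_n -> 'rV[R]_n} := HB.pack D1 D1l.
pose M1 := lin1_mx D1L.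
have M1E h : h *m M1 = D (h, 0) by rewrite mul_rV_lin1.
have M1_unit : M1 \in unitmx.
  apply: unitmx_inj => h; rewrite M1E => Dh; have := D1M h.
  rewrite Dh sub0r normrN => hM; apply/eqP; rewrite -normr_le0.
  have := le_trans (norm_mulmx_inv h) (ler_wpM2l (ltW K0) hM).
  have := normr_ge0 h; nra.
have [K1 K10 M1inv] := mulmx_bounded (invmx M1).
have [k0 k0gt0 Dk] := linear_lipschitz (diff_continuous dF).
(* Since K * e <= 1/4, the bound a <= K * (e * a + (k0 + 1) * b) gives a <= 4/3 * K * (k0 + 1) * b,
   which is rounded up. *)
pose C := 2 * K * (k0 + 1).
have C0 : 0 < C by rewrite !mulr_gt0 // addr_gt0.
have gC : \forall y \near y1, `|g y - g y1| <= C * `|y - y1|.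
  have /near_norm[d1 d1gt0 Fd1] := differentiable_near dF ltr01.
  near=> y.
  have Fyy : F (g y, y) = 0 by near: y.
  have : `|F (g y, y) - F (g y1, y) - (g y - g y1) *m M| <= e * `|g y - g y1|.
    by near: y.
  rewrite Fyy sub0r -opprD normrN => Fy'.
  have : `|F (g y1, y) - F (g y1, y1) - D (0, y - y1)| <= `|y - y1|.
    have := Fd1 (g y1, y).
    have -> : (g y1, y) - (g y1, y1) = (0, y - y1).
      by rewrite -[LHS]/(g y1 - g y1, y - y1) subrr.
    rewrite prod_normE normr0 max_r // mul1r; apply.
    by near: y; apply/near_norm; exists d1.
  rewrite F1 subr0 => Fy1.
  have FyC : `|F (g y1, y)| <= (k0 + 1) * `|y - y1|.
    rewrite -[F (g y1, y)](subrK (D (0, y - y1))).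
    apply: le_trans (ler_normD _ _) _; rewrite addrC mulrDl mul1r.
    apply: lerD => //; apply: le_trans (Dk _) _.
    by rewrite prod_normE normr0 max_r.
  have gM : `|(g y - g y1) *m M| <= e * `|g y - g y1| + (k0 + 1) * `|y - y1|.
    rewrite -[X in `|X|](addKr (F (g y1, y))) addrC.
    apply: le_trans (ler_normD _ _) _; rewrite normrN.
    by apply: lerD.
  have := le_trans (norm_mulmx_inv (g y - g y1)) (ler_wpM2l (ltW K0) gM).
  have := normr_ge0 (g y - g y1); rewrite /C.
  set a := `|g y - g y1|; set b := `|y - y1| => a0 aK.
  have : K * e * a <= 4^-1 * a by apply: ler_wpM2r.
  have : 0 <= K * ((k0 + 1) * b).
    by rewrite mulr_ge0 ?(ltW K0) // mulr_ge0 ?normr_ge0 // addr_ge0 // ltW.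
  by move: aK; nra.
(* Forced by [D (dg k, k) = 0], with [M1] the partial differential in x. *)
pose dg k := - (D (0, k) *m invmx M1).
have dglin : linear dg.
  move=> a h k; rewrite /dg scalerN -opprD scalemxAl -mulmxDl -linearP.
  congr (- (D _ *m _)).
  by rewrite -[RHS]/(a *: 0 + 0, a *: h + k) scaler0 addr0.
pose dgl := GRing.isLinear.Build _ _ _ _ _ dglin.
pose dgL : {linear Y -> 'rV[R]_n} := HB.pack dg dgl.
have dgc : continuous dgL.
  apply: bounded_linear_continuous; apply/linear_boundedP.
  exists (K1 * k0); split=> [|r /ltW Kr y]; first exact: num_real.
  rewrite /= normrN; apply: le_trans (M1inv _) _.
  apply: le_trans (ler_wpM2l (ltW K10) (Dk _)) _.
  rewrite prod_normE normr0 max_r // mulrA.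
  exact: ler_wpM2r.
have gdiff : is_diff y1 g dgL.
  apply: is_diff_near => // eps eps0.
  pose e' := eps / (K1 * (C + 1)).
  have KC0 : 0 < K1 * (C + 1) by rewrite mulr_gt0 // addr_gt0.
  have e'0 : 0 < e' by rewrite divr_gt0.
  have /near_norm[d1 d1gt0 Fd1] := differentiable_near dF e'0.
  near=> y.
  have Fyy : F (g y, y) = 0 by near: y.
  have gyC : `|g y - g y1| <= C * `|y - y1| by near: y.
  have DF : `|D (g y - g y1, y - y1)| <= e' * ((C + 1) * `|y - y1|).
    have := Fd1 (g y, y).
    have -> : (g y, y) - (g y1, y1) = (g y - g y1, y - y1) by [].
    rewrite Fyy F1 subr0 sub0r normrN => DF.
    have yC : `|(g y - g y1, y - y1)| <= (C + 1) * `|y - y1|.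
      rewrite prod_normE ge_max; apply/andP; split.
        by apply: le_trans gyC _; rewrite ler_wpM2r // lerDl.
      by rewrite ler_peMl // lerDr ltW.
    apply: le_trans (DF _) _; last by rewrite ler_pM2l.
    apply: le_lt_trans yC _; rewrite mulrC -ltr_pdivlMr ?addr_gt0 //.
    near: y; apply/near_norm; exists (d1 / (C + 1)) => //.
    by rewrite divr_gt0 // addr_gt0.
  have -> : g y - g y1 - dgL (y - y1) = D (g y - g y1, y - y1) *m invmx M1.
    by rewrite DE mulmxDl -M1E mulmxK //= /dg opprK.
  apply: le_trans (M1inv _) _.
  apply: le_trans (ler_wpM2l (ltW K10) DF) _.
  rewrite le_eqVlt; apply/orP; left; apply/eqP; rewrite /e'; field.
  by rewrite !gt_eqF // addr_gt0.
split; first by case: gdiff.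
move=> k; have -> : 'd g y1 k = dg k by case: gdiff => _ ->.
by rewrite DE -M1E /dg mulNmx mulmxKV // addNr.
Unshelve. all: by end_near. Qed.

End ImplicitFunction.

HB.instance Definition _ (R : realType) m n := NormedModule.on 'M[R]_(m, n).

(** Newton's iteration with a frozen derivative, [x - F (x, y) *m invmx M], is a contraction
    uniformly in [y]. The hypothesis on [F] is strict differentiability in [x], uniform in [y], so
    the same [M] serves at every point near the base point and [implicit_diff] applies at each
    nearby [y]. *)
Lemma implicit_function (R : realType) n (Y : normedModType R)
    (F : 'rV[R]_n * Y -> 'rV[R]_n) (M : 'M[R]_n) x0 y0 (rho : R) :
  M \in unitmx -> F (x0, y0) = 0 ->
  (forall e, 0 < e -> exists2 d, 0 < d & forall y x x',
    `|y - y0| < d -> `|x - x0| < d -> `|x' - x0| < d ->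
    `|F (x, y) - F (x', y) - (x - x') *m M| <= e * `|x - x'|) ->
  (\forall p \near (x0, y0), differentiable F p) -> 0 < rho ->
  exists (g : Y -> 'rV[R]_n) (r d : R),
    [/\ 0 < r <= rho, 0 < d <= rho,
        forall y, `|y - y0| < d -> `|g y - x0| < r /\ F (g y, y) = 0,
        forall x y, `|x - x0| < r -> `|y - y0| < d -> F (x, y) = 0 -> x = g y &
        forall y, `|y - y0| < d -> differentiable g y /\
          forall k, 'd F (g y, y) ('d g y k, k) = 0].
Proof.
move=> M_unit F0 Fstrict Fdiff rho0.
have [K K0 invM] := mulmx_bounded (invmx M).
(* With this [e] the iteration contracts by K * e = 1/4, which is also the bound required by
   [implicit_diff]. *)
pose e := (4 * K)^-1.
have e0 : 0 < e by rewrite invr_gt0 mulr_gt0.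
have Ke : K * e = 4^-1 by rewrite /e invfM mulrCA divff ?mulr1 // gt_eqF.
have [d1 d1gt0 Fe] := Fstrict e e0.
have /near_norm[d2 d2gt0 Fd] := Fdiff.
pose r := Num.min rho (Num.min d1 d2) / 2.
have m0 : 0 < Num.min rho (Num.min d1 d2) by rewrite !lt_min rho0 d1gt0.
have r0 : 0 < r by rewrite divr_gt0.
have /andP[rrho /andP[rd1 rd2]] : (r < rho) && ((r < d1) && (r < d2)).
  by rewrite -!lt_min ltr_pdivrMr // ltr_pMr // ltr1n.
have F00 : \forall y \near y0, `|F (x0, y)| < r / (2 * K).
  have Fc : F p @[p --> (x0, y0)] --> (0 : 'rV[R]_n).
    rewrite -F0; apply: differentiable_continuous; exact: (nbhs_singleton Fdiff).
  have c0 : 0 < r / (2 * K) by rewrite divr_gt0 // mulr_gt0.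
  move: Fc => /cvgr0_norm_lt /(_ _ c0).
  move=> /near_norm[d3 d3gt0 F3]; apply/near_norm; exists d3 => // y yd.
  apply: F3; rewrite -[X in `|X|]/((x0 - x0, y - y0)) prod_norm_lt subrr.
  by rewrite normr0 d3gt0.
have /near_norm[d3 d3gt0 F3] := F00.
pose d := Num.min r d3.
have d0 : 0 < d by rewrite lt_min r0.
have dr y : `|y - y0| < d -> `|y - y0| < r by rewrite lt_min => /andP[].
have Fer x x' y : `|x - x0| <= r -> `|x' - x0| <= r -> `|y - y0| < d ->
    `|F (x, y) - F (x', y) - (x - x') *m M| <= e * `|x - x'|.
  move=> xr x'r /dr yr; apply: Fe.
  - exact: lt_trans yr rd1.
  - exact: le_lt_trans xr rd1.
  - exact: le_lt_trans x'r rd1.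
have fixE x y : F (x, y) = 0 <-> x - F (x, y) *m invmx M = x.
  split=> [->|/eqP]; first by rewrite mul0mx subr0.
  rewrite -subr_eq0 addrAC subrr add0r oppr_eq0 => /eqP FM.
  by rewrite -(mulmxKV M_unit (F (x, y))) FM mul0mx.
have Tlip y x x' : `|y - y0| < d -> `|x - x0| <= r -> `|x' - x0| <= r ->
    `|(x - F (x, y) *m invmx M) - (x' - F (x', y) *m invmx M)| <=
    2^-1 * `|x - x'|.
  move=> yd xr x'r.
  have -> : (x - F (x, y) *m invmx M) - (x' - F (x', y) *m invmx M) =
      - ((F (x, y) - F (x', y) - (x - x') *m M) *m invmx M).
    rewrite [in RHS]mulmxBl (mulmxK M_unit) mulmxBl !opprB.
    by rewrite addrACA [RHS]addrACA [- x' - _]addrC.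
  rewrite normrN; apply: le_trans (invM _) _.
  have := ler_wpM2l (ltW K0) (Fer _ _ _ xr x'r yd).
  by rewrite mulrA Ke => /le_trans; apply; apply: ler_wpM2r => //; lra.
have T0 y : `|y - y0| < d -> `|F (x0, y) *m invmx M| < r / 2.
  rewrite lt_min => /andP[_ /F3 Fy]; apply: le_lt_trans (invM _) _.
  by rewrite mulrC -ltr_pdivlMr // -mulrA -invfM.
(* The condition on [y] stays under the existential so that choice gives a function on all of
   [Y]. *)
have ex y : exists x, `|y - y0| < d -> `|x - x0| < r /\ F (x, y) = 0.
  have [yd|//] := pselect (`|y - y0| < d); last by exists x0.
  have [||x xr xE] := @contraction_fixed_point R 'rV[R]_n
    (fun x => x - F (x, y) *m invmx M) x0 r r0.
  - by move=> x x'; exact: Tlip.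
  - by rewrite addrAC subrr add0r normrN ltW // T0.
  exists x => _; split; last exact/fixE.
  (* The strict bound [T0] at the centre puts the fixed point in the open ball. *)
  rewrite -[x in x - x0]xE -(subrKA (x0 - F (x0, y) *m invmx M)).
  apply: le_lt_trans (ler_normD _ _) _; rewrite [ltRHS]splitr.
  apply: ler_ltD.
    apply: le_trans (Tlip _ _ _ yd xr _) _; first by rewrite subrr normr0 ltW.
    by rewrite mulrC ler_pM2r.
  by rewrite addrAC subrr add0r normrN T0.
have [g gP] := choice ex.
have gu x y : `|x - x0| < r -> `|y - y0| < d -> F (x, y) = 0 -> x = g y.
  move=> xr yd /fixE Fx; have [gr /fixE Fg] := gP y yd.
  have := Tlip y x (g y) yd (ltW xr) (ltW gr); rewrite Fx Fg => xg.
  apply/subr0_eq/eqP; rewrite -normr_le0.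
  by have := normr_ge0 (x - g y); lra.
have gd y : `|y - y0| < d -> \forall z \near y, `|z - y0| < d.
  move=> yd; apply/near_norm; exists (d - `|y - y0|); first by rewrite subr_gt0.
  move=> z zy; rewrite -(subrKA y); apply: le_lt_trans (ler_normD _ _) _.
  by rewrite -ltrBrDr.
exists g, r, d; split => //.
- by rewrite r0 ltW.
- by rewrite d0 ge_min ltW // ltW.
move=> y yd; have [gr Fg] := gP y yd.
have dF : differentiable F (g y, y).
  apply: Fd; rewrite -[X in `|X|]/((g y - x0, y - y0)) prod_norm_lt.
  by rewrite (lt_trans gr) //= (lt_trans (dr _ yd)).
apply: (implicit_diff M_unit K0 invM e0) => //.
- by rewrite Ke.
- by apply: filterS (gd y yd) => z /gP[].
- apply: filterS (gd y yd) => z zd; apply: Fer => //; apply: ltW => //.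
  by have [] := gP z zd.
- apply/near_norm; exists (r - `|g y - x0|); first by rewrite subr_gt0.
  move=> x xg; apply: Fer => //; apply: ltW => //.
  rewrite -(subrKA (g y)); apply: le_lt_trans (ler_normD _ _) _.
  by rewrite -ltrBrDr.
Qed.

(** * The pitchfork in the plane *)

Section RealLemmas.
Variable R : realType.
Implicit Types (f df : R -> R).

Lemma is_derive_near f (x m : R) :
  (forall e, 0 < e -> \forall y \near x, `|f y - f x - m * (y - x)| <= e * `|y - x|) ->
  is_derive x 1 f m.
Proof.
move=> fm.
have ml : linear (fun h : R => m * h : R).
  by move=> a u v; rewrite mulrDr [a *: u]/(a * u) mulrCA.
pose mL : {linear R -> R} := HB.pack (fun h : R => m * h : R)
  (GRing.isLinear.Build _ _ _ _ _ ml).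
have mc : continuous mL by move=> y; apply: mulrl_continuous.
have [df dfE] := is_diff_near mc fm.
apply: DeriveDef; first exact/derivable1_diffP.
by rewrite deriveE // dfE /= mulr1.
Qed.

Lemma mean_value_between f df (r a b : R) :
  (forall x : R, `|x| < r -> is_derive x 1 f (df x)) -> `|a| < r -> `|b| < r ->
  exists2 c, (a <= c <= b) || (b <= c <= a) & f b - f a = df c * (b - a).
Proof.
move=> fdf.
wlog ab : a b / a <= b.
  move=> H ar br; have [/H|/ltW /H] := leP a b; first exact.
  move=> /(_ br ar)[c cab E]; exists c; first by rewrite orbC.
  by rewrite -opprB E -mulrN opprB.
move=> ar br.
have inr x : x \in `[a, b]%R -> `|x| < r.
  rewrite in_itv /= => /andP[ax xb]; rewrite ltr_norml.
  move: ar br; rewrite !ltr_norml => /andP[ra _] /andP[_ br].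
  by rewrite (lt_le_trans ra ax) (le_lt_trans xb br).
have dab (x : R) : x \in `]a, b[%R -> is_derive x 1 f (df x).
  by move=> xab; apply/fdf/inr; exact: subset_itv_oo_cc.
have cab : {within `[a, b], continuous f}.
  by apply: derivable_within_continuous => x /inr /fdf [].
have [c] := MVT_segment ab dab cab.
by rewrite in_itv /= => cab' E; exists c; rewrite ?cab'.
Qed.

Lemma between_norm (a b c r : R) : (a <= c <= b) || (b <= c <= a) ->
  `|a| <= r -> `|b| <= r -> `|c| <= r.
Proof.
by move=> abc; rewrite !ler_norml; lra.
Qed.

Lemma between_dist (a b c : R) : (a <= c <= b) || (b <= c <= a) ->
  `|c - a| <= `|b - a|.
Proof. by move=> abc; rewrite ler_norml; case: (ger0P (b - a)); lra. Qed.

Lemma zero_between f df (r a b : R) :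
  (forall x : R, `|x| < r -> is_derive x 1 f (df x)) -> `|a| < r -> `|b| < r ->
  a <= b -> f a * f b < 0 -> exists2 c, a < c < b & f c = 0.
Proof.
move=> fdf ar br ab fab.
have inr x : x \in `[a, b]%R -> `|x| < r.
  rewrite in_itv /= => /andP[ax xb]; rewrite ltr_norml.
  move: ar br; rewrite !ltr_norml => /andP[ra _] /andP[_ br].
  by rewrite (lt_le_trans ra ax) (le_lt_trans xb br).
have cab : {within `[a, b], continuous f}.
  by apply: derivable_within_continuous => x /inr /fdf [].
have [|c] := IVT ab cab (v := 0).
  by case: (leP (f a) (f b)) => fafb; apply/andP; split; nra.
rewrite in_itv /= => /andP[ac cb] fc; exists c => //.
rewrite !lt_neqAle ac cb !andbT; apply/andP; split.
  by apply/eqP => aE; move: fab; rewrite aE fc mul0r ltxx.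
by apply/eqP => bE; move: fab; rewrite -bE fc mulr0 ltxx.
Qed.

End RealLemmas.

(** * Zeros of a planar function with quadratic part [s * e + c / 2 * e ^ 2] *)

Section PlanarPitchfork.
Variables (R : realType) (g fs fe : R -> R -> R) (rho b c : R).
Hypothesis rho0 : 0 < rho.
Hypothesis g_s : forall s e : R, `|s| < rho -> `|e| < rho ->
  is_derive s 1 (g^~ e) (fs s e).
Hypothesis g_e : forall s e : R, `|s| < rho -> `|e| < rho ->
  is_derive e 1 (g s) (fe s e).
Hypothesis fs_cont : forall s e : R, `|s| < rho -> `|e| < rho ->
  {for (s, e), continuous (fun q : R * R => fs q.1 q.2)}.
Hypothesis fe_cont : forall s e : R, `|s| < rho -> `|e| < rho ->
  {for (s, e), continuous (fun q : R * R => fe q.1 q.2)}.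
Hypothesis g00 : g 0 0 = 0.
(* [g] has been divided by its mixed derivative at the origin, and its second
   derivative in [s] vanishes there. *)
Hypothesis fs_lin : forall k : R, 0 < k -> exists2 d : R, 0 < d &
  forall s e : R, `|s| < d -> `|e| < d -> `|fs s e - e| <= k * (`|s| + `|e|).
Hypothesis fe_lin : forall k : R, 0 < k -> exists2 d : R, 0 < d &
  forall s e : R, `|s| < d -> `|e| < d ->
  `|fe s e - (b * s + c * e)| <= k * (`|s| + `|e|).

(* Both sides are [(g t t - g t 0 - g 0 t + g 0 0) / t ^ 2] in the limit. *)
Lemma mixed_derivative_eq1 : b = 1.
Proof.
(* Four uses of the linear estimates at distance at most [t] cost 2, 1, 2 and 1 times k * t. *)
have key k : 0 < k -> `|b - 1| <= 6 * k.
  move=> k0; have [d1 d1gt0 fsk] := fs_lin k0; have [d2 d2gt0 fek] := fe_lin k0.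
  pose t := Num.min rho (Num.min d1 d2) / 2.
  have m0 : 0 < Num.min rho (Num.min d1 d2) by rewrite !lt_min rho0 d1gt0.
  have t0 : 0 < t by rewrite divr_gt0.
  have /andP[trho /andP[td1 td2]] : (t < rho) && ((t < d1) && (t < d2)).
    by rewrite -!lt_min ltr_pdivrMr // ltr_pMr // ltr1n.
  have tn : `|t| < rho by rewrite gtr0_norm.
  have zn : `|0 : R| < rho by rewrite normr0.
  have phi_d (s : R) : `|s| < rho ->
      is_derive s 1 (fun s => g s t - g s 0) (fs s t - fs s 0).
    by move=> sr; apply: is_deriveB; exact: g_s.
  have psi_d (e : R) : `|e| < rho ->
      is_derive e 1 (fun e => g t e - g 0 e) (fe t e - fe 0 e).
    by move=> er; apply: is_deriveB; exact: g_e.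
  have [s s0t] := mean_value_between phi_d zn tn.
  have [e e0t] := mean_value_between psi_d zn tn.
  rewrite !subr0 => psiE phiE.
  have st : `|s| <= t.
    by apply: between_norm s0t _ _; rewrite ?normr0 ?(gtr0_norm t0) // ltW.
  have et : `|e| <= t.
    by apply: between_norm e0t _ _; rewrite ?normr0 ?(gtr0_norm t0) // ltW.
  have := fsk s t (le_lt_trans st td1); rewrite gtr0_norm // => /(_ td1) f1.
  have := fsk s 0 (le_lt_trans st td1); rewrite normr0 => /(_ d1gt0) f2.
  have := fek t e; rewrite gtr0_norm // => /(_ td2 (le_lt_trans et td2)) f3.
  have := fek 0 e; rewrite normr0 => /(_ d2gt0 (le_lt_trans et td2)) f4.
  have E : fs s t - fs s 0 = fe t e - fe 0 e.
    by apply: (mulIf (lt0r_neq0 t0)); rewrite -psiE -phiE; ring.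
  have kt : 0 < k * t by rewrite mulr_gt0.
  have ks : k * `|s| <= k * t by rewrite ler_pM2l.
  have ke : k * `|e| <= k * t by rewrite ler_pM2l.
  have : `|(b - 1) * t| <= 6 * k * t.
    move: f1 f2 f3 f4; rewrite !ler_norml; lra.
  by rewrite normrM (gtr0_norm t0) ler_pM2r.
apply/subr0_eq/eqP; rewrite -normr_le0; apply/ler_addgt0Pl => e e0.
by rewrite addr0; have := key (e / 6); lra.
Qed.

Variables (sigma rho1 : R).
Hypothesis sigma2 : sigma * sigma = 1.
Hypothesis rho1_gt0 : 0 < rho1.
Hypothesis g_sign : forall s, 0 < `|s| < rho1 -> sigma * (s * g s 0) < 0.

(* In the cone [|s| <= K |e|] the derivative [fs] is close to [e], so [g] has one
   zero in [s]; outside the cone [g s e - g s 0] has the sign of [s * e]. *)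
Let K := 4 * (`|c| + 1).
Let k0 := (16 * (2 * K + 1))^-1.

Let K_ge4 : 4 <= K.
Proof. by rewrite /K; have := normr_ge0 c; lra. Qed.

Let k0_gt0 : 0 < k0.
Proof. by rewrite invr_gt0; have := K_ge4; lra. Qed.

Let k0K : k0 * (2 * K + 1) = 16^-1.
Proof.
have K1 : 2 * K + 1 != 0 by rewrite gt_eqF //; have := K_ge4; lra.
by rewrite /k0; field.
Qed.

Section Box.
Variable r : R.
Hypotheses (r0 : 0 < r) (r_rho : r <= rho) (r_rho1 : r <= rho1).
Hypothesis fs_r : forall s e : R, `|s| < r -> `|e| < r ->
  `|fs s e - e| <= k0 * (`|s| + `|e|).
Hypothesis fe_r : forall s e : R, `|s| < r -> `|e| < r ->
  `|fe s e - (s + c * e)| <= k0 * (`|s| + `|e|).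

Let gs_r (e : R) : `|e| < r -> forall s : R, `|s| < r ->
  is_derive s 1 (g^~ e) (fs s e).
Proof. by move=> er s sr; apply: g_s; exact: lt_le_trans r_rho. Qed.

Let ge_r (s : R) : `|s| < r -> forall e : R, `|e| < r ->
  is_derive e 1 (g s) (fe s e).
Proof. by move=> sr e er; apply: g_e => //; exact: lt_le_trans r_rho. Qed.

Let zr : `|0 : R| < r. Proof. by rewrite normr0. Qed.

(** This tunes [k0]: in the doubled cone the error is at most k0 * (2 * K + 1) * |e|. *)
Lemma cone_fs (s e : R) : `|s| < r -> `|e| < r -> `|s| <= 2 * K * `|e| ->
  `|fs s e - e| <= 16^-1 * `|e|.
Proof.
move=> sr er sKe; apply: le_trans (fs_r sr er) _.
by rewrite -k0K -mulrA ler_pM2l // mulrDl mul1r lerD2r.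
Qed.

Lemma cone_fs_ge (s e : R) : `|s| < r -> `|e| < r -> `|s| <= 2 * K * `|e| ->
  7 / 8 * (e * e) <= e * fs s e.
Proof.
move=> sr er sKe; have := cone_fs sr er sKe.
have [e0|e0] := leP 0 e; [rewrite (ger0_norm e0)|rewrite (ltr0_norm e0)];
  by rewrite ler_norml => /andP[]; nra.
Qed.

(** On the axis |fe 0 t| is at most (|c| + 1) * |t|, because [k0 <= 1]. The resulting constant is K
    / 4, which is where [K] comes from. *)
Lemma g0_bound (e : R) : `|e| < r -> `|g 0 e| <= (`|c| + 1) * (e * e).
Proof.
move=> er; have [t t0e] := mean_value_between (ge_r zr) zr er.
rewrite g00 !subr0 => ->.
have te : `|t| <= `|e| by apply: between_norm t0e _ _; rewrite ?normr0.
have := fe_r zr (le_lt_trans te er).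
rewrite normr0 !add0r => ft.
have k1 : k0 <= 1.
  by have := k0K; have := k0_gt0; have := K_ge4; nra.
rewrite normrM; have -> : e * e = `|e| * `|e| by rewrite -normrM ger0_norm // sqr_ge0.
rewrite mulrA; apply: ler_wpM2r => //.
rewrite -(subrK (c * t) (fe 0 t)); apply: le_trans (ler_normD _ _) _.
rewrite addrC mulrDl mul1r normrM; apply: lerD; first exact: ler_wpM2l.
by apply: le_trans ft _; have := normr_ge0 t; nra.
Qed.

(** From the axis to |s| = K * |e| the function changes by at least 7/8 * K * e ^ 2, in the
    direction of the sign of [s * e]; this beats |g 0 e| <= K / 4 * e ^ 2. *)
Lemma cone_boundary (s e : R) : `|s| < r -> `|e| < r -> `|s| = K * `|e| ->
  e != 0 -> 0 < s * e * g s e.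
Proof.
move=> sr er sK e0.
have [t t0s] := mean_value_between (gs_r er) zr sr.
rewrite subr0 => gE.
have ts : `|t| <= `|s| by apply: between_norm t0s _ _; rewrite ?normr0.
have en : 0 < `|e| by rewrite normr_gt0.
have K4 := K_ge4.
have tK : `|t| <= 2 * K * `|e| by rewrite (le_trans ts) // sK; nra.
have := cone_fs_ge (le_lt_trans ts sr) er tK => fst_.
have := g0_bound er => g0e.
have ee : e * e = `|e| * `|e| by rewrite -normrM ger0_norm // sqr_ge0.
have ss : s * s = K * K * (e * e).
  have -> : s * s = `|s| * `|s| by rewrite -normrM ger0_norm // sqr_ge0.
  by rewrite sK ee; ring.
have e2 : 0 < e * e by rewrite ee mulr_gt0.
have seg : `|s * e * g 0 e| <= K * (e * e) * ((K / 4) * (e * e)).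
  rewrite !normrM sK -mulrA [K * `|e| * _]mulrA -[K * `|e| * `|e|]mulrA -ee.
  apply: ler_wpM2l; first by rewrite mulr_ge0 // ltW //; lra.
  by have -> : K / 4 = `|c| + 1; [rewrite /K; field | exact: g0e].
have -> : s * e * g s e = s * e * g 0 e + s * s * (e * fs t e).
  by rewrite -[g s e](subrK (g 0 e)) gE; ring.
have : K * K * (e * e) * (7 / 8 * (e * e)) <= s * s * (e * fs t e).
  rewrite ss; apply: ler_wpM2l => //.
    by apply: mulr_ge0; [apply: mulr_ge0; lra|exact: ltW].
move: seg; rewrite ler_norml => /andP[seg _] sse.
have : 0 < K * (e * e) * (e * e) * (7 / 8 * K - K / 4).
  apply: mulr_gt0; last by lra.
    by apply: mulr_gt0 => //; apply: mulr_gt0 => //; lra.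
by move: seg sse; lra.
Qed.

(** The difference is [e * fe s t] for some [t] between 0 and [e]. Since [e] is small against [s],
    [fe s t] equals [s] up to |c * t| <= |s| / 4 and an error of |s| / 8. *)
Lemma outside_cone (s e : R) : `|s| < r -> `|e| < r -> K * `|e| <= `|s| ->
  e != 0 -> 0 < s * e * (g s e - g s 0).
Proof.
move=> sr er eK e0.
have [t t0e] := mean_value_between (ge_r sr) zr er.
rewrite subr0 => gE.
have te : `|t| <= `|e| by apply: between_norm t0e _ _; rewrite ?normr0.
have en : 0 < `|e| by rewrite normr_gt0.
have K4 := K_ge4.
have sn : 0 < `|s| by nra.
have ft := fe_r sr (le_lt_trans te er).
have ss : s * s = `|s| * `|s| by rewrite -normrM ger0_norm // sqr_ge0.
have ct : `|c * t| <= 4^-1 * `|s|.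
  rewrite normrM; have c0 := normr_ge0 c; have t0 := normr_ge0 t.
  have ce : `|c| * `|t| <= `|c| * `|e| by apply: ler_wpM2l.
  by move: eK; rewrite /K; nra.
have k16 : k0 <= 16^-1 by have := k0K; have := k0_gt0; nra.
have tst : `|t| <= `|s| by nra.
have fss : `|fe s t - s| <= 2^-1 * `|s|.
  rewrite -(subrK (c * t) (fe s t - s)); apply: le_trans (ler_normD _ _) _.
  have : `|fe s t - s - c * t| <= 8^-1 * `|s|.
    rewrite -addrA -opprD; apply: le_trans ft _.
    by have := k0_gt0; have := normr_ge0 t; nra.
  by move: ct; lra.
have sfe : 2^-1 * (s * s) <= s * fe s t.
  move: fss; have [s0|s0] := leP 0 s; [rewrite (ger0_norm s0)|rewrite (ltr0_norm s0)];
  by rewrite ler_norml => /andP[]; nra.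
have -> : s * e * (g s e - g s 0) = e * e * (s * fe s t) by rewrite gE; ring.
apply: mulr_gt0; first by rewrite -expr2 exprn_even_gt0.
by apply: lt_le_trans sfe; rewrite ss !mulr_gt0.
Qed.

(** On the doubled cone [fs] has the sign of [e], so [g] is strictly monotone in [s]. *)
Lemma cone_zero_unique (s t e : R) : `|s| < r -> `|t| < r -> `|e| < r ->
  e != 0 -> `|s| <= 2 * K * `|e| -> `|t| <= 2 * K * `|e| ->
  g s e = 0 -> g t e = 0 -> s = t.
Proof.
move=> sr tr er e0 sK tK gs gt.
have [u ust] := mean_value_between (gs_r er) sr tr.
rewrite gs gt subrr => /esym/eqP; rewrite mulf_eq0 => /orP[|].
  have uK : `|u| <= 2 * K * `|e| by apply: between_norm ust _ _.
  have ur : `|u| < r.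
    have : `|u| <= Num.max `|s| `|t|.
      by apply: between_norm ust _ _; rewrite le_max lexx ?orbT.
    by move=> /le_lt_trans; apply; rewrite gt_max sr.
  have := cone_fs_ge ur er uK.
  have : 0 < e * e by rewrite -expr2 exprn_even_gt0.
  by move=> ee + /eqP f0; rewrite f0 mulr0; lra.
by rewrite subr_eq0 => /eqP.
Qed.

(** By [cone_boundary] the values at the two ends of the cone have opposite signs. *)
Lemma cone_zero_exists (e : R) : K * `|e| < r -> `|e| < r ->
  exists s, `|s| <= K * `|e| /\ g s e = 0.
Proof.
move=> Ker er; have [->|e0] := eqVneq e 0.
  by exists 0; rewrite !normr0 mulr0.
have en : 0 < `|e| by rewrite normr_gt0.
have K4 := K_ge4.
have Ke0 : 0 <= K * `|e| by rewrite mulr_ge0 //; lra.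
have n1 : `|K * `|e| | = K * `|e| by rewrite ger0_norm.
have n2 : `|- (K * `|e|)| = K * `|e| by rewrite normrN.
have r1 : `|K * `|e| | < r by rewrite n1.
have r2 : `|- (K * `|e|)| < r by rewrite n2.
have c1 := cone_boundary r1 er n1 e0.
have c2 := cone_boundary r2 er n2 e0.
have [||s /andP[s1 s2] gs] := zero_between (gs_r er) r2 r1.
- by lra.
- have : 0 < K * `|e| * e * (K * `|e| * e).
    by rewrite -expr2 exprn_even_gt0 // !mulf_neq0 // gt_eqF //; lra.
  move: c1 c2; set a := g _ e; set a' := g _ e; set x := K * `|e| * e.
  by rewrite !mulNr -/x => c1 c2 xx; nra.
by exists s; split => //; rewrite ler_norml !ltW.
Qed.

Section Branch.
Variables (d : R) (xi : R -> R).
Hypotheses (d0 : 0 < d) (dK : 2 * K * d <= r).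
Hypothesis xiP : forall e : R, `|e| < d -> `|xi e| <= K * `|e| /\ g (xi e) e = 0.

Let dr : d <= r.
Proof.
apply: le_trans dK; rewrite ler_peMl ?(ltW d0) //.
by have := K_ge4; lra.
Qed.

Let er (e : R) : `|e| < d -> `|e| < r.
Proof. by move/lt_le_trans; apply; exact: dr. Qed.

Let cone_r (s e : R) : `|e| < d -> `|s| <= 2 * K * `|e| -> `|s| < r.
Proof.
move=> ed /le_lt_trans; apply; apply: lt_le_trans dK.
by rewrite ltr_pM2l //; have := K_ge4; lra.
Qed.

Let xi_cone (e : R) : `|e| < d -> `|xi e| <= 2 * K * `|e|.
Proof.
move=> /xiP[xiK _]; apply: le_trans xiK _; apply: ler_wpM2r => //.
by have := K_ge4; lra.
Qed.

Let xi_r (e : R) : `|e| < d -> `|xi e| < r.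
Proof. by move=> ed; apply: cone_r (xi_cone ed). Qed.

(** At e = 0 both partial derivatives vanish. The value there is the slope of s = - (c / 2) * e, the
    line other than e = 0 on which the quadratic part vanishes. *)
Definition branch_slope (e : R) :=
  if e == 0 then - (c / 2) else - (fe (xi e) e / fs (xi e) e).

Lemma branch0 : xi 0 = 0.
Proof.
have [|] := xiP (e := 0); first by rewrite normr0.
by rewrite normr0 mulr0 normr_le0 => /eqP.
Qed.

Let fs_norm (s e : R) : `|e| < d -> `|s| <= 2 * K * `|e| ->
  7 / 8 * `|e| <= `|fs s e|.
Proof.
move=> ed sK; have fsK := cone_fs_ge (cone_r ed sK) (er ed) sK.
have [->|e0] := eqVneq e 0; first by rewrite normr0 mulr0.
have en : 0 < `|e| by rewrite normr_gt0.
rewrite -(ler_pM2r en).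
have : e * fs s e <= `|fs s e| * `|e| by rewrite mulrC -normrM ler_norm.
have -> : 7 / 8 * `|e| * `|e| = 7 / 8 * (e * e).
  by rewrite -mulrA -normrM (ger0_norm (sqr_ge0 e)).
exact: le_trans fsK.
Qed.

Lemma branch_fs_neq0 (e : R) : `|e| < d -> e != 0 -> fs (xi e) e != 0.
Proof.
move=> ed e0; rewrite -normr_gt0; apply: lt_le_trans (fs_norm ed (xi_cone ed)).
by rewrite mulr_gt0 // normr_gt0.
Qed.

(** Mean value theorem along two legs: in the parameter from (xi e1, e1) to (xi e1, e), then in [s]
    to (xi e, e). The condition on [e1] keeps the second leg in the doubled cone at [e], where [fs]
    is bounded below. *)
Let increment (e1 e : R) : `|e1| < d -> `|e| < d -> `|e1| <= 2 * `|e| ->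
  exists s t,
    [/\ (xi e1 <= s <= xi e) || (xi e <= s <= xi e1),
        (e1 <= t <= e) || (e <= t <= e1), 7 / 8 * `|e| <= `|fs s e| &
        fs s e * (xi e - xi e1) + fe (xi e1) t * (e - e1) = 0].
Proof.
move=> e1d ed e12.
have [s ss sE] := mean_value_between (gs_r (er ed)) (xi_r e1d) (xi_r ed).
have [t tt tE] := mean_value_between (ge_r (xi_r e1d)) (er e1d) (er ed).
exists s, t; split => //.
  apply: fs_norm => //; apply: between_norm ss _ _; last exact: xi_cone.
  have [xiK _] := xiP e1d; apply: le_trans xiK _.
  by have := K_ge4; nra.
by rewrite -sE -tE (xiP e1d).2 (xiP ed).2; ring.
Qed.

Let near_branch (e1 : R) : `|e1| < d -> e1 != 0 ->
  \forall e \near e1, [/\ `|e| < d, `|e1| <= 2 * `|e| & e != 0].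
Proof.
move=> e1d e10; have en : 0 < `|e1| by rewrite normr_gt0.
apply/near_norm; exists (Num.min (`|e1| / 2) (d - `|e1|)).
  by rewrite lt_min divr_gt0 //= subr_gt0.
move=> e; rewrite lt_min => /andP[ee1 ee2].
have e1e : `|e1| <= `|e| + `|e - e1|.
  by rewrite -{1}[e1](subKr e); apply: ler_normB.
have ee : `|e| <= `|e1| + `|e - e1|.
  by rewrite -{1}[e](subrKC e1); apply: ler_normD.
have ee3 : `|e1| <= 2 * `|e| by lra.
by split => //; [lra|rewrite -normr_gt0; lra].
Qed.

Let branch_lip (e1 : R) : `|e1| < d -> e1 != 0 ->
  exists2 C : R, 0 < C & \forall e \near e1, `|xi e - xi e1| <= C * `|e - e1|.
Proof.
move=> e1d e10; have en : 0 < `|e1| by rewrite normr_gt0.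
(* [B] bounds |fe| on the box, while |fs| >= 7/8 * |e| >= 7/16 * |e1|; the relation of [increment]
   then gives the Lipschitz constant. *)
pose B := (1 + `|c| + 2 * k0) * r.
have c0 := normr_ge0 c.
have B0 : 0 < B by rewrite mulr_gt0 //; have := k0_gt0; lra.
exists (B / (7 / 16 * `|e1|)); first by rewrite divr_gt0 // mulr_gt0.
apply: filterS (near_branch e1d e10) => e [ed e12 e0].
have [s [t [_ tt fsn /eqP]]] := increment e1d ed e12.
rewrite addr_eq0 => /eqP E.
have tr : `|t| < r.
  have : `|t| <= Num.max `|e1| `|e|.
    by apply: between_norm tt _ _; rewrite le_max lexx ?orbT.
  by move=> /le_lt_trans; apply; rewrite gt_max !er.
have feB : `|fe (xi e1) t| <= B.
  rewrite -(subrK (xi e1 + c * t) (fe _ _)); apply: le_trans (ler_normD _ _) _.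
  have := fe_r (xi_r e1d) tr; have := ler_normD (xi e1) (c * t).
  rewrite normrM; have := xi_r e1d; have := k0_gt0; move: tr c0.
  by rewrite /B; nra.
rewrite -(ler_pM2l (_ : 0 < 7 / 16 * `|e1|)); last by rewrite mulr_gt0.
rewrite mulrA mulrCA divff ?mulr1; last by rewrite gt_eqF // mulr_gt0.
apply: (@le_trans _ _ (`|fs s e| * `|xi e - xi e1|)).
  by apply: ler_wpM2r => //; apply: le_trans fsn; lra.
by rewrite -normrM E normrN normrM; apply: ler_wpM2r.
Qed.

Let is_derive_branch_neq0 (e1 : R) : `|e1| < d -> e1 != 0 ->
  is_derive e1 1 xi (branch_slope e1).
Proof.
move=> e1d e10; rewrite /branch_slope (negbTE e10).
have [C C0 xiC] := branch_lip e1d e10.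
have f10 := branch_fs_neq0 e1d e10.
have f1n : 0 < `|fs (xi e1) e1| by rewrite normr_gt0.
have rr (x : R) : `|x| < r -> `|x| < rho by move/lt_le_trans; apply.
apply: is_derive_near => k kgt0.
pose k' := k * `|fs (xi e1) e1| / (C + 1).
have k'0 : 0 < k' by rewrite divr_gt0 ?mulr_gt0 // addr_gt0.
have /cvgrPdist_le /(_ _ k'0) /near_norm[a a0 fsa] :=
  fs_cont (rr _ (xi_r e1d)) (rr _ (er e1d)).
have /cvgrPdist_le /(_ _ k'0) /near_norm[a' a'0 fea] :=
  fe_cont (rr _ (xi_r e1d)) (rr _ (er e1d)).
have nea : \forall e \near e1, `|e - e1| < Num.min a a' / (C + 1).
  apply/near_norm; exists (Num.min a a' / (C + 1)) => //.
  by rewrite divr_gt0 ?addr_gt0 // lt_min a0.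
near=> e.
have [ed e12 e0] : [/\ `|e| < d, `|e1| <= 2 * `|e| & e != 0].
  by near: e; exact: near_branch.
have xiCe : `|xi e - xi e1| <= C * `|e - e1| by near: e.
have ea : (C + 1) * `|e - e1| < Num.min a a'.
  rewrite mulrC -ltr_pdivlMr ?addr_gt0 //.
  by near: e.
have en := normr_ge0 (e - e1).
have Ce : 0 <= C * `|e - e1| by rewrite mulr_ge0 // ltW.
move: ea; rewrite mulrDl mul1r lt_min => /andP[ea ea'].
have [s [t [ss tt fsn E]]] := increment e1d ed e12.
have se1 : `|s - xi e1| <= `|xi e - xi e1|.
  exact: between_dist.
have te1 : `|t - e1| <= `|e - e1|.
  exact: between_dist.
have fse : `|fs (xi e1) e1 - fs s e| <= k'.
  apply: (fsa (s, e)).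
  rewrite -[X in `|X|]/((s - xi e1, e - e1)) prod_norm_lt; apply/andP; split.
    by apply: le_lt_trans (le_trans se1 xiCe) _; apply: le_lt_trans ea; rewrite lerDl.
  by apply: le_lt_trans ea; rewrite lerDr.
have fee : `|fe (xi e1) e1 - fe (xi e1) t| <= k'.
  apply: (fea (xi e1, t)).
  rewrite -[X in `|X|]/((xi e1 - xi e1, t - e1)) prod_norm_lt subrr normr0 a'0.
  by apply: le_lt_trans te1 _; apply: le_lt_trans ea'; rewrite lerDr.
rewrite -(ler_pM2l f1n) -normrM.
(* Subtracting the relation [E] leaves only the variations of [fs] and [fe], each at most [k']. *)
have -> : fs (xi e1) e1 * (xi e - xi e1 - - (fe (xi e1) e1 / fs (xi e1) e1) * (e - e1))
  = (fs (xi e1) e1 - fs s e) * (xi e - xi e1) +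
    (fe (xi e1) e1 - fe (xi e1) t) * (e - e1).
  rewrite -[RHS]addr0 -E; field; exact: f10.
apply: le_trans (ler_normD _ _) _; rewrite !normrM.
have kE : `|fs (xi e1) e1| * (k * `|e - e1|) = k' * (C * `|e - e1|) + k' * `|e - e1|.
  rewrite /k'; field; rewrite gt_eqF // addr_gt0 //.
rewrite kE; apply: lerD; last exact: ler_wpM2r.
by apply: ler_pM.
Unshelve. all: by end_near. Qed.

(** At the origin [fs] vanishes and [branch_lip] degenerates; the cone bound |xi e| <= K * |e| takes
    over the role of the Lipschitz estimate. *)
Let branch_near0 (k : R) : 0 < k -> \forall e \near (0 : R),
  [/\ `|e| < d, `|xi e + c / 2 * e| <= k * `|e|,
      `|fs (xi e) e - e| <= k * `|e| &
      `|fe (xi e) e - (xi e + c * e)| <= k * `|e|].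
Proof.
move=> kgt0; have K4 := K_ge4.
pose k1 := k / (2 * K * (K + 1)).
have KK : 0 < 2 * K * (K + 1) by rewrite !mulr_gt0 //; lra.
have k10 : 0 < k1 by rewrite divr_gt0.
have k1E : k1 * (2 * K * (K + 1)) = k by rewrite divfK // gt_eqF.
have [a a0 fsa] := fs_lin k10; have [a' a'0 fea] := fe_lin k10.
apply/near_norm; exists (Num.min d (Num.min a a' / K)).
  by rewrite lt_min d0 divr_gt0 ?lt_min ?a0 //; lra.
move=> e; rewrite subr0 lt_min => /andP[ed].
rewrite ltr_pdivlMr ?lt_min => [/andP[ea ea']|]; last by lra.
have en := normr_ge0 e.
have [xiK gxi] := xiP ed.
have xia : `|xi e| < a by apply: le_lt_trans xiK _; rewrite mulrC.
have xia' : `|xi e| < a' by apply: le_lt_trans xiK _; rewrite mulrC.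
have ea1 : `|e| < a by nra.
have ea'1 : `|e| < a' by nra.
have kk (s : R) : `|s| <= K * `|e| -> k1 * (`|s| + `|e|) <= k1 * (K + 1) * `|e|.
  by move=> sK; rewrite -mulrA; apply: ler_wpM2l; [exact: ltW|lra].
have kk1 : k1 * (K + 1) * `|e| <= k * `|e|.
  apply: ler_wpM2r => //; rewrite -k1E.
  by apply: ler_wpM2l; [exact: ltW|nra].
split => //.
- have [e0|e0] := eqVneq e 0.
    by rewrite e0 branch0 !mulr0 addr0 !normr0 mulr0.
  have e0n : 0 < `|e| by rewrite normr_gt0.
  have zr' : `|0 : R| < r by rewrite normr0.
  have [s ss sE] := mean_value_between (gs_r (er ed)) zr' (xi_r ed).
  (* Removing c / 2 * t ^ 2 leaves a function with derivative o(t), so [g 0 e] is c / 2 * e ^ 2 up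
     to o(e ^ 2). *)
  have hd (t : R) : `|t| < r ->
      is_derive t 1 (fun t => g 0 t - c / 2 * (t * t)) (fe 0 t - c * t).
    move=> tr; have g0t := ge_r zr' tr.
    apply: is_derive_eq.
    by rewrite -[X in _ - X]/(c / 2 * (t * 1 + t * 1)); field.
  have [t tt] := mean_value_between hd zr' (er ed).
  rewrite g00 !mulr0 !subr0 => tE.
  have sn : `|s| <= K * `|e|.
    by apply: between_norm ss _ _ => //; rewrite normr0 mulr_ge0 //; lra.
  have tn : `|t| <= `|e| by apply: between_norm tt _ _; rewrite ?normr0.
  have f1 : `|fs s e - e| <= k1 * (K + 1) * `|e|.
    apply: le_trans (kk _ sn); apply: fsa => //.
    by apply: le_lt_trans sn _; rewrite mulrC.
  have f2 : `|fe 0 t - c * t| <= k1 * `|e|.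
    have := fea 0 t; rewrite normr0 mulr0 !add0r => f2.
    apply: le_trans (f2 _ _) _ => //; first exact: le_lt_trans tn ea'1.
    by rewrite ler_pM2l.
  (* Expansion of 0 = g (xi e) e from the axis, with leading terms e * xi e and c / 2 * e ^ 2. *)
  have E : e * (xi e + c / 2 * e) =
      - ((fs s e - e) * xi e) - (fe 0 t - c * t) * e.
    move: sE; rewrite subr0 gxi => sE; rewrite -tE.
    have -> : (fs s e - e) * xi e = fs s e * xi e - e * xi e by ring.
    by rewrite -sE; ring.
  rewrite -(ler_pM2l e0n) -normrM E.
  apply: le_trans (ler_normB _ _) _; rewrite normrN !normrM.
  have h1 : `|fs s e - e| * `|xi e| <= k1 * (K + 1) * `|e| * (K * `|e|).
    exact: ler_pM.
  have h2 : `|fe 0 t - c * t| * `|e| <= k1 * `|e| * `|e| by apply: ler_wpM2r.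
  have e2 : 0 <= k1 * (`|e| * `|e|) by apply: mulr_ge0; [exact: ltW|exact: mulr_ge0].
  have : 0 <= k1 * (`|e| * `|e|) * (K * K + K - 1).
    by rewrite mulr_ge0 //; nra.
  by rewrite -k1E; lra.
- by apply: le_trans kk1; apply: le_trans (kk _ xiK); exact: fsa.
- apply: le_trans kk1; apply: le_trans (kk _ xiK).
  have := fea (xi e) e xia' ea'1.
  by rewrite mixed_derivative_eq1 mul1r.
Qed.

Lemma is_derive_branch (e : R) : `|e| < d -> is_derive e 1 xi (branch_slope e).
Proof.
move=> ed; have [->|] := eqVneq e 0; last exact: is_derive_branch_neq0.
apply: is_derive_near => k kgt0; apply: filterS (branch_near0 kgt0).
move=> e' [_ xik _ _].
by rewrite branch0 !subr0 /branch_slope eqxx mulNr opprK.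
Qed.

Lemma branch_slope_continuous (e : R) : `|e| < d ->
  {for e, continuous branch_slope}.
Proof.
move=> ed; have [->|e0] := eqVneq e 0.
  apply/cvgrPdist_le => k kgt0.
  pose k1 := Num.min 8^-1 (k / (2 * (2 + `|c|))).
  have c0 := normr_ge0 c.
  have k10 : 0 < k1 by rewrite lt_min invr_gt0 divr_gt0 //= ?andbT; lra.
  have k1k : k1 * (2 * (2 + `|c|)) <= k.
    rewrite -ler_pdivlMr; last by lra.
    by rewrite /k1 ge_min lexx orbT.
  apply: filterS (branch_near0 k10) => t [td xik fsk fek].
  rewrite /branch_slope eqxx; have [_|t0] := eqVneq t 0.
    by rewrite subrr normr0 ltW.
  have tn : 0 < `|t| by rewrite normr_gt0.
  have fst0 := branch_fs_neq0 td t0.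
  have fsn : 7 / 8 * `|t| <= `|fs (xi t) t| by apply: fs_norm => //; exact: xi_cone.
  have f0 : 0 < `|fs (xi t) t| by rewrite normr_gt0.
  rewrite -(ler_pM2r f0) -normrM.
  (* The three terms on the right are the errors bounded by [branch_near0], and |fs| >= 7/8 * |t|
     allows the division. *)
  have -> : (- (c / 2) - - (fe (xi t) t / fs (xi t) t)) * fs (xi t) t =
     (fe (xi t) t - (xi t + c * t)) + (xi t + c / 2 * t) - c / 2 * (fs (xi t) t - t).
    by field.
  apply: le_trans (ler_normB _ _) _; rewrite normrM.
  have c2 : `|c / 2| = `|c| / 2 by rewrite normrM (@ger0_norm _ 2^-1) // invr_ge0.
  have h1 := ler_normD (fe (xi t) t - (xi t + c * t)) (xi t + c / 2 * t).
  have h2 : `|c| / 2 * `|fs (xi t) t - t| <= `|c| / 2 * (k1 * `|t|).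
    by apply: ler_wpM2l => //; rewrite divr_ge0.
  have h3 : k * (7 / 8 * `|t|) <= k * `|fs (xi t) t| by rewrite ler_pM2l.
  have h4 : k1 * (2 * (2 + `|c|)) * `|t| <= k * `|t| by rewrite ler_pM2r.
  have h5 : 0 <= k1 * (`|c| * `|t|) by apply: mulr_ge0; [exact: ltW|exact: mulr_ge0].
  have h6 : 0 <= k1 * `|t| by apply: mulr_ge0; exact: ltW.
  by rewrite c2; lra.
have xic : {for e, continuous xi}.
  by apply/differentiable_continuous/derivable1_diffP; case: (is_derive_branch ed).
have pc : (xi t, t) @[t --> e] --> (xi e, e).
  exact: (cvg_pair xic cvg_id).
have rr (x : R) : `|x| < r -> `|x| < rho by move/lt_le_trans; apply.
have fec : fe (xi t) t @[t --> e] --> fe (xi e) e.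
  exact: cvg_comp pc (fe_cont (rr _ (xi_r ed)) (rr _ (er ed))).
have fsc : fs (xi t) t @[t --> e] --> fs (xi e) e.
  exact: cvg_comp pc (fs_cont (rr _ (xi_r ed)) (rr _ (er ed))).
have bE : branch_slope e = - (fe (xi e) e / fs (xi e) e).
  by rewrite /branch_slope (negbTE e0).
suff : branch_slope t @[t --> e] --> - (fe (xi e) e / fs (xi e) e) by rewrite -bE.
have : - (fe (xi t) t / fs (xi t) t) @[t --> e] --> - (fe (xi e) e / fs (xi e) e).
  by apply: cvgN; apply: cvgM => //; apply: cvgV => //; exact: branch_fs_neq0.
apply: cvg_trans; apply: near_eq_cvg.
apply: filterS (near_branch ed e0) => t [_ _ t0].
by rewrite /branch_slope (negbTE t0).
Qed.

End Branch.
End Box.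

(** Outside the cone and for [sigma * e < 0], [g s 0] and [g s e - g s 0] have the same sign, so
    their sum has no zero. For [sigma * e > 0] the sign of [g] at the boundary of the cone is
    opposite to its sign at s = r / 2, resp. s = - r / 2. *)
Lemma planar_pitchfork (rho2 : R) : 0 < rho2 ->
  exists (r d : R) (xi m : R -> R), [/\ 0 < r <= rho2, 0 < d <= rho2 &
  [/\ forall e : R, `|e| < d -> [/\ `|xi e| < r, g (xi e) e = 0,
        is_derive e 1 xi (m e) & {for e, continuous m}],
      xi 0 = 0,
      forall s e : R, `|s| < r -> `|e| < d -> sigma * e <= 0 -> g s e = 0 ->
        s = xi e,
      forall e : R, `|e| < d -> e != 0 -> fs (xi e) e != 0 &
      forall e : R, `|e| < d -> 0 < sigma * e ->
        exists s t, [/\ - r < s < xi e, xi e < t < r, g s e = 0 & g t e = 0]]].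
Proof.
move=> rho2_gt0.
have [d1 d1gt0 fs1] := fs_lin k0_gt0; have [d2 d2gt0 fe2] := fe_lin k0_gt0.
pose r := Num.min (Num.min rho rho1) (Num.min rho2 (Num.min d1 d2)).
have r0 : 0 < r by rewrite !lt_min rho0 rho1_gt0 rho2_gt0 d1gt0.
have /andP[/andP[r_rho r_rho1] /andP[r_rho2 /andP[rd1 rd2]]] :
    ((r <= rho) && (r <= rho1)) && ((r <= rho2) && ((r <= d1) && (r <= d2))).
  by rewrite -!le_min.
have fsr (s e : R) : `|s| < r -> `|e| < r -> `|fs s e - e| <= k0 * (`|s| + `|e|).
  by move=> sr er; apply: fs1; exact: lt_le_trans rd1.
have fer (s e : R) : `|s| < r -> `|e| < r ->
    `|fe s e - (s + c * e)| <= k0 * (`|s| + `|e|).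
  move=> sr er; have := fe2 s e; rewrite mixed_derivative_eq1 mul1r; apply;
  exact: lt_le_trans rd2.
have K4 := K_ge4.
have r2 : `|r / 2| < r by rewrite gtr0_norm; lra.
have r2' : `|- (r / 2)| < r by rewrite normrN.
(* For a fixed [s] the sign of [g s 0] persists for small [e]; it is used at the two points r / 2
   and - r / 2. *)
have keep (s : R) : 0 < `|s| < r ->
    \forall e \near (0 : R), sigma * (s * g s e) < 0.
  move=> /andP[s0 sr].
  have gc : {for 0, continuous (g s)}.
    apply/differentiable_continuous/derivable1_diffP.
    have sr' : `|s| < rho by exact: lt_le_trans r_rho.
    by case: (g_e sr' (_ : `|0 : R| < rho)); rewrite ?normr0.
  have lim : sigma * (s * g s e) @[e --> (0 : R)] --> sigma * (s * g s 0).
    exact: (cvgM (cvg_cst sigma) (cvgM (cvg_cst s) gc)).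
  apply: (cvgr_lt _ lim); apply: g_sign; rewrite s0 /=.
  exact: lt_le_trans r_rho1.
have [|a a0 keep1] := (near_norm _ _).1 (keep (r / 2) _).
  by rewrite r2 gtr0_norm; lra.
have [|a' a'0 keep2] := (near_norm _ _).1 (keep (- (r / 2)) _).
  by rewrite r2' normrN gtr0_norm; lra.
(* The first bound places the cone inside |s| < r / 2 and gives 2 * K * d <= r. *)
pose d := Num.min (r / (4 * K)) (Num.min a a').
have d0 : 0 < d by rewrite !lt_min a0 a'0 divr_gt0 //; lra.
have /andP[dr /andP[da da']] : (d <= r / (4 * K)) && ((d <= a) && (d <= a')).
  by rewrite -!le_min.
have dr' : K * d <= r / 4.
  move: dr; rewrite ler_pdivlMr; last by lra.
  by rewrite mulrC; lra.
have dK : 2 * K * d <= r by lra.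
have dd : 4 * d <= K * d by rewrite ler_pM2r.
have er (e : R) : `|e| < d -> `|e| < r by move=> /lt_le_trans; apply; lra.
have Ker (e : R) : `|e| < d -> K * `|e| < r / 2.
  move=> ed; apply: (@lt_le_trans _ _ (K * d)); first by rewrite ltr_pM2l //; lra.
  by lra.
have ex (e : R) : exists s : R, `|e| < d -> `|s| <= K * `|e| /\ g s e = 0.
  have [ed|//] := pselect (`|e| < d); last by exists 0.
  have Ke := Ker e ed.
  have [|s sP] := cone_zero_exists r0 r_rho fsr fer _ (er e ed) => //.
    by lra.
  by exists s.
have [xi xiP] := choice ex.
exists r, d, xi, (branch_slope xi); split.
- by rewrite r0.
- by rewrite d0 (le_trans _ r_rho2) //; lra.
split.
- move=> e ed; have [xiK gxi] := xiP e ed; split => //.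
  + by apply: le_lt_trans xiK _; apply: lt_trans (Ker e ed) _; lra.
  + exact: (is_derive_branch r0 r_rho fsr fer d0 dK xiP).
  + exact: (branch_slope_continuous r0 r_rho fsr fer d0 dK xiP).
- exact: branch0 d0 xiP.
- move=> s e sr ed se gse; have [xiK gxi] := xiP e ed.
  have [e0|e0] := eqVneq e 0.
    rewrite e0 (branch0 d0 xiP); apply/eqP; apply: contraT => s0.
    have := g_sign (s := s); rewrite normr_gt0 s0 (lt_le_trans sr r_rho1).
    by rewrite -{1}e0 gse !mulr0 ltxx => /(_ isT).
  have en : 0 < `|e| by rewrite normr_gt0.
  have [sK|sK] := leP `|s| (2 * K * `|e|).
    apply: (cone_zero_unique r_rho fsr sr _ (er e ed) e0 sK) => //.
      by apply: le_lt_trans xiK _; apply: lt_trans (Ker e ed) _; lra.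
    by apply: le_trans xiK _; apply: ler_wpM2r => //; lra.
  have sK' : K * `|e| <= `|s|.
    by apply: ltW; apply: le_lt_trans sK; apply: ler_wpM2r => //; lra.
  have := outside_cone r0 r_rho fer sr (er e ed) sK' e0.
  rewrite gse sub0r => seg.
  have s0 : 0 < `|s| < rho1.
    rewrite (lt_le_trans sr r_rho1) andbT; apply: le_lt_trans sK.
    by rewrite !mulr_ge0 //; lra.
  have := g_sign s0.
  have : s * e * - g s 0 = - ((sigma * e) * (sigma * (s * g s 0))).
    rewrite -[LHS]mulr1 -sigma2; ring.
  by move=> E g0; move: seg; rewrite E oppr_gt0 ltNge mulr_le0 // ltW.
- move=> e ed e0; exact: (branch_fs_neq0 fsr d0 dK xiP).
- move=> e ed se; have [xiK gxi] := xiP e ed.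
  have e0 : e != 0 by apply/eqP => e0; move: se; rewrite e0 mulr0 ltxx.
  have en : 0 < `|e| by rewrite normr_gt0.
  have n1 : `|K * `|e| | = K * `|e| by rewrite ger0_norm // mulr_ge0 //; lra.
  have n2 : `|- (K * `|e|)| = K * `|e| by rewrite normrN.
  have Ke := Ker e ed.
  have r1 : `|K * `|e| | < r by rewrite n1; lra.
  have r1' : `|- (K * `|e|)| < r by rewrite n2; lra.
  have ke0 : 0 < K * `|e| by rewrite mulr_gt0 //; lra.
  have c1 := cone_boundary r0 r_rho fsr fer r1 (er e ed) n1 e0.
  have c2 := cone_boundary r0 r_rho fsr fer r1' (er e ed) n2 e0.
  have gd (s : R) : `|s| < r -> is_derive s 1 (g^~ e) (fs s e).
    move=> sr; apply: g_s; first exact: lt_le_trans r_rho.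
    exact: lt_le_trans (er e ed) r_rho.
  have := keep1 e; rewrite subr0 => /(_ (lt_le_trans ed da)) k1.
  have := keep2 e; rewrite subr0 => /(_ (lt_le_trans ed da')) k2.
  move: xiK; rewrite ler_norml => /andP[xi1 xi2].
  (* The sign at the cone boundary is expressed through [e], the one at distance r / 2 through
     [sigma]; positivity of [sigma * e] reconciles them. *)
  have opp (A B x y : R) : 0 < x * e * A -> 0 < x -> sigma * (y * B) < 0 ->
      0 < y -> A * B < 0.
    move=> h1 x0 h2 y0.
    have {}h1 : 0 < e * A by rewrite -mulrA pmulr_rgt0 in h1.
    have {}h2 : sigma * B < 0 by rewrite mulrCA pmulr_rlt0 in h2.
    have : (sigma * e) * (A * B) < 0.
      have -> : sigma * e * (A * B) = (e * A) * (sigma * B) by ring.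
      by rewrite pmulr_rlt0.
    by rewrite pmulr_rlt0.
  have [||t /andP[t1 t2] gt] := zero_between gd r1 r2; first by lra.
    by apply: (opp _ _ (K * `|e|) (r / 2)) => //; lra.
  have [||s /andP[s1 s2] gs] := zero_between gd r2' r1'; first by lra.
    (* Changing the signs of both values reduces the left zero to the situation of the right one. *)
    rewrite mulrC -mulrNN; apply: (opp _ _ (K * `|e|) (r / 2)) => //; last by lra.
      by move: c2; lra.
    by move: k2; lra.
  by exists s, t; split => //; apply/andP; split; lra.
Qed.

End PlanarPitchfork.

(** * Imaginary eigenvalues *)

Section ImaginaryEigenvalues.
Variables (R : realType) (n : nat).
Implicit Types (A : 'M[R]_n) (a b : 'rV[R]_n).

(* [a + i b] is a left eigenvector of [A] for the eigenvalue [i y]. *)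
Definition imaginary_pair A (y : R) a b :=
  a *m A = - y *: b /\ b *m A = y *: a.

Let ReD : {morph @complex.Re R : x y / x + y}.
Proof. by move=> [? ?] [? ?]. Qed.

Let ImD : {morph @complex.Im R : x y / x + y}.
Proof. by move=> [? ?] [? ?]. Qed.

Let ReM (x : R[i]) (t : R) : complex.Re (x * real_complex R t) = complex.Re x * t.
Proof. by case: x => u w /=; rewrite mulr0 subr0. Qed.

Let ImM (x : R[i]) (t : R) : complex.Im (x * real_complex R t) = complex.Im x * t.
Proof. by case: x => u w /=; rewrite mulr0 add0r. Qed.

Lemma imaginary_eigenvalueP A (y : R) :
  complex_eigenvalue A (Complex 0 y) <->
  exists a b, imaginary_pair A y a b /\ ~ (a = 0 /\ b = 0).
Proof.
split=> [/eigenvalueP[u uA u0]|[a [b [[aA bA] ab0]]]].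
  exists (map_mx (@complex.Re R) u), (map_mx (@complex.Im R) u).
  split; first split.
  - apply/rowP => k; have /rowP /(_ k) := uA; rewrite !mxE.
    move=> /(congr1 (@complex.Re R)).
    rewrite (big_morph (@complex.Re R) ReD (erefl : complex.Re 0 = 0)).
    under eq_bigr do rewrite !mxE ReM.
    under [in X in _ -> X]eq_bigr do rewrite !mxE.
    by move=> ->; case: (u _ _) => p q /=; rewrite mul0r sub0r mulNr.
  - apply/rowP => k; have /rowP /(_ k) := uA; rewrite !mxE.
    move=> /(congr1 (@complex.Im R)).
    rewrite (big_morph (@complex.Im R) ImD (erefl : complex.Im 0 = 0)).
    under eq_bigr do rewrite !mxE ImM.
    under [in X in _ -> X]eq_bigr do rewrite !mxE.
    by move=> ->; case: (u _ _) => p q /=; rewrite mul0r add0r.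
  - move=> [a0 b0]; move/eqP: u0; apply; apply/rowP => k; rewrite mxE.
    have /rowP /(_ k) := a0; have /rowP /(_ k) := b0; rewrite !mxE.
    by case: (u _ _) => p q /= -> ->.
apply/eigenvalueP; exists (\row_k Complex (a ord0 k) (b ord0 k)).
  apply/rowP => k; rewrite !mxE.
  have /rowP /(_ k) := aA; have /rowP /(_ k) := bA; rewrite !mxE => bAk aAk.
  rewrite [LHS]complexE (big_morph (@complex.Re R) ReD (erefl : complex.Re 0 = 0)).
  rewrite (big_morph (@complex.Im R) ImD (erefl : complex.Im 0 = 0)).
  under eq_bigr do rewrite !mxE ReM /=.
  under [in X in _ + _ * X]eq_bigr do rewrite !mxE ImM /=.
  rewrite aAk bAk [RHS]complexE /=.
  by rewrite !mul0r sub0r add0r mulNr.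
apply/eqP => /rowP u0; apply: ab0; split; apply/rowP => k;
by have := u0 k; rewrite !mxE => -[].
Qed.

Lemma imaginary_pair_sqr A y a b :
  imaginary_pair A y a b -> a *m (A *m A + (y ^+ 2)%:M) = 0.
Proof.
move=> [aA bA]; rewrite mulmxDr mulmxA aA -scalemxAl bA mul_mx_scalar.
by rewrite scalerA mulNr -expr2 scaleNr addNr.
Qed.

Lemma imaginary_pair_det_neq0 A y a b :
  imaginary_pair A y a b -> y != 0 -> \det (A *m A + (y ^+ 2)%:M) != 0 ->
  a = 0 /\ b = 0.
Proof.
move=> Aab y0 detA; have a0 : a = 0.
  have Au : A *m A + (y ^+ 2)%:M \in unitmx by rewrite unitmxE unitfE.
  by rewrite -(mulmxK Au a) (imaginary_pair_sqr Aab) mul0mx.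
split=> //; case: Aab => + _; rewrite a0 mul0mx => /esym/eqP.
by rewrite scaler_eq0 oppr_eq0 (negbTE y0) => /eqP.
Qed.

(** Adding the norm estimates of the two relations bounds |y| * (|a| + |b|) by n * |A| * (|a| +
    |b|); the factor n is due to the sup norm. *)
Lemma imaginary_pair_bound A y a b :
  imaginary_pair A y a b -> ~ (a = 0 /\ b = 0) -> `|y| <= n%:R * `|A|.
Proof.
move=> [aA bA] ab0; rewrite leNgt; apply/negP => yA; apply: ab0.
have h1 : `|y| * `|b| <= n%:R * `|A| * `|a|.
  by rewrite -(normrN y) -normrZ -aA; exact: norm_mulmx_le.
have h2 : `|y| * `|a| <= n%:R * `|A| * `|b|.
  by rewrite -normrZ -bA; exact: norm_mulmx_le.
have a0 := normr_ge0 a; have b0 := normr_ge0 b.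
have : (`|y| - n%:R * `|A|) * (`|a| + `|b|) <= 0 by lra.
rewrite pmulr_rle0 ?subr_gt0 // => ab.
by split; apply/eqP; rewrite -normr_le0; lra.
Qed.

(* Turning the complex vector [a + i b] so that its real part is killed by [c],
   the relations give [w S^-1 A c = 1], which fails when [A c] is small. *)
Lemma imaginary_pair_small A (w : 'rV[R]_n) (c : 'cV[R]_n) y a b :
  imaginary_pair A y a b -> y != 0 ->
  let N := A + c *m w in let S := N *m N + (y ^+ 2)%:M in
  \det S != 0 -> (w *m invmx S *m (A *m c)) ord0 ord0 != 1 -> a = 0 /\ b = 0.
Proof.
move=> [aA bA] y0 N S detS wS.
have S_unit : S \in unitmx by rewrite unitmxE unitfE.
pose al := (a *m c) ord0 ord0; pose be := (b *m c) ord0 ord0.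
have acE : a *m c = al%:M by rewrite [LHS]mx11_scalar.
have bcE : b *m c = be%:M by rewrite [LHS]mx11_scalar.
have [[al0 be0]|albe] := pselect (al = 0 /\ be = 0).
  apply: (@imaginary_pair_det_neq0 N y) => //.
  split; rewrite mulmxDr mulmxA ?acE ?bcE ?al0 ?be0 raddf0 mul0mx addr0 //.
(* [u + i z] is [a + i b] multiplied by be + i al, that is, by i times the conjugate of its value al
   + i be on [c]. Hence [c] kills [u], and its value on [z] is the squared modulus [t]. *)
pose u := be *: a - al *: b; pose z := al *: a + be *: b.
have uA : u *m A = - y *: z.
  rewrite mulmxBl -!scalemxAl aA bA /z !scalerDr !scalerA.
  by rewrite addrC -scaleNr mulrN !mulNr [al * y]mulrC [be * y]mulrC.
have zA : z *m A = y *: u.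
  rewrite mulmxDl -!scalemxAl aA bA /u !scalerBr !scalerA.
  by rewrite addrC mulrN scaleNr [al * y]mulrC [be * y]mulrC.
have uc : u *m c = 0.
  rewrite mulmxBl -!scalemxAl acE bcE !scale_scalar_mx.
  by rewrite mulrC subrr.
pose t := al ^+ 2 + be ^+ 2.
have zc : z *m c = t%:M.
  by rewrite mulmxDl -!scalemxAl acE bcE !scale_scalar_mx -raddfD /= -!expr2.
have t0 : t != 0.
  apply/eqP => t0; apply: albe.
  have h1 := sqr_ge0 al; have h2 := sqr_ge0 be; rewrite /t in t0.
  split; apply/eqP; rewrite -sqrf_eq0; apply/eqP; lra.
have uN : u *m N = - y *: z by rewrite mulmxDr mulmxA uc mul0mx addr0.
have zN : z *m N = y *: u + t *: w.
  by rewrite mulmxDr mulmxA zc mul_scalar_mx zA.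
have uS : u *m S = - (y * t) *: w.
  rewrite mulmxDr mulmxA uN -scalemxAl zN mul_mx_scalar scalerDr !scalerA.
  by rewrite mulNr -expr2 scaleNr addrAC addNr add0r mulNr.
have uE : u = - (y * t) *: (w *m invmx S).
  by rewrite scalemxAl -uS mulmxK.
have : u *m A *m c = (- y * t)%:M by rewrite uA -scalemxAl zc scale_scalar_mx.
rewrite -mulmxA uE -scalemxAl => /matrixP /(_ ord0 ord0).
rewrite [in LHS]mxE [RHS]mxE eqxx mulr1n !mulNr => /eqP.
rewrite eqr_opp -[X in _ == X]mulr1 (inj_eq (mulfI _)) ?mulf_neq0 //.
by rewrite (negbTE wS).
Qed.

(* An eigenvalue [i y] of [J p] has bounded [y].  For [y] near 0 it is excluded by
   [imaginary_pair_small], for other [y] by [det (J p0 ^ 2 + y ^ 2) != 0], and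
   compactness makes the neighborhood of [p0] uniform in [y]. *)
Lemma hyperbolic_near (T : topologicalType) (p0 : T) (J : T -> 'M[R]_n)
    (w : 'rV[R]_n) (c : 'cV[R]_n) :
  {for p0, continuous J} -> J p0 *m c = 0 -> J p0 + c *m w \in unitmx ->
  (forall z, complex_eigenvalue (J p0) z -> z != 0 -> complex.Re z != 0) ->
  \forall p \near p0, \det (J p) != 0 ->
    forall z, complex_eigenvalue (J p) z -> complex.Re z != 0.
Proof.
move=> Jc Jc0 N_unit J_hyp.
(* The compact interval [- B, B] contains every [y] such that i y is an eigenvalue of some [J p]
   with [p] near [p0]. *)
pose B := n%:R * (`|J p0| + 1).
have bound : \forall p \near p0, n%:R * `|J p| <= B.
  have : (fun p => `|J p|) @ p0 --> `|J p0| by exact: (cvg_norm Jc).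
  move=> /cvgr_le /(_ (`|J p0| + 1)); rewrite ltrDl ltr01 => /(_ isT).
  by apply: filterS => p Jp; apply: ler_wpM2l.
pose P p (y : R) := forall a b, imaginary_pair (J p) y a b -> y != 0 ->
  a = 0 /\ b = 0.
have tube : \forall p \near p0, `[- B, B]%classic `<=` P p.
  have /compact_near_coveringP := @segment_compact R (- B) B.
  apply=> y0 _.
  have J1 : {for (y0, p0), continuous (fun q : R * T => J q.2)}.
    by apply: (@continuous_comp _ _ _ snd J) => //; exact: cvg_snd.
  have y1 : {for (y0, p0), continuous (fun q : R * T => (q.1 ^+ 2)%:M : 'M[R]_n)}.
    apply/continuous_mxP => i j.
    rewrite (_ : (fun q => _) = (fun q : R * T => q.1 ^+ 2 * (i == j)%:R)); last first.
      by apply/funext => q; rewrite mxE mulr_natr.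
    apply: continuousM; last exact: cvg_cst.
    by apply: continuousM; exact: cvg_fst.
  have [y00|y00] := eqVneq y0 0.
    pose N (q : R * T) := J q.2 + c *m w.
    pose S q := N q *m N q + (q.1 ^+ 2)%:M.
    have Nc : {for (y0, p0), continuous N}.
      exact: (cvgD J1 (cvg_cst _)).
    have Sc : {for (y0, p0), continuous S}.
      exact: (cvgD (continuous_mulmx Nc Nc) y1).
    have detS : \det (S (y0, p0)) != 0.
      rewrite /S /= y00 expr0n /= raddf0 addr0 det_mulmx.
      by rewrite mulf_neq0 // -unitfE -unitmxE.
    have S_unit : S (y0, p0) \in unitmx by rewrite unitmxE unitfE.
    (* [D] vanishes at (0, p0) because [J p0 *m c = 0], so it stays away from 1 nearby. *)
    pose D q := (w *m invmx (S q) *m (J q.2 *m c)) ord0 ord0.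
    have Dc : {for (y0, p0), continuous D}.
      have cc (m k : nat) (M : 'M[R]_(m, k)) :
        {for (y0, p0), continuous (fun _ : R * T => M)} by exact: cvg_cst.
      have Mc : {for (y0, p0), continuous (fun q => w *m invmx (S q) *m (J q.2 *m c))}.
        apply: continuous_mulmx; apply: continuous_mulmx => //.
        exact: continuous_invmx.
      by move/continuous_mxP: Mc; apply.
    have D1 : D (y0, p0) != 1.
      by rewrite /D /= Jc0 mulmx0 mxE eq_sym oner_eq0.
    have nearS := cvgr_neq0 _ (continuous_det Sc) detS.
    have D10 : D (y0, p0) - 1 != 0 by rewrite subr_eq0.
    have nearD := cvgr_neq0 _ (cvgB Dc (cvg_cst (1 : R))) D10.
    near=> q; move=> a b qab q0.
    apply: (imaginary_pair_small qab q0 (w := w) (c := c)).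
      by near: q; exact: nearS.
    by rewrite -subr_eq0; near: q; exact: nearD.
  pose S (q : R * T) := J q.2 *m J q.2 + (q.1 ^+ 2)%:M.
  have Sc : {for (y0, p0), continuous S}.
    exact: (cvgD (continuous_mulmx J1 J1) y1).
  have detS : \det (S (y0, p0)) != 0.
    apply/negP => /det0P[a a0 aS].
    (* A kernel vector [a] of J p0 ^ 2 + y0 ^ 2 is the real part of an eigenvector for i y0, and [b]
       is its imaginary part. *)
    pose b := - y0^-1 *: (a *m J p0).
    have : complex_eigenvalue (J p0) (Complex 0 y0).
      apply/imaginary_eigenvalueP; exists a, b; split.
        split; first by rewrite scalerA mulrNN divff // scale1r.
        move: aS; rewrite mulmxDr mulmxA mul_mx_scalar /= => /eqP.
        rewrite addr_eq0 -scalemxAl => /eqP ->.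
        by rewrite scalerN scaleNr opprK scalerA expr2 mulKf.
      by move=> [] /eqP; rewrite (negbTE a0).
    by move=> /J_hyp; rewrite eq_complex /= eqxx (negbTE y00) => /(_ isT)/negP.
  have nearS := cvgr_neq0 _ (continuous_det Sc) detS.
  near=> q; move=> a b qab q0.
  apply: (imaginary_pair_det_neq0 qab q0).
  by near: q; exact: nearS.
near=> p => detJ z zJ; apply/negP => /eqP z0.
have zE : z = Complex 0 (complex.Im z) by case: (z) z0 => /= ? ? ->.
have := zJ; rewrite zE => /imaginary_eigenvalueP[a [b [Jab ab0]]].
have [y0|y0] := eqVneq (complex.Im z) 0.
  have J_unit : J p \in unitmx by rewrite unitmxE unitfE.
  move: Jab => [aJ bJ]; apply: ab0; rewrite y0 in aJ bJ.
  split; [rewrite -(mulmxK J_unit a) aJ|rewrite -(mulmxK J_unit b) bJ].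
    by rewrite oppr0 scale0r mul0mx.
  by rewrite scale0r mul0mx.
have zB : `|complex.Im z| <= B.
  by apply: le_trans (imaginary_pair_bound Jab ab0) _; near: p.
have PB : `[- B, B]%classic `<=` P p by near: p.
by apply: ab0; apply: PB Jab y0; rewrite /= in_itv /= -ler_norml.
Unshelve. all: by end_near. Qed.

End ImaginaryEigenvalues.

(** * The index *)

Section EuclideanNorm.
Variables (R : realType) (n : nat).
Implicit Types (x v : 'rV[R]_n).

Let sqnorm x : R := \sum_i x ord0 i ^+ 2.

Lemma enorm_ge0 x : 0 <= enorm x.
Proof. exact: sqrtr_ge0. Qed.

Lemma norm_le_enorm x : `|x| <= enorm x.
Proof.
apply: norm_mx_le => [|i j]; first exact: enorm_ge0.
rewrite (ord1 i) -sqrtr_sqr; apply: ler_wsqrtr.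
by rewrite (bigD1 j) //= lerDl; apply: sumr_ge0 => k _; exact: sqr_ge0.
Qed.

Lemma enorm_eq0 x : (enorm x == 0) = (x == 0).
Proof.
apply/eqP/eqP => [x0|->].
  by apply/eqP; rewrite -normr_le0 -x0; exact: norm_le_enorm.
rewrite /enorm big1 ?sqrtr0 // => i _.
by rewrite mxE expr0n.
Qed.

Lemma enorm_gt0 x : (0 < enorm x) = (x != 0).
Proof. by rewrite lt_neqAle eq_sym enorm_eq0 enorm_ge0 andbT. Qed.

Lemma enormZ (t : R) x : enorm (t *: x) = `|t| * enorm x.
Proof.
rewrite /enorm -sqrtr_sqr -sqrtrM ?sqr_ge0 // mulr_sumr.
by congr Num.sqrt; apply: eq_bigr => i _; rewrite mxE exprMn.
Qed.

Lemma enorm_normalize x : x != 0 -> enorm ((enorm x)^-1 *: x) = 1.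
Proof.
move=> x0; have e0 : 0 < enorm x by rewrite enorm_gt0.
by rewrite enormZ gtr0_norm ?invr_gt0 // mulVf // gt_eqF.
Qed.

Let sqnorm_diff x :
  differentiable sqnorm x /\ forall v, 'd sqnorm x v = \sum_i 2 * x ord0 i * v ord0 i.
Proof.
rewrite /sqnorm; elim: (index_enum _) => [|i s [IHd IH]].
  have -> : (fun x => \sum_(i <- [::]) x ord0 i ^+ 2) = cst 0 :> ('rV[R]_n -> R).
    by apply/funext => y; rewrite big_nil.
  by split=> [|v]; [exact: differentiable_cst|rewrite big_nil diff_cst].
pose ci (y : 'rV[R]_n) : R := y ord0 i.
have -> : (fun x => \sum_(i <- i :: s) x ord0 i ^+ 2) =
    (ci * ci) + (fun x => \sum_(i <- s) x ord0 i ^+ 2) :> ('rV[R]_n -> R).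
  by apply/funext => y; rewrite big_cons expr2.
have cd : differentiable ci x by exact: differentiable_coord.
have cdE v : 'd ci x v = v ord0 i.
  rewrite (@diff_coords _ _ _ _ _ id); last by [].
  by rewrite diff_val.
have ccd : differentiable (ci * ci) x by exact: differentiableM.
split=> [|v]; first exact: differentiableD.
rewrite diffD // big_cons -[LHS]/('d (ci * ci) x v + _) IH; congr (_ + _).
rewrite diffM // -[LHS]/(ci x * 'd ci x v + ci x * 'd ci x v) cdE /ci.
by ring.
Qed.

Lemma enorm_continuous : continuous (@enorm R n).
Proof.
move=> x; have /differentiable_continuous qc := (sqnorm_diff x).1.
exact: (continuous_comp qc (@sqrt_continuous R _)).
Qed.

Lemma enorm_diff x : x != 0 -> differentiable (@enorm R n) x /\
  forall v, 'd (@enorm R n) x v = (\sum_i x ord0 i * v ord0 i) / enorm x.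
Proof.
move=> x0; have [qd qdE] := sqnorm_diff x.
have q0 : 0 < sqnorm x by rewrite -sqrtr_gt0 enorm_gt0.
have [sd sE] := is_derive1_sqrt q0.
have sd' : differentiable (@Num.sqrt R) (sqnorm x) by apply/derivable1_diffP.
have -> : @enorm R n = Num.sqrt \o sqnorm by [].
split=> [|v]; first exact: differentiable_comp.
rewrite diff_comp // -[LHS]/('d (@Num.sqrt R) (sqnorm x) ('d sqnorm x v)).
have sdE : 'd (@Num.sqrt R) (sqnorm x) 1 = (2 * Num.sqrt (sqnorm x))^-1.
  by rewrite -deriveE.
have sdZ (t : R) : 'd (@Num.sqrt R) (sqnorm x) t = t * 'd (@Num.sqrt R) (sqnorm x) 1.
  by rewrite -[in LHS](mulr1 t) -[X in 'd _ _ X]/(t *: 1) linearZ.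
have e0 : enorm x != 0 by rewrite enorm_eq0.
rewrite sdZ sdE qdE -[(Num.sqrt \o sqnorm) x]/(enorm x).
rewrite -[Num.sqrt (sqnorm x)]/(enorm x).
under eq_bigr do rewrite -mulrA.
rewrite -mulr_sumr; move: (\sum_i _) => S; move: (enorm x) e0 => e e0.
by field.
Qed.

(** This is the radial extension of the constant map [v]; [has_degree] asks for its regularity away
    from 0. *)
Lemma class_C1_enormZ v : class_C 1 [set x | x != 0] (fun x => enorm x *: v).
Proof.
split=> [x /= x0|h x /= x0].
  by apply: differentiableZl; exact: (enorm_diff x0).1.
have nz : \forall y \near x, y != 0.
  apply/near_norm; exists `|x|; first by rewrite normr_gt0.
  by move=> y; apply: contraTneq => ->; rewrite sub0r normrN ltxx.
pose D (y : 'rV[R]_n) : 'rV[R]_n := ((\sum_i y ord0 i * h ord0 i) / enorm y) *: v.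
have dE (y : 'rV[R]_n) : y != 0 -> 'd (fun x => enorm x *: v) y h = D y.
  by move=> y0; rewrite diffZl ?(enorm_diff y0).2 //; exact: (enorm_diff y0).1.
have nearD : \forall y \near x, D y = 'd (fun x => enorm x *: v) y h.
  by apply: filterS nz => y /dE.
suff Dc : D y @[y --> x] --> D x.
  rewrite -(dE x x0) in Dc; apply: cvg_trans Dc.
  apply: (@near_eq_cvg _ _ (nbhs x) (nbhs_filter x)).
  by apply: filterS nearD => y ->.
have Sc : (fun y : 'rV[R]_n => \sum_i y ord0 i * h ord0 i : R) @ x -->
    (\sum_i x ord0 i * h ord0 i : R).
  apply: (@continuous_sum R _ x _ _ _ (fun i (y : 'rV[R]_n) => y ord0 i * h ord0 i)).
  by move=> i _; exact: (cvgM (@coord_continuous _ _ _ ord0 i x) (cvg_cst _)).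
have Ec : (fun y : 'rV[R]_n => (enorm y)^-1 : R) @ x --> ((enorm x)^-1 : R).
  have e0 : enorm x != 0 by rewrite enorm_eq0.
  exact: (cvgV e0 (@enorm_continuous x)).
exact: (cvgZ (cvgM Sc Ec) (cvg_cst v)).
Qed.

End EuclideanNorm.

(* Such a field is homotopic on small spheres, along straight lines, to the
   constant field [nu]. *)
Lemma index0_of_missed_direction (R : realType) n (A : set 'rV[R]_n)
    (W : 'rV[R]_n -> 'rV[R]_n) z nu : nu != 0 ->
  (\forall x \near z, [/\ A x, {for x, continuous W}, W x = 0 -> x = z &
     forall t, 0 < t -> W x <> - t *: nu]) ->
  has_index A W z 0.
Proof.
move=> nu0 /near_norm[d d0 Wd]; pose r := d / 2.
have r0 : 0 < r by rewrite divr_gt0.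
have rd x : enorm (x - z) <= r -> `|x - z| < d.
  move=> xr; apply: le_lt_trans (norm_le_enorm _) _; apply: le_lt_trans xr _.
  by rewrite /r; lra.
have ud u : sphere u -> `|z + r *: u - z| < d.
  move=> u1; apply: rd; rewrite addrAC subrr add0r enormZ u1 mulr1.
  by rewrite gtr0_norm.
pose h := (enorm nu)^-1 *: nu.
have h1 : sphere h by exact: enorm_normalize.
have e00 : enorm (0 : 'rV[R]_n) = 0 by apply/eqP; rewrite enorm_eq0.
have hN : h <> - h.
  move=> /eqP; rewrite -subr_eq0 opprK -mulr2n -scaler_nat.
  rewrite scaler_eq0 pnatr_eq0 /= => /eqP hE.
  by move: h1; rewrite /sphere /= hE e00 => /esym/eqP; rewrite oner_eq0.
have W0 u : sphere u -> W (z + r *: u) != 0.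
  move=> u1; apply/eqP => Wu; have [_ _ /(_ Wu) zE _] := Wd _ (ud u u1).
  have /eqP : r *: u = 0 by rewrite -[LHS](addKr z) zE addNr.
  rewrite scaler_eq0 gt_eqF //= => /eqP uE.
  have : enorm u = 1 by []; rewrite uE e00 => /esym/eqP.
  by rewrite oner_eq0.
(* A zero of this segment with 0 < t < 1 would make [W] a negative multiple of [nu]; at t = 0 it
   would be a zero of [W] on the sphere. *)
pose w (q : R * 'rV[R]_n) := (1 - q.1) *: W (z + r *: q.2) + q.1 *: nu.
have w0 t u : 0 <= t <= 1 -> sphere u -> w (t, u) != 0.
  move=> /andP[t0 t1] u1; apply/eqP; rewrite /w /= => wE.
  have [tE|t1'] := eqVneq t 1.
    by move: wE; rewrite tE subrr scale0r add0r scale1r; apply/eqP.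
  have t1n : 1 - t != 0 by rewrite subr_eq0 eq_sym.
  have WE : W (z + r *: u) = - (t / (1 - t)) *: nu.
    apply: (scalerI t1n); rewrite scalerA mulrN mulrCA divff // mulr1 scaleNr.
    by apply/eqP; rewrite -addr_eq0 wE.
  have [tE|t0'] := eqVneq t 0.
    by move: (W0 u u1); rewrite WE tE mul0r oppr0 scale0r eqxx.
  have [_ _ _ /(_ (t / (1 - t)))] := Wd _ (ud u u1); apply => //.
  by rewrite divr_gt0 // ?subr_gt0 lt_neqAle ?t0 ?t1 ?t1' // eq_sym t0'.
exists r; split => //.
  by move=> x /rd /Wd[].
(* The constant map misses [- h], a regular value with empty fiber, so the degree sum is 0. *)
exists (cst h), (- h); split.
- exists (fun q => (enorm (w q))^-1 *: w q); split.
  + apply: continuous_in_subspaceT => -[t u] /[!inE] -[/= t01 u1].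
    have {}t01 : 0 <= t <= 1 by move: t01; rewrite in_itv.
    have [_ Wc _ _] := Wd _ (ud u u1).
    have Wc' : W (z + r *: q.2) @[q --> (t, u)] --> W (z + r *: u).
      have lc : z + r *: q.2 @[q --> (t, u)] --> z + r *: u.
        exact: (cvgD (cvg_cst z) (cvgZ (cvg_cst r) cvg_snd)).
      exact: cvg_comp lc Wc.
    have wc : w q @[q --> (t, u)] --> w (t, u).
      exact: (cvgD (cvgZ (cvgB (cvg_cst (1 : R)) cvg_fst) Wc')
        (cvgZ cvg_fst (cvg_cst nu))).
    have ewc : enorm (w q) @[q --> (t, u)] --> enorm (w (t, u)).
      exact: cvg_comp wc (@enorm_continuous R n (w (t, u))).
    have e0 : enorm (w (t, u)) != 0 by rewrite enorm_eq0 w0.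
    exact: (cvgZ (cvgV e0 ewc) wc).
  + by move=> t u t01 u1; apply: enorm_normalize; exact: w0.
  + by move=> u _; rewrite /w /= subr0 scale1r scale0r addr0.
  + by move=> u _; rewrite /w /= subrr scale0r scale1r add0r.
- exact: class_C1_enormZ.
- by rewrite /sphere /= -scaleN1r enormZ normrN1 mul1r.
- by move=> u [_ /hN].
- rewrite (_ : sphere_fiber (cst h) (- h) = set0) ?fsbig_set0 //.
  by apply/seteqP; split=> // u [_ /hN].
Qed.

(** * Rules for differentials *)

Section DifferentialRules.
Variables (R : realType).
Implicit Types (E W : normedModType R).

Lemma linear_bound_continuous E W (l : {linear E -> W}) (k : R) :
  (forall x, `|l x| <= k * `|x|) -> continuous l.
Proof.
move=> lk; apply: bounded_linear_continuous; apply/linear_boundedP.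
exists k; split=> [|r /ltW kr x]; first exact: num_real.
by apply: le_trans (lk x) _; exact: ler_wpM2r.
Qed.

Lemma is_diff_affine E W (f : E -> W) (l : {linear E -> W}) x :
  continuous l -> (forall y, f y - f x = l (y - x)) -> is_diff x f l.
Proof.
move=> lc fl; apply: is_diff_near => // e e0; apply: filterE => y.
by rewrite fl subrr normr0 mulr_ge0 // ltW.
Qed.

Lemma differentiable_mulmxr E m n p (f : E -> 'M[R]_(m, n)) (B : 'M[R]_(n, p)) x :
  differentiable f x -> differentiable (fun y => f y *m B) x /\
    forall h, 'd (fun y => f y *m B) x h = 'd f x h *m B.
Proof.
move=> fd; have Bc : continuous (mulmxr B : 'M[R]_(m, n) -> 'M[R]_(m, p)).
  move=> M; apply: (@continuous_mulmx R _ M _ _ _ id (fun=> B)).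
    exact: cvg_id.
  exact: cst_continuous.
have Bd M : differentiable (mulmxr B : 'M[R]_(m, n) -> 'M[R]_(m, p)) M.
  exact: linear_differentiable.
split=> [|h]; first exact: (differentiable_comp fd (Bd _)).
apply: (etrans (congr1 (@^~ h) (diff_comp fd (Bd _)))).
exact: (congr1 (@^~ _) (diff_lin _ Bc)).
Qed.

Lemma differentiable_bigsum E I (s : seq I) (f : I -> E -> R) x :
  (forall i, differentiable (f i) x) ->
  differentiable (fun y => \sum_(i <- s) f i y) x.
Proof.
move=> fd; elim: s => [|i s IH].
  rewrite (_ : (fun y => _) = cst 0); first exact: differentiable_cst.
  by apply/funext => y; rewrite big_nil.
rewrite (_ : (fun y => _) = f i + (fun y => \sum_(i <- s) f i y)).
  exact: differentiableD.
by apply/funext => y; rewrite big_cons.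
Qed.

Lemma is_diff_near_eq E W (f g : E -> W) x : (\forall y \near x, f y = g y) ->
  differentiable f x -> is_diff x g ('d f x).
Proof.
move=> fg fd; apply: is_diff_near => [|e e0]; first exact: diff_continuous.
near=> y; rewrite -(nbhs_singleton fg).
have <- : f y = g y by near: y.
by near: y; exact: differentiable_near.
Unshelve. all: by end_near. Qed.

(** As [g x = 0], the increment of the product is [f y * g y], and replacing [f y] by [f x] costs
    o(1) times O(|y - x|). This gives the reduced function its second derivatives at the origin. *)
Lemma is_diff_mul_vanishing E (f g : E -> R) x :
  {for x, continuous f} -> differentiable g x -> g x = 0 ->
  is_diff x (fun y => f y * g y) (fun h => f x * 'd g x h).
Proof.
move=> fc gd gx.
have lin : linear (fun h => f x * 'd g x h : R).
  by move=> a u w; rewrite linearP mulrDr [a *: _]/(a * _) mulrCA.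
pose L : {linear E -> R} := HB.pack (fun h => f x * 'd g x h : R)
  (GRing.isLinear.Build _ _ _ _ _ lin).
have Lc : continuous L.
  move=> h; have dgc : ('d g x : E -> R) k @[k --> h] --> 'd g x h.
    exact: diff_continuous.
  exact: (cvgM (cvg_cst (f x)) dgc).
apply: (@is_diff_near R E R _ L) => // e e0.
have [k k0 dgk] := linear_lipschitz (diff_continuous gd).
pose m := `|f x| + 1.
have m0 : 0 < m by rewrite ltr_wpDl.
have e1 : 0 < e / 2 / m by rewrite !divr_gt0.
have e2 : 0 < e / 2 / k by rewrite !divr_gt0.
near=> y; rewrite gx mulr0 subr0 /=.
have fy1 : `|f x - f y| <= e / 2 / k.
  by near: y; move/cvgrPdist_le : fc; apply.
have fy2 : `|f y| <= m.
  have : `|f x - f y| <= 1 by near: y; move/cvgrPdist_le : fc; apply.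
  have := ler_normB (f x) (f x - f y); rewrite opprB addrC subrK /m; lra.
have gy : `|g y - 'd g x (y - x)| <= e / 2 / m * `|y - x|.
  by rewrite -[g y]subr0 -gx; near: y; exact: differentiable_near.
have -> : f y * g y - f x * 'd g x (y - x) =
   f y * (g y - 'd g x (y - x)) - (f x - f y) * 'd g x (y - x) by ring.
apply: le_trans (ler_normB _ _) _; rewrite !normrM.
have -> : e * `|y - x| = m * (e / 2 / m * `|y - x|) + e / 2 / k * (k * `|y - x|).
  by field; rewrite !gt_eqF.
by apply: lerD; apply: ler_pM.
Unshelve. all: by end_near. Qed.

Lemma diff_basis n W (f : 'rV[R]_n * R -> W) p h t : 'd f p (h, t) =
  \sum_i h ord0 i *: 'd f p (delta_mx ord0 i, 0) + t *: 'd f p (0, 1).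
Proof.
have -> : (h, t) = (h, 0) + (0, t) :> 'rV[R]_n * R.
  by rewrite -[RHS]/(h + 0, 0 + t) addr0 add0r.
have -> : (0, t) = t *: (0, 1) :> 'rV[R]_n * R.
  by rewrite -[RHS]/(t *: 0, t * 1) scaler0 mulr1.
rewrite linearD linearZ /=; congr (_ + _).
pose inl (u : 'rV[R]_n) := (u, 0) : 'rV[R]_n * R.
have inlD u w : inl (u + w) = inl u + inl w.
  by rewrite -[RHS]/(u + w, 0 + 0) addr0.
have inlZ a u : inl (a *: u) = a *: inl u.
  by rewrite -[RHS]/(a *: u, a * 0) mulr0.
rewrite -/(inl h) [in LHS](row_sum_delta h).
elim: (index_enum _) => [|i s IH].
  by rewrite !big_nil -[RHS](linear0 ('d f p)).
by rewrite !big_cons inlD inlZ linearD linearZ IH.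
Qed.

(** [class_C] gives continuity direction by direction. Closeness within e / (n + 1) on the n + 1
    basis vectors controls the differential uniformly in [h]. *)
Lemma diff_uniformly_close n m (f : 'rV[R]_n * R -> 'rV[R]_m) p0 (e : R) :
  (forall h, {for p0, continuous (fun p => 'd f p h)}) -> 0 < e ->
  \forall p \near p0, forall h, `|'d f p h - 'd f p0 h| <= e * `|h|.
Proof.
move=> fc e0; pose e' := e / n.+1%:R.
have e'0 : 0 < e' by rewrite divr_gt0.
near=> p; move=> [h t].
have -> : 'd f p (h, t) - 'd f p0 (h, t) =
    \sum_i (h ord0 i *: 'd f p (delta_mx ord0 i, 0) -
      h ord0 i *: 'd f p0 (delta_mx ord0 i, 0)) +
    t *: ('d f p (0, 1) - 'd f p0 (0, 1)).
  apply: (etrans (congr2 (fun a b => a - b)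
    (diff_basis f p h t) (diff_basis f p0 h t))).
  by rewrite opprD addrACA -sumrB -scalerBr.
have h1 : `|h| <= `|(h, t)| by rewrite prod_normE le_max lexx.
have t1 : `|t| <= `|(h, t)| by rewrite prod_normE le_max lexx orbT.
have -> : e * `|(h, t)| = \sum_(i < n) (e' * `|(h, t)|) + e' * `|(h, t)|.
  have {1}-> : e = n.+1%:R * e' by rewrite /e' mulrC divfK // pnatr_eq0.
  by rewrite sumr_const card_ord -mulrSr -mulrA mulr_natl.
apply: le_trans (ler_normD _ _) _; apply: lerD.
  apply: le_trans (ler_norm_sum _ _ _) _; apply: ler_sum => i _.
  rewrite -scalerBr normrZ mulrC; apply: ler_pM => //; last first.
    by apply: le_trans h1; exact: norm_coord_le.
  move: i; near: p; apply: filter_forall => i.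
  by have /cvgrPdistC_le := fc (delta_mx ord0 i, 0); apply.
rewrite normrZ mulrC; apply: ler_pM => //.
near: p.
by have /cvgrPdistC_le := fc (0, 1); apply.
Unshelve. all: by end_near. Qed.

End DifferentialRules.

Lemma continuous_near_eq (T U : topologicalType) (f g : T -> U) x :
  {for x, continuous f} -> (\forall y \near x, f y = g y) ->
  {for x, continuous g}.
Proof.
move=> fc fg.
have lim : f y @[y --> x] --> g x by rewrite -(nbhs_singleton fg).
apply: cvg_trans lim; apply: (@near_eq_cvg _ _ (nbhs x) (nbhs_filter x)).
by apply: filterS fg => y ->.
Qed.

(** * Lyapunov-Schmidt reduction *)

Section FamilyDerivatives.
Variables (R : realType) (n : nat).
Variables (Om : set ('rV[R]_n * R)) (V : 'rV[R]_n * R -> 'rV[R]_n).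
Hypothesis Om_open : open Om.
Hypothesis V_C2 : class_C 2 Om V.
Implicit Types (p : 'rV[R]_n * R) (h : 'rV[R]_n).

Definition param_deriv p : 'rV[R]_n := 'd V p (0, 1).

Lemma family_diff p : Om p -> differentiable V p.
Proof. exact: V_C2.1. Qed.

Lemma family_diff2 p (h : 'rV[R]_n * R) : Om p ->
  differentiable (fun q => 'd V q h) p.
Proof. exact: (V_C2.2 h).1. Qed.

Let inl (h : 'rV[R]_n) := (h, 0) : 'rV[R]_n * R.

Let inl_linear : linear inl.
Proof.
by move=> a u w; rewrite -[RHS]/(a *: u + w, a * 0 + 0) mulr0 addr0.
Qed.

Let inlL : {linear 'rV[R]_n -> ('rV[R]_n * R)%type} :=
  HB.pack inl (GRing.isLinear.Build _ _ _ _ _ inl_linear).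

Let inl_continuous : continuous inlL.
Proof.
apply: (@linear_bound_continuous _ _ _ inlL 1) => h.
by rewrite prod_normE normr0 max_l // mul1r.
Qed.

Lemma jac_xE p h : Om p -> h *m jac_x V p = 'd V p (h, 0).
Proof.
move=> Omp; rewrite /jac_x /jacobian mul_rV_lin1.
pose j (x : 'rV[R]_n) := (x, p.2) : 'rV[R]_n * R.
have [jd jE] : is_diff (p.1) j inl.
  apply: (@is_diff_affine _ _ _ _ inlL) => // y.
  by rewrite -[LHS]/(y - p.1, p.2 - p.2) subrr.
have Vd : differentiable V (j p.1) by rewrite /j -surjective_pairing; exact: family_diff.
have -> : (fun x => V (x, p.2)) = V \o j by [].
by rewrite diff_comp //= jE /j -surjective_pairing.
Qed.

Lemma family_diffE p h (t : R) : Om p ->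
  'd V p (h, t) = h *m jac_x V p + t *: param_deriv p.
Proof.
move=> Omp; rewrite jac_xE //.
have -> : (h, t) = (h, 0) + t *: (0, 1) :> 'rV[R]_n * R.
  by rewrite -[RHS]/(h + t *: 0, 0 + t * 1) scaler0 mulr1 addr0 add0r.
by rewrite linearD linearZ.
Qed.

Let near_Om p : Om p -> \forall q \near p, Om q.
Proof. by move=> Omp; exact: open_nbhs_nbhs. Qed.

Lemma jac_x_differentiable p : Om p -> differentiable (jac_x V) p.
Proof.
move=> Omp; apply: differentiable_mx => i j.
have Vij : differentiable (fun q => 'd V q (delta_mx ord0 i, 0) ord0 j : R) p.
  apply: (@differentiable_coords _ _ _ _ _ (fun q => 'd V q (delta_mx ord0 i, 0))).
  exact: family_diff2.
have eqij : \forall q \near p,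
    'd V q (delta_mx ord0 i, 0) ord0 j = jac_x V q i j.
  apply: filterS (near_Om Omp) => q Omq.
  by rewrite -jac_xE // -rowE mxE.
by have [] := is_diff_near_eq eqij Vij.
Qed.

Lemma param_deriv_differentiable p : Om p -> differentiable param_deriv p.
Proof. exact: family_diff2. Qed.

(** On a small ball the differential stays uniformly close to the one at [p0], so
    [mean_value_strict] applies; [implicit_function] needs this strict form. *)
Lemma family_strict p0 (e : R) : Om p0 -> 0 < e ->
  exists2 d : R, 0 < d & forall p q, `|p - p0| < d -> `|q - p0| < d ->
    `|V p - V q - 'd V p0 (p - q)| <= e * `|p - q|.
Proof.
move=> Omp0 e0.
have close : \forall p \near p0, forall h : 'rV[R]_n * R,
    `|'d V p h - 'd V p0 h| <= e * `|h|.
  apply: diff_uniformly_close => // h.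
  by apply: differentiable_continuous; exact: family_diff2.
have /near_norm[d d0 dP] : \forall p \near p0,
    Om p /\ forall h : 'rV[R]_n * R, `|'d V p h - 'd V p0 h| <= e * `|h|.
  by near=> p; split; near: p; [exact: near_Om|exact: close].
exists d => // p q pd qd.
apply: (@mean_value_strict _ _ _ V ('d V p0) p0 d e (ltW e0)).
- by move=> z; rewrite -ball_normE /= distrC => /dP[/family_diff].
- by move=> z; rewrite -ball_normE /= distrC => /dP[].
- by rewrite -ball_normE /= distrC.
- by rewrite -ball_normE /= distrC.
Unshelve. all: by end_near. Qed.

End FamilyDerivatives.

Section Reduction.
Variables (R : realType) (n : nat).
Variables (Om : set ('rV[R]_n * R)) (V : 'rV[R]_n * R -> 'rV[R]_n).
Hypothesis Om_open : open Om.
Hypothesis V_C2 : class_C 2 Om V.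
Variables (x0 : 'rV[R]_n) (e0 : R) (v : 'rV[R]_n) (c : 'cV[R]_n).
Let p0 := (x0, e0).
Hypothesis Omp0 : Om p0.
Hypothesis V0 : V p0 = 0.
Hypothesis vJ : v *m jac_x V p0 = 0.
Hypothesis Jc : jac_x V p0 *m c = 0.
Hypothesis vc : v *m c = 1%:M.
Hypothesis M_unit : jac_x V p0 + c *m v \in unitmx.
Implicit Types (x y : 'rV[R]_n) (s t : R) (q k : R * R).

(* The projector along [v] onto the row space of the Jacobian at [p0]. *)
Let Q : 'M[R]_n := 1%:M - c *m v.

Let Qc : Q *m c = 0.
Proof. by rewrite mulmxBl mul1mx -mulmxA vc mulmx1 subrr. Qed.

Let vQ : v *m Q = 0.
Proof. by rewrite mulmxBr mulmx1 mulmxA vc mul1mx subrr. Qed.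

Let JQ : jac_x V p0 *m Q = jac_x V p0.
Proof. by rewrite mulmxBr mulmx1 mulmxA Jc mul0mx subr0. Qed.

Let mulQ y : y *m Q = y - y *m c *m v.
Proof. by rewrite mulmxBr mulmx1 mulmxA. Qed.

(** [Q *m c = 0] and [v *m c = 1] make the row space of [Q] independent of the line of [v], so one
    vector equation encodes both conditions. *)
Let split_eq y x s : y *m Q + (x *m c *m v - s *: v) = 0 <->
  y *m Q = 0 /\ x *m c = s%:M.
Proof.
split=> [E|[-> ->]]; last by rewrite mul_scalar_mx subrr addr0.
have xc : x *m c = s%:M.
  have := congr1 (mulmx^~ c) E; rewrite /= mulmxDl mul0mx -[y *m Q *m c]mulmxA Qc.
  rewrite mulmx0 add0r mulmxBl -[X in X - _]mulmxA vc mulmx1 -scalemxAl vc.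
  by rewrite scale_scalar_mx mulr1 => /eqP; rewrite subr_eq0 => /eqP.
by split=> //; move: E; rewrite xc mul_scalar_mx subrr addr0.
Qed.

Let L (z : 'rV[R]_n * (R * R)) := (z.1, e0 + z.2.2) : 'rV[R]_n * R.

(** A square system for [x] with parameters (s, e). Its derivative in [x] at the base point is
    [jac_x V p0 *m Q + c *m v], which [JQ] turns into the invertible matrix of [M_unit]. *)
Let F (z : 'rV[R]_n * (R * R)) : 'rV[R]_n :=
  V (L z) *m Q + ((z.1 - x0) *m c *m v - z.2.1 *: v).

Let l (z : 'rV[R]_n * (R * R)) := (z.1, z.2.2) : 'rV[R]_n * R.

Let l_linear : linear l. Proof. by []. Qed.

Let lL : {linear ('rV[R]_n * (R * R))%type -> ('rV[R]_n * R)%type} :=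
  HB.pack l (GRing.isLinear.Build _ _ _ _ _ l_linear).

Let norm_l z : `|l z| <= `|z|.
Proof.
case: z => h [a b]; rewrite !prod_normE ge_max !le_max !lexx /=.
by rewrite !orbT.
Qed.

Let L_diff z : is_diff z L l.
Proof.
apply: (@is_diff_affine _ _ _ _ lL) => [|y].
  by apply: (@linear_bound_continuous _ _ _ _ 1) => y; rewrite mul1r; exact: norm_l.
rewrite -[LHS]/(y.1 - z.1, e0 + y.2.2 - (e0 + z.2.2)).
by rewrite opprD addrACA subrr add0r.
Qed.

Let A (z : 'rV[R]_n * (R * R)) : 'rV[R]_n := z.1 *m c *m v - z.2.1 *: v.

Let A_linear : linear A.
Proof.
move=> a [h k] [h' k']; rewrite /A /= !mulmxDl -!scalemxAl scalerDl scalerBr.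
by rewrite opprD addrACA -[(a *: k).1 *: v]/((a * k.1) *: v) scalerA.
Qed.

Let AL : {linear ('rV[R]_n * (R * R))%type -> 'rV[R]_n} :=
  HB.pack A (GRing.isLinear.Build _ _ _ _ _ A_linear).

Let A_continuous : continuous AL.
Proof.
have [K K0 hK] := mulmx_bounded (c *m v).
apply: (@linear_bound_continuous _ _ _ _ (K + `|v|)) => -[h [a b]].
have h1 : `|h| <= `|(h, (a, b))| by rewrite prod_normE le_max lexx.
have a1 : `|a| <= `|(h, (a, b))| by rewrite !prod_normE !le_max lexx orbT.
rewrite /= /A /=; apply: le_trans (ler_normB _ _) _; rewrite mulrDl; apply: lerD.
  by rewrite -mulmxA; apply: le_trans (hK h) _; rewrite ler_pM2l.
by rewrite normrZ mulrC; apply: ler_wpM2l.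
Qed.

Let mulQL_continuous : continuous (mulmxr Q : 'rV[R]_n -> 'rV[R]_n).
Proof.
have [K K0 hK] := mulmx_bounded Q.
exact: (@linear_bound_continuous _ _ _ (mulmxr Q) K).
Qed.

Let F_diff z : Om (L z) ->
  is_diff z F (fun w => 'd V (L z) (l w) *m Q + A w).
Proof.
move=> OmL; have [Ld LE] := L_diff z.
have Vd := family_diff V_C2 OmL.
have VLd : differentiable (V \o L) z by exact: differentiable_comp.
have Qd y : differentiable (mulmxr Q : 'rV[R]_n -> 'rV[R]_n) y.
  exact: linear_differentiable.
have Gd : differentiable (mulmxr Q \o (V \o L)) z by exact: differentiable_comp.
pose B (z : 'rV[R]_n * (R * R)) : 'rV[R]_n := (z.1 - x0) *m c *m v - z.2.1 *: v.
have [Bd BE] : is_diff z B A.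
  apply: (@is_diff_affine _ _ _ _ AL) => // y.
  rewrite /= /B /A -[(y - z).1]/(y.1 - z.1) -[(y - z).2.1]/(y.2.1 - z.2.1).
  rewrite !mulmxBl scalerBl.
  move: (y.1 *m c *m v) (z.1 *m c *m v) (x0 *m c *m v) (y.2.1 *: v) (z.2.1 *: v).
  move=> a1 a2 b a3 a4; rewrite [a1 - b - a3]addrAC [a2 - b - a4]addrAC.
  rewrite !opprB [a1 - a3 - b + _]addrA subrK.
  by rewrite addrACA [RHS]addrACA [- a3 - a2]addrC.
have FE : F = (mulmxr Q \o (V \o L)) + B by [].
apply: DiffDef; first by rewrite FE; exact: differentiableD.
apply/funext => w; rewrite FE.
have e1 : 'd (mulmxr Q \o (V \o L)) z w = 'd V (L z) (l w) *m Q.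
  apply: (etrans (congr1 (@^~ w) (diff_comp VLd (Qd _)))).
  apply: (etrans (congr1 (@^~ _) (diff_lin _ mulQL_continuous))).
  congr (_ *m Q); apply: (etrans (congr1 (@^~ w) (diff_comp Ld Vd))).
  by rewrite /= LE.
have e2 : 'd B z w = A w by rewrite BE.
exact: (etrans (congr1 (@^~ w) (diffD Gd Bd)) (congr2 +%R e1 e2)).
Qed.

(** The implicit function theorem for [F]. The equation [V = V *m c *m v] is [V *m Q = 0] rewritten
    so as to exhibit the scalar [V *m c] that remains to be solved. *)
Lemma reduced_curve (rho : R) : 0 < rho ->
  (forall p, `|p - p0| < rho -> Om p) ->
  exists (gam : R * R -> 'rV[R]_n) (r d : R),
  [/\ 0 < r <= rho, 0 < d <= rho,
      forall q, `|q| < d -> [/\ `|gam q - x0| < r,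
        V (gam q, e0 + q.2) = (V (gam q, e0 + q.2) *m c) *m v &
        (gam q - x0) *m c = (q.1)%:M],
      forall x s t, `|x - x0| < r -> `|s| < d -> `|t| < d ->
        V (x, e0 + t) = (V (x, e0 + t) *m c) *m v ->
        (x - x0) *m c = s%:M -> x = gam (s, t) &
      forall q, `|q| < d -> differentiable gam q /\ forall k,
        'd V (gam q, e0 + q.2) ('d gam q k, k.2) *m Q = 0 /\
        'd gam q k *m c = (k.1)%:M].
Proof.
move=> rho0 rhoOm.
have VQ p : V p *m Q = 0 <-> V p = (V p *m c) *m v.
  rewrite mulQ; split=> [/eqP|<-]; last by rewrite subrr.
  by rewrite subr_eq0 => /eqP.
have F0 : F (x0, 0) = 0.
  by apply/split_eq; rewrite /L /= addr0 V0 mul0mx subrr mul0mx raddf0.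
have LOm z : `|z - (x0, 0)| < rho -> Om (L z).
  case: z => h [a b]; rewrite -[X in `|X|]/((h - x0, (a - 0, b - 0))) !subr0.
  rewrite !prod_norm_lt => /andP[h1 /andP[_ b1]].
  apply: rhoOm; rewrite -[X in `|X|]/((h - x0, e0 + b - e0)) addrAC subrr add0r.
  by rewrite prod_norm_lt h1.
have Fd : \forall z \near (x0, 0 : R * R), differentiable F z.
  apply: (proj2 (near_norm (x0, 0 : R * R) (fun z => differentiable F z))).
  by exists rho => // z zr; case: (F_diff (LOm z zr)).
have Fstrict (e : R) : 0 < e -> exists2 d, 0 < d & forall (y : R * R) x x',
    `|y - 0| < d -> `|x - x0| < d -> `|x' - x0| < d ->
    `|F (x, y) - F (x', y) - (x - x') *m (jac_x V p0 + c *m v)| <= e * `|x - x'|.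
  move=> egt0; have [K K0 hK] := mulmx_bounded Q.
  have eK : 0 < e / K by rewrite divr_gt0.
  have [d d0 dV] := family_strict Om_open V_C2 Omp0 eK.
  exists d => // y x x'; rewrite subr0 => yd xd x'd.
  have y2 : `|y.2| < d by move: yd; case: (y) => a b; rewrite prod_norm_lt => /andP[].
  have Ld z : `|z - x0| < d -> `|L (z, y) - p0| < d.
    move=> zd; rewrite -[X in `|X|]/((z - x0, e0 + y.2 - e0)) addrAC subrr add0r.
    by rewrite prod_norm_lt zd.
  have LE : L (x, y) - L (x', y) = (x - x', 0).
    by rewrite -[LHS]/(x - x', e0 + y.2 - (e0 + y.2)) subrr.
  have -> : F (x, y) - F (x', y) - (x - x') *m (jac_x V p0 + c *m v) =
      (V (L (x, y)) - V (L (x', y)) - 'd V p0 (L (x, y) - L (x', y))) *m Q.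
    rewrite LE -(jac_xE V_C2) // (mulmxBl (V _ - V _)) (mulmxBl (V _)).
    rewrite -(mulmxA (x - x')) JQ.
    have xE : (x - x') *m c *m v = (x - x0) *m c *m v - (x' - x0) *m c *m v.
      by rewrite -!mulmxBl opprB addrA subrK.
    rewrite mulmxDr [(x - x') *m (c *m v)]mulmxA xE /F /=.
    rewrite opprD addrACA.
    rewrite (_ : _ - y.1 *: v - _ = (x - x0) *m c *m v - (x' - x0) *m c *m v).
      by rewrite opprD addrACA subrr addr0.
    by rewrite opprB addrA subrK.
  apply: le_trans (hK _) _.
  have := dV _ _ (Ld x xd) (Ld x' x'd); rewrite LE => dVx.
  apply: le_trans (ler_wpM2l (ltW K0) dVx) _.
  by rewrite prod_normE normr0 max_l // mulrA [K * _]mulrC divfK // gt_eqF.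
have [gam [r [d [/andP[r0 r1] /andP[d0 d1] gamP gam_uniq gam_diff]]]] :=
  implicit_function M_unit F0 Fstrict Fd rho0.
have q0 q : `|q| < d -> `|q - 0| < d by rewrite subr0.
exists gam, r, d; split; rewrite ?r0 ?d0 //.
- by move=> q /q0 /gamP[gr /split_eq[/VQ ? ?]]; split.
- move=> x s t xr sd td /VQ Vx xc; apply: gam_uniq => //.
    by rewrite subr0 prod_norm_lt sd.
  exact/split_eq.
- move=> q qd; have [gd gE] := gam_diff q (q0 q qd); split=> // k.
  have [gr _] := gamP q (q0 q qd).
  have OmL : Om (L (gam q, q)).
    apply: LOm; rewrite -[X in `|X|]/((gam q - x0, q - 0)) prod_norm_lt.
    by rewrite (lt_le_trans gr r1) subr0 (lt_le_trans qd d1).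
  have [_ FE] := F_diff OmL.
  by have := gE k; rewrite FE => /split_eq.
Qed.

End Reduction.

(** * Planar functions, sign changes and curves *)

Section PlaneFunctions.
Variable R : realType.
Implicit Types (f : R * R -> R) (s e : R).

Lemma partial_derive1 f s e : differentiable f (s, e) ->
  is_derive s 1 (fun t => f (t, e)) ('d f (s, e) (1, 0)).
Proof.
have lE t : (0, e) + t *: (1, 0) = (t, e) :> R * R.
  by rewrite -[LHS]/(0 + t * 1, e + t * 0) mulr1 mulr0 addr0 add0r.
move=> fd; have := @is_derive_line R _ _ f (0, e) (1, 0) s.
rewrite lE => /(_ fd).
by rewrite (_ : (fun t => _) = (fun t => f (t, e))) //; apply/funext => t; rewrite lE.
Qed.

Lemma partial_derive2 f s e : differentiable f (s, e) ->
  is_derive e 1 (fun t => f (s, t)) ('d f (s, e) (0, 1)).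
Proof.
have lE t : (s, 0) + t *: (0, 1) = (s, t) :> R * R.
  by rewrite -[LHS]/(s + t * 0, 0 + t * 1) mulr1 mulr0 addr0 add0r.
move=> fd; have := @is_derive_line R _ _ f (s, 0) (0, 1) e.
rewrite lE => /(_ fd).
by rewrite (_ : (fun t => _) = (fun t => f (s, t))) //; apply/funext => t; rewrite lE.
Qed.

Lemma diff_pairE (W : normedModType R) (f : R * R -> W) p s e :
  'd f p (s, e) = s *: 'd f p (1, 0) + e *: 'd f p (0, 1).
Proof.
have -> : (s, e) = s *: (1, 0) + e *: (0, 1) :> R * R.
  by rewrite -[RHS]/(s * 1 + e * 0, s * 0 + e * 1) !mulr1 !mulr0 addr0 add0r.
by rewrite linearD !linearZ.
Qed.

Lemma norm_pair_le s e : `|(s, e)| <= `|s| + `|e|.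
Proof. by rewrite prod_normE ge_max lerDl lerDr !normr_ge0. Qed.

Lemma vanishing_linear_estimate f : differentiable f 0 -> f 0 = 0 ->
  forall k : R, 0 < k -> exists2 d : R, 0 < d & forall s e, `|s| < d -> `|e| < d ->
    `|f (s, e) - ('d f 0 (1, 0) * s + 'd f 0 (0, 1) * e)| <= k * (`|s| + `|e|).
Proof.
move=> fd f0 k k0.
have [d d0 dP] := (near_norm _ _).1 (differentiable_near fd k0).
exists d => // s e sd ed; have := dP (s, e).
rewrite !subr0 prod_norm_lt sd ed f0 subr0 diff_pairE => /(_ isT) fE.
rewrite -[_ *: _]/(_ * _) -[e *: _]/(_ * _) [s * _]mulrC [e * _]mulrC in fE.
by apply: le_trans fE _; rewrite ler_pM2l // norm_pair_le.
Qed.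

End PlaneFunctions.

(** By the intermediate value theorem [f] keeps one sign on each side of 0; the same sign on both
    sides would make [tau * f] nonnegative for [tau] that sign. *)
Lemma sign_change (R : realType) (f df : R -> R) (d : R) : 0 < d ->
  (forall x : R, `|x| < d -> is_derive x 1 f (df x)) ->
  (forall x : R, 0 < `|x| < d -> f x != 0) -> f 0 = 0 ->
  (forall tau : R, tau * tau = 1 ->
    ~ (forall x : R, `|x| < d -> 0 <= tau * f x)) ->
  exists2 tau : R, tau * tau = 1 &
    forall x : R, 0 < `|x| < d -> 0 < tau * (x * f x).
Proof.
move=> d0 fdf fn0 f0 fsign.
have same (x y : R) : 0 < `|x| < d -> 0 < `|y| < d -> 0 < x * y -> 0 < f x * f y.
  wlog xy : x y / x <= y.
    move=> H hx hy; have [/H|/ltW /H] := leP x y; first exact.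
    by rewrite mulrC [f x * _]mulrC; exact.
  move=> /andP[x0 xd] /andP[y0 yd] xy0.
  rewrite lt_neqAle eq_sym mulf_neq0 ?fn0 ?x0 ?y0 //= leNgt; apply/negP => fxy.
  have [t /andP[t1 t2] ft] := zero_between fdf xd yd xy fxy.
  have t0 : 0 < `|t| by rewrite normr_gt0; apply/eqP => t0; nra.
  have td : `|t| < d.
    rewrite ltr_norml; move: xd yd; rewrite !ltr_norml => /andP[? _] /andP[_ ?].
    by rewrite (lt_trans _ t1) //= (lt_trans t2).
  by have := fn0 t; rewrite t0 td ft eqxx => /(_ isT).
pose p := d / 2; have p0 : 0 < p by rewrite divr_gt0.
have pd : 0 < `|p| < d by rewrite gtr0_norm // p0 /p; lra.
have pd' : 0 < `|- p| < d by rewrite normrN.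
have fp0 := fn0 p pd; have fp0' := fn0 (- p) pd'.
pose tau : R := Num.sg (f p).
have tau2 : tau * tau = 1 by rewrite -expr2 sqr_sg fp0.
have taup : 0 < tau * f p by rewrite -normrEsg normr_gt0.
have pos (x : R) : 0 < `|x| < d -> 0 < x -> 0 < tau * f x.
  move=> xd x0; have := same x p xd pd; rewrite mulr_gt0 // => /(_ isT) fxp.
  by rewrite -(pmulr_lgt0 _ taup) mulrACA tau2 mul1r.
exists tau => // x xd; have [x0|x0] := leP 0 x.
  have {}x0 : 0 < x by rewrite lt_neqAle x0 andbT eq_sym -normr_gt0; case/andP: xd.
  by rewrite mulrCA mulr_gt0 // pos.
have := same x (- p) xd pd'; rewrite mulrN oppr_gt0 nmulr_rlt0 // => /(_ p0) fxp.
have fpp : tau * f (- p) < 0.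
  rewrite lt_neqAle mulf_neq0 ?sgr_eq0 //= leNgt; apply/negP => taun.
  apply: (fsign tau tau2) => y yd; have [->|y0] := eqVneq y 0.
    by rewrite f0 mulr0.
  have yd' : 0 < `|y| < d by rewrite normr_gt0 y0.
  have [y1|y1] := leP 0 y.
    by apply/ltW/pos => //; rewrite lt_neqAle eq_sym y0.
  have := same y (- p) yd' pd'; rewrite mulrN oppr_gt0 nmulr_rlt0 // => /(_ p0) fyp.
  by apply: ltW; rewrite -(pmulr_lgt0 _ taun) mulrACA tau2 mul1r.
rewrite mulrCA nmulr_rgt0 // -(nmulr_lgt0 _ fpp) mulrACA tau2 mul1r //.
Qed.

Section Curves.
Variables (R : realType) (W : normedModType R).

(** The factor [kap] takes the values 1 and -1, the latter for the reversed parameter. *)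
Lemma class_C1_curve (Y Y' : R -> W) (d e0 kap : R) :
  (forall e : R, `|e| < d -> is_derive e 1 Y (Y' e) /\ {for e, continuous Y'}) ->
  `|kap| = 1 ->
  class_C 1 `]e0 - d, e0 + d[%classic (fun e => Y (kap * (e - e0))).
Proof.
move=> Yd kap1; pose l (e : R) := kap * (e - e0).
have ld e : (`]e0 - d, e0 + d[%classic : set R) e -> `|l e| < d.
  by rewrite /= in_itv /= normrM kap1 mul1r ltr_norml; lra.
have klin : linear (fun t : R => kap * t : R).
  by move=> a u w; rewrite mulrDr [a *: u]/(a * u) mulrCA.
pose kL : {linear R -> R} := HB.pack (fun t : R => kap * t : R)
  (GRing.isLinear.Build _ _ _ _ _ klin).
have kc : continuous kL by move=> y; exact: mulrl_continuous.
have lD e : is_diff e l (fun t : R => kap * t).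
  by apply: (@is_diff_affine _ _ _ _ kL) => // y; rewrite /l /=; ring.
have Ydiff e : `|l e| < d -> differentiable Y (l e).
  by move=> /Yd[[Yl _] _]; apply/derivable1_diffP.
have dE e (h : R) : `|l e| < d -> 'd (Y \o l) e h = (kap * h) *: Y' (l e).
  move=> le; have [lde lE] := lD e.
  rewrite (diff_comp lde (Ydiff e le)) /= lE /=.
  rewrite -[X in 'd _ _ X]mulr1 -[X in 'd _ _ X]/((kap * h) *: 1) linearZ /=.
  by rewrite -deriveE; [have [[_ ->] _] := Yd _ le|exact: Ydiff].
split=> [e /ld le|h e /ld le].
  by have [lde _] := lD e; exact: (differentiable_comp lde (Ydiff e le)).
have lc : {for e, continuous l} by have [/differentiable_continuous] := lD e.
have lY : Y' (l t) @[t --> e] --> Y' (l e) by exact: cvg_comp lc (Yd _ le).2.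
have Hc : {for e, continuous (fun t => (kap * h) *: Y' (l t))}.
  exact: (cvgZ (cvg_cst (kap * h)) lY).
have HE : \forall t \near e, (kap * h) *: Y' (l t) = 'd (Y \o l) t h.
  have : \forall t \near e, `|l t| < d.
    by apply: (cvgr_lt _ (cvg_norm lc)).
  by apply: filterS => t lt_; rewrite dE.
exact: (continuous_near_eq Hc HE).
Qed.

End Curves.

(** * From branches of zeros to the bifurcation *)

Section Assembly.
Variables (R : realType) (n : nat).
Implicit Types (V : 'rV[R]_n * R -> 'rV[R]_n) (Om : set ('rV[R]_n * R)).

Lemma forward_one_to_k Om V x0 e0 :
  forward_pitchfork Om V x0 e0 -> one_to_k Om V x0 e0.
Proof. by move=> [U [d [dom [one _] _ _ three]]]; exists U, d. Qed.

Lemma backward_k_to_one Om V x0 e0 :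
  forward_pitchfork (@reverse_param R n @^-1` Om) (V \o @reverse_param R n) x0 (- e0) ->
  k_to_one Om V x0 e0.
Proof.
move=> [U [d [[Uo d0 dom] [one _] _ _ three]]].
have zE e : zeros (V \o @reverse_param R n) U (- e) = zeros V U e.
  by rewrite /zeros /= /reverse_param /= opprK.
exists U, d; split.
- split=> // x e Ux ed; have := dom x (- e) Ux.
  by rewrite /reverse_param /= opprK; apply; lra.
- move=> e ed; have := three (- e); rewrite /three_zeros zE; apply; lra.
- move=> e ed; have := one (- e); rewrite /one_zero zE; apply; lra.
Qed.

(** The chart [gam] and the function [g] are abstract here so that the result serves both the family
    and its reversal, where [e] is replaced by [- e]. *)
Lemma forward_pitchfork_of_branches Om V x0 e0 (U : set 'rV[R]_n) (r d : R)
    (gam : R -> R -> 'rV[R]_n) (g : R -> R -> R) (xi : R -> R) :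
  0 < d -> open_nbhs x0 U ->
  (forall x e, U x -> `|e| < d -> Om (x, e0 + e)) ->
  (forall x e, `|e| < d -> (U x /\ V (x, e0 + e) = 0) <->
    exists s, [/\ `|s| < r, g s e = 0 & x = gam s e]) ->
  (forall s t e, `|s| < r -> `|t| < r -> `|e| < d -> gam s e = gam t e -> s = t) ->
  gam (xi 0) 0 = x0 ->
  (forall e, `|e| < d -> `|xi e| < r /\ g (xi e) e = 0) ->
  (forall s e, `|s| < r -> `|e| < d -> e <= 0 -> g s e = 0 -> s = xi e) ->
  (forall e, `|e| < d -> 0 < e -> exists s t,
    [/\ - r < s < xi e, xi e < t < r, g s e = 0 & g t e = 0]) ->
  non_hyperbolic V (x0, e0) ->
  (forall e, `|e| < d -> e != 0 -> ~ non_hyperbolic V (gam (xi e) e, e0 + e)) ->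
  class_C 1 `]e0 - d, e0 + d[%classic (fun e => gam (xi (e - e0)) (e - e0)) ->
  forward_pitchfork Om V x0 e0.
Proof.
move=> d0 Uo dom zE inj x00 xiP uniq three nh hyp curve.
have zeroP x e : `|e - e0| < d -> zeros V U e x <->
    exists s, [/\ `|s| < r, g s (e - e0) = 0 & x = gam s (e - e0)].
  by move=> ed; rewrite -zE // /zeros /= [e0 + _]addrC subrK.
have zero_xi e : `|e - e0| < d -> zeros V U e (gam (xi (e - e0)) (e - e0)).
  by move=> ed; apply/zeroP => //; have [xr gx] := xiP _ ed; exists (xi (e - e0)).
have uniqE e : e0 - d < e <= e0 -> zeros V U e = [set gam (xi (e - e0)) (e - e0)].
  move=> ed; have ed' : `|e - e0| < d by rewrite ltr_norml; lra.
  apply/seteqP; split=> x /=; last by move=> ->; exact: zero_xi.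
  by move=> /(zeroP _ _ ed')[s [sr gs ->]]; rewrite (uniq s (e - e0)) //; lra.
exists U, d; split.
- rewrite /bifurcation_domain.
  split.
      exact: Uo.
    exact: d0.
  move=> x e Ux ed.
  have eE : e = e0 + (e - e0) by rewrite addrC subrK.
  by rewrite eE; apply: dom => //; rewrite ltr_norml; lra.
- split=> [e ed|]; first by exists (gam (xi (e - e0)) (e - e0)); exact: uniqE.
  by rewrite uniqE ?subrr ?x00 // lexx andbT; lra.
- move=> x e ed.
  rewrite (uniqE e ed) => xE.
  split=> [nhx|].
    rewrite /= in xE.
    have [ee|ee] := eqVneq e e0; first by rewrite xE ee subrr x00.
    have ed' : `|e - e0| < d by rewrite ltr_norml; lra.
    have en : e - e0 != 0 by rewrite subr_eq0.
    have eE : e0 + (e - e0) = e by rewrite addrC subrK.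
    by have := hyp _ ed' en; rewrite eE -xE.
  by case=> xx ee; rewrite xx ee.
- exists (fun e => gam (xi (e - e0)) (e - e0)); split => //.
    by rewrite subrr.
  by move=> e ed; apply: zero_xi; rewrite ltr_norml; lra.
- move=> e ed; have ed' : `|e - e0| < d by rewrite ltr_norml; lra.
  have ep : 0 < e - e0 by rewrite subr_gt0; case/andP: ed.
  have [s [t [s1 t1 gs gt]]] := three (e - e0) ed' ep.
  have [xr gx] := xiP _ ed'.
  have sr : `|s| < r by move: xr; rewrite !ltr_norml; lra.
  have tr : `|t| < r by move: xr; rewrite !ltr_norml; lra.
  (* Three zeros of [V], distinct because s < xi < t and [gam] is injective in its first
     argument. *)
  pose h (i : nat) := gam (nth 0 [:: s; xi (e - e0); t] i) (e - e0).
  have nr i : `I_3 i -> `|nth 0 [:: s; xi (e - e0); t] i| < r by case: i => [|[|[|]]].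
  have hfun : set_fun `I_3 (zeros V U e) h.
    move=> i i3; apply/zeroP => //; exists (nth 0 [:: s; xi (e - e0); t] i).
    by split => //; [exact: nr|case: i i3 => [|[|[|]]]].
  have hinj : {in `I_3 &, injective h}.
    move=> i j; rewrite !inE => i3 j3 /(inj _ _ _ (nr i i3) (nr j j3) ed').
    by case: i i3 => [|[|[|i]]] //; case: j j3 => [|[|[|j]]] //= _ _ E; exfalso; lra.
  have hI : (`I_3 #<= h @` `I_3)%card.
    by have /card_eqPle[] := inj_card_eq hinj.
  apply: card_le_trans hI _; apply: subset_card_le.
  by move=> _ [i i3 <-]; exact: hfun.
Qed.

End Assembly.

(** * The reduced function, its derivatives and its zeros *)

Section ReducedFunction.
Variables (R : realType) (n : nat).
Variables (Om : set ('rV[R]_n * R)) (V : 'rV[R]_n * R -> 'rV[R]_n).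
Hypothesis Om_open : open Om.
Hypothesis V_C2 : class_C 2 Om V.
Variables (x0 : 'rV[R]_n) (e0 : R) (v : 'rV[R]_n) (c : 'cV[R]_n).
Let p0 := (x0, e0).
Hypothesis V0 : V p0 = 0.
Hypothesis vJ : v *m jac_x V p0 = 0.
Hypothesis Jc : jac_x V p0 *m c = 0.
Hypothesis vc : v *m c = 1%:M.
Hypothesis Vec : param_deriv V p0 *m c = 0.
Let Q : 'M[R]_n := 1%:M - c *m v.
Variables (rho : R) (gam : R * R -> 'rV[R]_n) (r d : R).
Hypotheses (d0 : 0 < d) (r0 : 0 < r) (r_rho : r <= rho) (d_rho : d <= rho).
Hypothesis rho_Om : forall p, `|p - p0| < rho -> Om p.
Hypothesis N_unit : forall p, `|p - p0| < rho ->
  jac_x V p *m Q + c *m v \in unitmx.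
Hypothesis gam_eq : forall q, `|q| < d -> [/\ `|gam q - x0| < r,
  V (gam q, e0 + q.2) = (V (gam q, e0 + q.2) *m c) *m v &
  (gam q - x0) *m c = (q.1)%:M].
Hypothesis gam_uniq : forall x s t, `|x - x0| < r -> `|s| < d -> `|t| < d ->
  V (x, e0 + t) = (V (x, e0 + t) *m c) *m v ->
  (x - x0) *m c = s%:M -> x = gam (s, t).
Hypothesis gam_diff : forall q, `|q| < d -> differentiable gam q /\ forall k,
  'd V (gam q, e0 + q.2) ('d gam q k, k.2) *m Q = 0 /\
  'd gam q k *m c = (k.1)%:M.
Implicit Types (x y : 'rV[R]_n) (s t : R) (q k : R * R).

Definition graph_point q := (gam q, e0 + q.2).
Local Notation Gam := graph_point.

Definition reduced_fun q : R := (V (Gam q) *m c) ord0 ord0.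
Local Notation g := reduced_fun.

Lemma graph_point_near q : `|q| < d -> `|Gam q - p0| < rho.
Proof.
case: q => s t qd; have [gr _ _] := gam_eq qd.
rewrite -[X in `|X|]/((gam (s, t) - x0, e0 + t - e0)) addrAC subrr add0r.
rewrite prod_norm_lt (lt_le_trans gr r_rho).
by move: qd; rewrite prod_norm_lt => /andP[_ /lt_le_trans]; apply.
Qed.

Let Om_Gam q : `|q| < d -> Om (Gam q).
Proof. by move/graph_point_near/rho_Om. Qed.

Let zero_d : `|0 : R * R| < d. Proof. by rewrite normr0. Qed.

Let Om_p0 : Om p0.
Proof. by apply: rho_Om; rewrite subrr normr0 (lt_le_trans d0). Qed.

Lemma reduced_gam0 : gam 0 = x0.
Proof.
apply/esym; apply: gam_uniq; rewrite ?normr0 //.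
- by rewrite subrr normr0.
- by rewrite addr0 V0 !mul0mx.
- by rewrite subrr mul0mx raddf0.
Qed.

Lemma graph_point0 : Gam 0 = p0.
Proof. by rewrite /Gam reduced_gam0 addr0. Qed.

Lemma reduced_funE q : `|q| < d -> V (Gam q) = g q *: v.
Proof.
move=> qd; have [_ VE _] := gam_eq qd.
by rewrite [LHS]VE [V _ *m c]mx11_scalar mul_scalar_mx.
Qed.

Lemma reduced_fun0 : g 0 = 0.
Proof. by rewrite /g graph_point0 V0 mul0mx mxE. Qed.

Lemma graph_point_diff q : `|q| < d -> differentiable Gam q /\
  forall k, 'd Gam q k = ('d gam q k, k.2).
Proof.
move=> qd; have [gd _] := gam_diff qd.
have snd_lin : linear (snd : R * R -> R) by [].
pose sndL : {linear (R * R)%type -> R} :=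
  HB.pack (snd : R * R -> R) (GRing.isLinear.Build _ _ _ _ _ snd_lin).
have sndc : continuous sndL.
  apply: (@linear_bound_continuous _ _ _ sndL 1) => -[s t].
  by rewrite mul1r prod_normE le_max lexx orbT.
pose e q := e0 + q.2.
have [ed eE] : is_diff q e snd.
  apply: (@is_diff_affine _ _ _ _ sndL) => // y.
  by rewrite -[RHS]/(y.2 - q.2) /e opprD addrACA subrr add0r.
have GE : Gam = (fun q => (gam q, e q)) by [].
split=> [|k]; first by rewrite GE; exact: differentiable_pair.
by rewrite GE diff_pair //= eE.
Qed.

Lemma reduced_fun_diff q : `|q| < d -> differentiable g q /\
  forall k, 'd V (Gam q) ('d gam q k, k.2) = 'd g q k *: v.
Proof.
move=> qd; have [Gd GE] := graph_point_diff qd.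
have Vd := family_diff V_C2 (Om_Gam qd).
have VGd : differentiable (V \o Gam) q by exact: differentiable_comp.
have [VGcd VGcE] := differentiable_mulmxr c VGd.
have gd : differentiable g q by exact: differentiable_coords VGcd.
split=> // k; have [_ /(_ k) [VQ _]] := gam_diff qd.
have dgE : 'd g q k = ('d V (Gam q) ('d gam q k, k.2) *m c) ord0 ord0.
  rewrite (diff_coords _ _ _ VGcd) VGcE; congr ((_ *m c) _ _).
  apply: (etrans (congr1 (@^~ k) (diff_comp Gd Vd))).
  by rewrite /= GE.
move: VQ; rewrite mulmxBr mulmx1 mulmxA => /eqP; rewrite subr_eq0 => /eqP {1}->.
by rewrite [_ *m c]mx11_scalar mul_scalar_mx dgE.
Qed.

Lemma reduced_fun_partial1 q : `|q| < d ->
  'd gam q (1, 0) *m jac_x V (Gam q) = 'd g q (1, 0) *: v.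
Proof.
move=> qd; have [_ gE] := reduced_fun_diff qd.
by rewrite (jac_xE V_C2) ?gE //; exact: Om_Gam.
Qed.

Let kappa p : R := (v *m \adj (jac_x V p) *m c) ord0 ord0.

(** With [k] the s-derivative of [gam], multiply [k *m D_x V = g_s *: v] by the adjugate and then by
    [c], and use [k *m c = 1]. *)
Lemma det_jac_x_reduced q : `|q| < d ->
  \det (jac_x V (Gam q)) = 'd g q (1, 0) * kappa (Gam q).
Proof.
move=> qd; have [_ /(_ (1, 0)) [_ kc]] := gam_diff qd.
have := congr1 (fun M => M *m \adj (jac_x V (Gam q)) *m c) (reduced_fun_partial1 qd).
rewrite /= -[X in X *m c]mulmxA mul_mx_adj mul_mx_scalar -scalemxAl kc.
rewrite -!scalemxAl => /matrixP /(_ ord0 ord0).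
by rewrite [LHS]mxE [RHS]mxE mxE eqxx mulr1n mulr1.
Qed.

(** The two relations of [gam_diff] add up to one linear system with an invertible matrix. The
    closed formula makes the continuity of [d gam] visible. *)
Lemma diff_gamE q k : `|q| < d ->
  'd gam q k = (k.1 *: v - k.2 *: (param_deriv V (Gam q) *m Q)) *m
    invmx (jac_x V (Gam q) *m Q + c *m v).
Proof.
move=> qd; have [_ /(_ k) [VQ kc]] := gam_diff qd.
have Nu := N_unit (graph_point_near qd).
rewrite -[LHS](mulmxK Nu); congr (_ *m _).
rewrite mulmxDr !mulmxA kc mul_scalar_mx addrC; congr (_ + _).
apply/eqP; rewrite -addr_eq0 -VQ (family_diffE V_C2); last exact: Om_Gam.
by rewrite mulmxDl -scalemxAl.
Qed.

Let Gam_cont q : `|q| < d -> {for q, continuous Gam}.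
Proof.
by move=> qd; apply: differentiable_continuous; have [] := graph_point_diff qd.
Qed.

Let near_box q : `|q| < d -> \forall q' \near q, `|q'| < d.
Proof.
move=> qd; apply/near_norm; exists (d - `|q|); first by rewrite subr_gt0.
move=> q' qq'; rewrite -(subrK q q'); apply: le_lt_trans (ler_normD _ _) _.
by rewrite -ltrBrDr.
Qed.

Let jacG_cont q : `|q| < d -> {for q, continuous (fun q => jac_x V (Gam q))}.
Proof.
move=> qd; apply: (continuous_comp (Gam_cont qd)).
apply: differentiable_continuous.
exact: (jac_x_differentiable Om_open V_C2 (Om_Gam qd)).
Qed.

Let parG_cont q : `|q| < d -> {for q, continuous (fun q => param_deriv V (Gam q))}.
Proof.
move=> qd; apply: (continuous_comp (Gam_cont qd)).
apply: differentiable_continuous; exact: (param_deriv_differentiable V_C2 (Om_Gam qd)).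
Qed.

Lemma diff_gam_continuous q k : `|q| < d ->
  {for q, continuous (fun q => 'd gam q k)}.
Proof.
move=> qd.
pose H q := (k.1 *: v - k.2 *: (param_deriv V (Gam q) *m Q)) *m
    invmx (jac_x V (Gam q) *m Q + c *m v).
have cc (m l : nat) (M : 'M[R]_(m, l)) : {for q, continuous (fun _ : R * R => M)}.
  exact: cvg_cst.
have PQ := continuous_mulmx (parG_cont qd) (cc _ _ Q).
have NQ := cvgD (continuous_mulmx (jacG_cont qd) (cc _ _ Q)) (cc _ _ (c *m v)).
have Hc : {for q, continuous H}.
  apply: continuous_mulmx.
    exact: (cvgB (cc _ _ (k.1 *: v)) (cvgZ (cvg_cst k.2) PQ)).
  apply: (@continuous_invmx _ _ q _ (fun q => jac_x V (Gam q) *m Q + c *m v)).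
    exact: N_unit (graph_point_near qd).
  exact: NQ.
have HE : \forall q' \near q, H q' = 'd gam q' k.
  by apply: filterS (near_box qd) => q' q'd; rewrite diff_gamE.
exact: (continuous_near_eq Hc HE).
Qed.

Let jc i p : R := (jac_x V p *m c) i ord0.
Let pc p : R := (param_deriv V p *m c) ord0 ord0.

(** The shape matters: each last factor is differentiable and vanishes at the base point, [jc] by
    [Jc] and [pc] by (P1). *)
Let dgE q k : `|q| < d ->
  'd g q k = \sum_i 'd gam q k ord0 i * jc i (Gam q) + k.2 * pc (Gam q).
Proof.
move=> qd; have [_ /(_ k)] := reduced_fun_diff qd.
rewrite (family_diffE V_C2); last exact: Om_Gam.
move=> /(congr1 (fun M => (M *m c) ord0 ord0)).
rewrite mulmxDl -!scalemxAl vc -mulmxA !mxE eqxx mulr1 => <-.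
by congr (_ + _); rewrite /pc mxE.
Qed.

Let jc_diff i p : Om p -> differentiable (jc i) p.
Proof.
move=> Omp; apply: differentiable_coords.
by have [] := differentiable_mulmxr c (jac_x_differentiable Om_open V_C2 Omp).
Qed.

Let pc_diff p : Om p -> differentiable pc p.
Proof.
move=> Omp; apply: differentiable_coords.
by have [] := differentiable_mulmxr c (param_deriv_differentiable V_C2 Omp).
Qed.

Lemma diff_reduced_continuous q k : `|q| < d ->
  {for q, continuous (fun q => 'd g q k)}.
Proof.
move=> qd; have Gc := Gam_cont qd.
pose H q := \sum_i 'd gam q k ord0 i * jc i (Gam q) + k.2 * pc (Gam q).
have jcc i : jc i (Gam q') @[q' --> q] --> jc i (Gam q).
  exact: cvg_comp Gc (differentiable_continuous (jc_diff i (Om_Gam qd))).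
have pcc : pc (Gam q') @[q' --> q] --> pc (Gam q).
  exact: cvg_comp Gc (differentiable_continuous (pc_diff (Om_Gam qd))).
have Hc : {for q, continuous H}.
  apply: cvgD; last exact: (cvgM (cvg_cst k.2) pcc).
  apply: (@continuous_sum _ _ q _ _ _ (fun i q => 'd gam q k ord0 i * jc i (Gam q))).
  move=> i _; have /continuous_mxP/(_ ord0 i) gc := @diff_gam_continuous q k qd.
  exact: (cvgM gc (jcc i)).
have HE : \forall q' \near q, H q' = 'd g q' k.
  by apply: filterS (near_box qd) => q' q'd; rewrite dgE.
exact: (continuous_near_eq Hc HE).
Qed.

Lemma diff_reduced0 k : 'd g 0 k = 0.
Proof.
rewrite dgE // /pc graph_point0 Vec mxE mulr0 addr0 big1 // => i _.
by rewrite /jc Jc mxE mulr0.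
Qed.

(** In each product of [dgE] one factor is continuous and the other vanishes at 0, which is the
    situation of [is_diff_mul_vanishing]. *)
Lemma diff_reduced_diff0 k : differentiable (fun q => 'd g q k) 0.
Proof.
have [Gd _] := graph_point_diff zero_d.
have Hs : differentiable (fun q => \sum_i 'd gam q k ord0 i * jc i (Gam q)) 0.
  apply: differentiable_bigsum => i.
  have jG : differentiable (jc i \o Gam) 0.
    by apply: differentiable_comp => //; apply: jc_diff; exact: Om_Gam.
  have j0 : (jc i \o Gam) 0 = 0 by rewrite /= graph_point0 /jc Jc mxE.
  have /continuous_mxP/(_ ord0 i) gc := @diff_gam_continuous 0 k zero_d.
  by have [] := is_diff_mul_vanishing gc jG j0.
have Hp : differentiable (fun q => k.2 * pc (Gam q)) 0.
  have pG : differentiable (pc \o Gam) 0.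
    by apply: differentiable_comp => //; apply: pc_diff; exact: Om_Gam.
  have p0' : (pc \o Gam) 0 = 0 by rewrite /= graph_point0 /pc Vec mxE.
  have cc : {for (0 : R * R), continuous (fun _ : R * R => k.2)} by exact: cvg_cst.
  by have [] := is_diff_mul_vanishing cc pG p0'.
have HE : \forall q \near (0 : R * R),
    ((fun q => \sum_i 'd gam q k ord0 i * jc i (Gam q)) + (fun q => k.2 * pc (Gam q))) q
    = 'd g q k.
  by apply: filterS (near_box zero_d) => q qd; rewrite dgE.
by have [] := is_diff_near_eq HE (differentiableD Hs Hp).
Qed.

(* [det (D_x V)] vanishes along the reduced surface together with the
   derivative of the reduced function in the direction of the kernel. *)
Lemma diff_det_reduced (w : 'rV[R]_n * R) : 'd V p0 w = 0 ->
  'd (fun p => \det (jac_x V p)) p0 w =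
  'd (fun q => 'd g q (1, 0)) 0 ((w.1 *m c) ord0 ord0, w.2) * kappa p0.
Proof.
move=> Vw; set k := (_, w.2).
have [Gd GE] := graph_point_diff zero_d.
(* A kernel vector of [DV] is tangent to the surface: [w.1] solves the linear system that determines
   [d gam]. *)
have wE : 'd Gam 0 k = w.
  rewrite GE [RHS]surjective_pairing; congr (_, _).
  have [_ /(_ k) [VQ kc]] := gam_diff zero_d.
  have p00 : `|p0 - p0| < rho by rewrite subrr normr0 (lt_le_trans d0).
  have Nu := N_unit p00.
  apply: (can_inj (mulmxK Nu)); rewrite (mulmxDr ('d gam 0 k)) (mulmxDr w.1) !mulmxA kc.
  congr (_ + _).
    move: VQ; rewrite addr0 reduced_gam0 -/p0 (family_diffE V_C2) //.
    move: Vw; rewrite {1}[w]surjective_pairing (family_diffE V_C2) //.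
    rewrite mulmxDl => /eqP; rewrite addr_eq0 => /eqP wJ /eqP.
    by rewrite addr_eq0 wJ mulNmx => /eqP.
  by rewrite [w.1 *m c]mx11_scalar.
have dd : differentiable (fun p => \det (jac_x V p)) (Gam 0).
  rewrite graph_point0; apply: differentiable_det.
  exact: (jac_x_differentiable Om_open V_C2 Om_p0).
have detG : differentiable ((fun p => \det (jac_x V p)) \o Gam) 0.
  exact: differentiable_comp.
have dE : 'd ((fun p => \det (jac_x V p)) \o Gam) 0 k =
    'd (fun p => \det (jac_x V p)) p0 w.
  by rewrite diff_comp //= wE graph_point0.
have kc : {for (0 : R * R), continuous (fun q => kappa (Gam q))}.
  have cc (m l : nat) (M : 'M[R]_(m, l)) :
      {for (0 : R * R), continuous (fun _ : R * R => M)}.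
    exact: cvg_cst.
  have := continuous_mulmx (continuous_mulmx (cc _ _ v)
    (continuous_adj (jacG_cont zero_d))) (cc _ _ c).
  by move/continuous_mxP; apply.
have [_ kE] := is_diff_mul_vanishing kc (diff_reduced_diff0 (1, 0))
  (diff_reduced0 (1, 0)).
have HE : \forall q \near (0 : R * R),
    ((fun p => \det (jac_x V p)) \o Gam) q = kappa (Gam q) * 'd g q (1, 0).
  by apply: filterS (near_box zero_d) => q qd; rewrite /= det_jac_x_reduced // mulrC.
have [_ hE] := is_diff_near_eq HE detG.
apply: (etrans (esym dE)); apply: (etrans (esym (congr1 (@^~ k) hE))).
by apply: (etrans (congr1 (@^~ k) kE)); rewrite graph_point0; exact: mulrC.
Qed.

(** The invertible matrix of [N_unit] maps the s-derivative [k] of [gam] to [v] and a left kernel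
    vector [u] of [D_x V] to a multiple of [v]. So [u] is a multiple of [k], and
    [k *m D_x V = g_s *: v] does not vanish. *)
Lemma det_jac_x_neq0 q : `|q| < d -> 'd g q (1, 0) != 0 ->
  \det (jac_x V (Gam q)) != 0.
Proof.
move=> qd gs0; apply/negP => /det0P[u u0 uJ].
have Nu := N_unit (graph_point_near qd).
have [_ /(_ (1, 0)) [_ kc]] := gam_diff qd.
have kJ := reduced_fun_partial1 qd.
set k := 'd gam q (1, 0) in kJ kc.
have vQ : v *m Q = 0 by rewrite mulmxBr mulmx1 mulmxA vc mul1mx subrr.
have kN : k *m (jac_x V (Gam q) *m Q + c *m v) = v.
  by rewrite mulmxDr !mulmxA kJ kc -scalemxAl vQ scaler0 add0r mul1mx.
have uN : u = (u *m c) ord0 ord0 *: k.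
  apply: (can_inj (mulmxK Nu)); rewrite mulmxDr -scalemxAl kN !mulmxA uJ mul0mx add0r.
  by rewrite {1}[u *m c]mx11_scalar mul_scalar_mx.
move: uJ; rewrite uN -scalemxAl kJ => /(congr1 (mulmx^~ c)) /eqP.
rewrite /= -!scalemxAl vc mul0mx scalerA scaler_eq0 mulf_eq0 (negPf gs0) orbF.
case/orP=> [/eqP uc|/eqP /matrixP /(_ ord0 ord0)].
  by move: u0; rewrite uN uc scale0r eqxx.
by rewrite !mxE => /eqP; rewrite oner_eq0.
Qed.

Let gs (s e : R) : `|s| < d -> `|e| < d ->
  is_derive s 1 (fun s => g (s, e)) ('d g (s, e) (1, 0)).
Proof.
move=> sd ed; apply: partial_derive1.
by have [|] := @reduced_fun_diff (s, e); rewrite ?prod_norm_lt ?sd.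
Qed.

Let ge (s e : R) : `|s| < d -> `|e| < d ->
  is_derive e 1 (fun e => g (s, e)) ('d g (s, e) (0, 1)).
Proof.
move=> sd ed; apply: partial_derive2.
by have [|] := @reduced_fun_diff (s, e); rewrite ?prod_norm_lt ?sd.
Qed.

Hypothesis isolated : \forall x \near x0, V (x, e0) = 0 -> x = x0.
Hypothesis index : nonzero_index [set x | Om (x, e0)] (fun x => V (x, e0)) x0.

Let family_cont p : Om p -> {for p.1, continuous (fun x => V (x, p.2))}.
Proof.
case: p => x e Omp.
have pd : differentiable (fun y : 'rV[R]_n => (y, e)) x.
  by apply: differentiable_pair; [exact: ex_diff|exact: differentiable_cst].
apply: (continuous_comp (differentiable_continuous pd)).
exact: differentiable_continuous (family_diff V_C2 Omp).
Qed.

(* If the reduced function at [e0] had a constant sign, the vector field would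
   avoid the opposite direction along [v], and its index would be 0. *)
Lemma reduced_sign_change : exists tau d1 : R, [/\ tau * tau = 1, 0 < d1 <= d &
  forall s, 0 < `|s| < d1 -> 0 < tau * (s * g (s, 0))].
Proof.
have [eta eta0 iso] := (near_norm _ _).1 isolated.
have gamc : {for (0 : R * R), continuous gam}.
  by apply: differentiable_continuous; have [] := gam_diff zero_d.
have [d2 d20 gam_eta] : exists2 d2 : R, 0 < d2 &
    forall q, `|q| < d2 -> `|gam q - x0| < eta.
  have : \forall q \near (0 : R * R), `|gam q - x0| < eta.
    have : \forall x \near gam 0, `|x - x0| < eta.
      by rewrite reduced_gam0; apply/near_norm; exists eta.
    exact: gamc.
  by move=> /near_norm[d2 d20 dP]; exists d2 => // q qd; apply: dP; rewrite subr0.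
pose d1 := Num.min d d2.
have d10 : 0 < d1 by rewrite lt_min d0.
have d1d s : `|s| < d1 -> `|s| < d /\ `|s| < d2 by rewrite lt_min => /andP[].
have zd : `|0 : R| < d by rewrite normr0.
have g_s s : `|s| < d1 -> is_derive s 1 (fun s => g (s, 0)) ('d g (s, 0) (1, 0)).
  by move=> /d1d[sd _]; exact: gs.
have g_neq0 s : 0 < `|s| < d1 -> g (s, 0) != 0.
  move=> /andP[s0 /d1d[sd sd2]]; apply/eqP => g0.
  have qd : `|(s, 0 : R)| < d by rewrite prod_norm_lt sd zd.
  have Vs : V (gam (s, 0), e0) = 0.
    by have := reduced_funE qd; rewrite /Gam addr0 g0 scale0r.
  (* By isolation the point would be [x0], whose coordinate along [c] is 0 and not [s]. *)
  have gE : gam (s, 0) = x0.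
    by apply: iso => //; apply: gam_eta; rewrite prod_norm_lt sd2 normr0.
  have [_ _] := gam_eq qd; rewrite gE subrr mul0mx => /esym /matrixP /(_ ord0 ord0).
  by rewrite !mxE => /= s00; move: s0; rewrite -[s]mulr1n s00 normr0 ltxx.
have [tau tau2 tauP] : exists2 tau : R, tau * tau = 1 &
    forall s : R, 0 < `|s| < d1 -> 0 < tau * (s * g (s, 0)).
  apply: (sign_change d10 g_s g_neq0); first exact: reduced_fun0.
  move=> tau tau2 tau_sign.
  have v0 : v != 0.
    apply/eqP => vE; move: vc; rewrite vE mul0mx => /matrixP /(_ ord0 ord0) /eqP.
    by rewrite !mxE eq_sym oner_eq0.
  have nu0 : tau *: v != 0.
    rewrite scaler_eq0 negb_or v0 andbT; apply/eqP => t0; move: tau2.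
    by rewrite t0 mul0r => /eqP; rewrite eq_sym oner_eq0.
  have [K K0 cK] : exists2 K : R, 0 < K &
      forall h : 'rV[R]_n, `|(h *m c) ord0 ord0| <= K * `|h|.
    have [K K0 hK] := mulmx_bounded c.
    by exists K => // h; apply: le_trans (norm_coord_le _ _ _) (hK h).
  suff : has_index [set x | Om (x, e0)] (fun x => V (x, e0)) x0 0.
    by move/index; rewrite eqxx.
  apply: (index0_of_missed_direction nu0).
  apply/near_norm; exists (Num.min eta (Num.min r (d1 / K))).
    by rewrite !lt_min eta0 r0 divr_gt0.
  move=> x; rewrite !lt_min => /and3P[x_eta x_r x_d].
  have Omx : Om (x, e0).
    apply: rho_Om; rewrite -[X in `|X|]/((x - x0, e0 - e0)) subrr prod_norm_lt.
    by rewrite normr0 (lt_le_trans x_r) // (lt_le_trans d0).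
  split=> [//|||t t0 Vx].
  - exact: family_cont Omx.
  - exact: iso.
  have sd : `|((x - x0) *m c) ord0 ord0| < d1.
    by apply: le_lt_trans (cK _) _; rewrite mulrC -ltr_pdivlMr.
  have Vc : V (x, e0) *m c = (- t * tau)%:M.
    by rewrite Vx -!scalemxAl vc !scale_scalar_mx mulr1.
  (* [V] is parallel to [v] at [x], so [x] lies on the surface; there [g] is - t * tau, and
     [tau * g] = - t contradicts [tau_sign]. *)
  have xE : x = gam (((x - x0) *m c) ord0 ord0, 0).
    apply: gam_uniq => //; first by have [] := d1d _ sd.
      by rewrite addr0 Vc mul_scalar_mx {1}Vx scalerA.
    exact: mx11_scalar.
  have gE : g (((x - x0) *m c) ord0 ord0, 0) = - t * tau.
    by rewrite /g /Gam -xE addr0 Vc mxE eqxx mulr1n.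
  have := tau_sign _ sd; rewrite gE mulrCA tau2 mulr1 oppr_ge0 leNgt t0 //.
exists tau, d1; split=> //.
by rewrite d10 ge_min lexx.
Qed.

(* Otherwise [g (s, 0)], which is [a / 2 * s ^ 2 + o (s ^ 2)], would have the sign
   of [a] on both sides of 0. *)
Lemma reduced_second_diff0 : 'd (fun q => 'd g q (1, 0)) 0 (1, 0) = 0.
Proof.
pose h q := 'd g q (1, 0); rewrite -/h.
have [tau [d1 [tau2 /andP[d10 d1d] tauP]]] := reduced_sign_change.
apply/eqP; set a := 'd h 0 (1, 0); case: (eqVneq a 0) => //= a0.
have k0 : 0 < `|a| / 2 by rewrite divr_gt0 // normr_gt0.
have [d2 d20 d2P] : exists2 d2 : R, 0 < d2 & forall s : R, `|s| < d2 ->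
    `|h (s, 0) - a * s| <= `|a| / 2 * `|s|.
  have [d2 d20 d2P] := vanishing_linear_estimate (diff_reduced_diff0 (1, 0))
    (diff_reduced0 (1, 0)) k0.
  exists d2 => // s sd; have zd2 : `|0 : R| < d2 by rewrite normr0.
  have hE : `|h (s, 0) - (a * s + 'd h 0 (0, 1) * 0)| <= `|a| / 2 * (`|s| + `|0 : R|).
    exact: d2P s 0 sd zd2.
  move: hE; move: (h _) ('d h 0 (0, 1)) => H B.
  by rewrite mulr0 normr0 !addr0.
have tau_n : `|tau| = 1.
  by apply/eqP; rewrite -sqrp_eq1 // -normrX expr2 tau2 normr1.
(* With an error of at most |a * s| / 2, [h (s, 0)] has the sign of [a * s]. *)
have hs (s : R) : `|s| < d2 -> 0 < tau * h (s, 0) -> 0 < tau * a * s.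
  move=> sd hs0; have hE := d2P s sd.
  have : `|tau * h (s, 0) - tau * a * s| <= `|tau * a * s| / 2.
    rewrite -mulrA -mulrBr !normrM tau_n !mul1r; apply: le_trans hE _.
    by rewrite mulrAC.
  move: (tau * h _) hs0 (tau * a * s) => H H0 A HA; rewrite ltNge; apply/negP => A0.
  by move: HA; rewrite (ler0_norm A0) ler_norml => /andP[_]; lra.
have zd : `|0 : R| < d by rewrite normr0.
have g_s (s : R) : `|s| < d -> is_derive s 1 (fun s => g (s, 0)) (h (s, 0)).
  by move=> sd; exact: gs.
have hP (s : R) : 0 < `|s| < Num.min d1 d2 -> 0 < tau * a * s.
  rewrite lt_min => /and3P[s0 s1 s2].
  have sd : `|s| < d by apply: lt_le_trans s1 _.
  have [t ts gE] := mean_value_between g_s zd sd.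
  rewrite reduced_fun0 !subr0 in gE.
  have := tauP s; rewrite s0 s1 gE => /(_ isT) hst.
  have s20 : 0 < s * s by rewrite -expr2 exprn_even_gt0 //= -normr_gt0.
  have ht : 0 < tau * h (t, 0).
    rewrite -(pmulr_lgt0 _ s20); move: hst; move: (h _) => H.
    by rewrite (_ : tau * H * (s * s) = tau * (s * (H * s))) //; ring.
  have t2 : `|t| < d2.
    by apply: le_lt_trans s2; apply: between_norm ts _ _; rewrite ?normr0.
  have at0 := hs t t2 ht.
  (* [t] lies between 0 and [s], so the sign found at [t] is transferred to [s]. *)
  have st0 : 0 <= s * t.
    case/orP: ts => /andP[t_1 t_2]; first exact: mulr_ge0 (le_trans t_1 t_2) t_1.
    exact: mulr_le0 (le_trans t_1 t_2) t_2.
  have tn : t != 0 by apply/eqP => t0; move: at0; rewrite t0 mulr0 ltxx.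
  have {}st0 : 0 < s * t by rewrite lt_neqAle st0 eq_sym mulf_neq0 // -normr_gt0.
  have t20 : 0 < t * t by rewrite -expr2 exprn_even_gt0.
  by rewrite -(pmulr_lgt0 _ t20) mulrACA mulr_gt0.
pose p := Num.min d1 d2 / 2.
have p0' : 0 < p by rewrite divr_gt0 // lt_min d10.
have pm : 0 < `|p| < Num.min d1 d2.
  rewrite gtr0_norm // p0' /p ltr_pdivrMr // ltr_pMr ?ltr1n //.
  by rewrite lt_min d10.
have := hP p pm; have := hP (- p); rewrite normrN mulrN oppr_gt0 => /(_ pm).
by move=> h1 h2; have := lt_trans h1 h2; rewrite ltxx.
Qed.

(** As [g_ss = 0], [diff_det_reduced] leaves w.2 * g_se * kappa for the derivative of the
    determinant along [w]. *)
Lemma reduced_mixed_neq0 (w : 'rV[R]_n * R) : 'd V p0 w = 0 ->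
  'd (fun p => \det (jac_x V p)) p0 w != 0 ->
  'd (fun q => 'd g q (1, 0)) 0 (0, 1) != 0.
Proof.
move=> Vw /eqP dn0; apply/eqP => b0; apply: dn0.
have E (D A B x y k : R) : D = (x * A + y * B) * k -> A = 0 -> B = 0 -> D = 0.
  by move=> -> -> ->; rewrite !mulr0 addr0 mul0r.
have dE := @diff_pairE R R (fun q => 'd g q (1, 0)) 0 ((w.1 *m c) ord0 ord0) w.2.
apply: (E _ _ _ _ _ (kappa p0) _ reduced_second_diff0 b0).
exact: etrans (diff_det_reduced Vw) (congr1 (fun z : R => z * kappa p0) dE).
Qed.

Lemma reduced_pitchfork (b : R) : b = 'd (fun q => 'd g q (1, 0)) 0 (0, 1) ->
  b != 0 -> exists (sigma r1 d1 : R) (xi m : R -> R),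
  [/\ sigma * sigma = 1, 0 < r1 <= d, 0 < d1 <= d &
  [/\ forall e : R, `|e| < d1 -> [/\ `|xi e| < r1, g (xi e, e) = 0,
        is_derive e 1 xi (m e) & {for e, continuous m}],
      xi 0 = 0,
      forall s e : R, `|s| < r1 -> `|e| < d1 -> sigma * e <= 0 -> g (s, e) = 0 ->
        s = xi e,
      forall e : R, `|e| < d1 -> e != 0 -> 'd g (xi e, e) (1, 0) != 0 &
      forall e : R, `|e| < d1 -> 0 < sigma * e -> exists s t,
        [/\ - r1 < s < xi e, xi e < t < r1, g (s, e) = 0 & g (t, e) = 0]]].
Proof.
move=> bE b0; have [tau [d1 [tau2 /andP[d10 d1d] tauP]]] := reduced_sign_change.
have binv : b^-1 != 0 by rewrite invr_eq0.
(* Division by [b] multiplies the sign of [g (s, 0)] by that of [b]; the minus sign turns [tauP]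
   into the hypothesis [g_sign]. *)
pose sigma := - (tau * Num.sg b).
have sigma2 : sigma * sigma = 1.
  by rewrite mulrNN mulrACA tau2 mul1r -expr2 sqr_sg b0.
pose G s e := b^-1 * g (s, e).
pose fs s e := b^-1 * 'd g (s, e) (1, 0).
pose fe s e := b^-1 * 'd g (s, e) (0, 1).
pose b1 := b^-1 * 'd (fun q => 'd g q (0, 1)) 0 (1, 0).
pose c1 := b^-1 * 'd (fun q => 'd g q (0, 1)) 0 (0, 1).
have G_s (s e : R) : `|s| < d -> `|e| < d -> is_derive s 1 (G^~ e) (fs s e).
  by move=> sd ed; have := gs sd ed => gd; exact: is_deriveZ.
have G_e (s e : R) : `|s| < d -> `|e| < d -> is_derive e 1 (G s) (fe s e).
  by move=> sd ed; have := ge sd ed => gd; exact: is_deriveZ.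
have dg_cont k (s e : R) : `|s| < d -> `|e| < d ->
    {for (s, e), continuous (fun q => b^-1 * 'd g q k)}.
  move=> sd ed; apply: cvgM; first exact: cvg_cst.
  by apply: diff_reduced_continuous; rewrite prod_norm_lt sd.
have fs_cont (s e : R) : `|s| < d -> `|e| < d ->
    {for (s, e), continuous (fun q : R * R => fs q.1 q.2)}.
  have -> : (fun q : R * R => fs q.1 q.2) = fun q => b^-1 * 'd g q (1, 0).
    by apply/funext => -[].
  exact: dg_cont.
have fe_cont (s e : R) : `|s| < d -> `|e| < d ->
    {for (s, e), continuous (fun q : R * R => fe q.1 q.2)}.
  have -> : (fun q : R * R => fe q.1 q.2) = fun q => b^-1 * 'd g q (0, 1).
    by apply/funext => -[].
  exact: dg_cont.
have dg_lin k kk (kk0 : 0 < kk) : exists2 d2 : R, 0 < d2 &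
    forall s e : R, `|s| < d2 -> `|e| < d2 ->
    `|b^-1 * 'd g (s, e) k - (b^-1 * 'd (fun q => 'd g q k) 0 (1, 0) * s +
       b^-1 * 'd (fun q => 'd g q k) 0 (0, 1) * e)| <= kk * (`|s| + `|e|).
  have bk0 : 0 < kk * `|b| by rewrite mulr_gt0 ?normr_gt0.
  have [d2 d20 d2P] := vanishing_linear_estimate (diff_reduced_diff0 k)
    (diff_reduced0 k) bk0.
  have scale (H A B s e N : R) : `|H - (A * s + B * e)| <= kk * `|b| * N ->
      `|b^-1 * H - (b^-1 * A * s + b^-1 * B * e)| <= kk * N.
    rewrite -!(mulrA b^-1) -mulrDr -mulrBr normrM normfV ler_pdivrMl ?normr_gt0 //.
    by rewrite mulrCA mulrA.
  exists d2; first exact: d20.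
  move=> s e sd ed; have dE := d2P s e sd ed.
  exact: (scale _ _ _ s e _ dE).
have G00 : G 0 0 = 0 by rewrite /G reduced_fun0 mulr0.
have fs_lin kk (kk0 : 0 < kk) : exists2 d2 : R, 0 < d2 &
    forall s e : R, `|s| < d2 -> `|e| < d2 ->
    `|fs s e - e| <= kk * (`|s| + `|e|).
  have [d2 d20 d2P] := dg_lin (1, 0) kk kk0.
  have simp (H A B s e N : R) : `|H - (b^-1 * A * s + b^-1 * B * e)| <= N ->
      A = 0 -> b = B -> `|H - e| <= N.
    by move=> HE A0 bB; move: HE; rewrite A0 -bB mulr0 mul0r add0r mulVf // mul1r.
  exists d2; first exact: d20.
  move=> s e sd ed; have dE := d2P s e sd ed.
  exact: (simp _ _ _ s e _ dE reduced_second_diff0 bE).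
have G_sign (s : R) : 0 < `|s| < d1 -> sigma * (s * G s 0) < 0.
  move=> /tauP sg0; rewrite /sigma /G mulNr oppr_lt0.
  have -> : tau * Num.sg b * (s * (b^-1 * g (s, 0))) =
      (Num.sg b * b^-1) * (tau * (s * g (s, 0))) by ring.
  apply: mulr_gt0 => //; rewrite -sgrV -normrEsg normr_gt0 //.
have := planar_pitchfork d0 G_s G_e fs_cont fe_cont G00 fs_lin
  (dg_lin (0, 1)) sigma2 d10 G_sign d0.
move=> [r1 [d2 [xi [m [r1P d2P [H1 H2 H3 H4 H5]]]]]].
have Gz s e : G s e = 0 <-> g (s, e) = 0.
  split=> [/eqP|]; rewrite /G; last by move=> ->; rewrite mulr0.
  by rewrite mulf_eq0 (negPf binv) => /eqP.
exists sigma, r1, d2, xi, m; split=> //; split=> //.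
- by move=> e /H1[? /Gz ? ? ?].
- by move=> s e sr ed se /Gz; exact: H3.
- by move=> e ed /(H4 e ed); rewrite mulf_eq0 (negPf binv).
- move=> e ed se; have [s [t [sr tr /Gz gs0 /Gz gt0]]] := H5 e ed se.
  by exists s, t.
Qed.

Hypothesis hyperbolic : forall p, `|p - p0| < rho -> \det (jac_x V p) != 0 ->
  forall z, complex_eigenvalue (jac_x V p) z -> complex.Re z != 0.

Section Branch.
Variables (r1 d1 : R) (xi m : R -> R).
Hypotheses (r1_d : r1 <= d) (d1_d : d1 <= d) (r1_0 : 0 < r1).
Hypothesis xiP : forall e : R, `|e| < d1 -> [/\ `|xi e| < r1, g (xi e, e) = 0,
  is_derive e 1 xi (m e) & {for e, continuous m}].

(** The ball is where [gam_uniq] applies, and the strip bounds the coordinate [s], so that the zeros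
    of [V] in this set correspond exactly to the zeros of [g] with |s| < r1. *)
Definition pitchfork_box : set 'rV[R]_n :=
  [set x | `|x - x0| < r /\ `|((x - x0) *m c) ord0 ord0| < r1].
Local Notation U := pitchfork_box.

Let box_d (s e : R) : `|s| < r1 -> `|e| < d1 -> `|(s, e)| < d.
Proof.
by move=> sr ed; rewrite prod_norm_lt (lt_le_trans sr r1_d) (lt_le_trans ed d1_d).
Qed.

Lemma pitchfork_box_open : open_nbhs x0 U.
Proof.
split; last by split; rewrite subrr ?mul0mx ?mxE normr0.
have [K K0 hK] := mulmx_bounded c.
rewrite openE => x [xr xc]; suff : \forall y \near x, U y by [].
apply/near_norm.
exists (Num.min (r - `|x - x0|) ((r1 - `|((x - x0) *m c) ord0 ord0|) / K)).
  by rewrite lt_min subr_gt0 xr divr_gt0 // subr_gt0.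
move=> y; rewrite lt_min ltr_pdivlMr // mulrC !ltrBrDr => /andP[yr yc].
have yE : y - x0 = (y - x) + (x - x0) by rewrite addrA subrK.
split; rewrite yE; first exact: le_lt_trans (ler_normD _ _) yr.
rewrite mulmxDl mxE; apply: le_lt_trans (ler_normD _ _) (le_lt_trans _ yc).
by rewrite lerD2r; apply: le_trans (norm_coord_le _ _ _) (hK _).
Qed.

Lemma pitchfork_box_Om x (e : R) : U x -> `|e| < d1 -> Om (x, e0 + e).
Proof.
move=> [xr _] ed; apply: rho_Om.
rewrite -[X in `|X|]/((x - x0, e0 + e - e0)) addrAC subrr add0r prod_norm_lt.
by rewrite (lt_le_trans xr r_rho) (lt_le_trans ed) // (le_trans d1_d).
Qed.

Lemma pitchfork_box_zeros x (e : R) : `|e| < d1 -> (U x /\ V (x, e0 + e) = 0) <->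
  exists s, [/\ `|s| < r1, g (s, e) = 0 & x = gam (s, e)].
Proof.
move=> ed; split=> [[[xr xc] Vx]|[s [sr gs0 ->]]].
  have xE : x = gam (((x - x0) *m c) ord0 ord0, e).
    apply: gam_uniq => //.
    - exact: lt_le_trans xc r1_d.
    - exact: lt_le_trans ed d1_d.
    - by rewrite Vx !mul0mx.
    - exact: mx11_scalar.
  exists (((x - x0) *m c) ord0 ord0); split=> //.
  by rewrite /g /Gam -xE Vx mul0mx mxE.
have qd := box_d sr ed; have [gr _ gc] := gam_eq qd.
split; last by have := reduced_funE qd; rewrite gs0 scale0r.
by split=> //; rewrite gc mxE eqxx mulr1n.
Qed.

Lemma gam_injective (s t e : R) : `|s| < r1 -> `|t| < r1 -> `|e| < d1 ->
  gam (s, e) = gam (t, e) -> s = t.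
Proof.
move=> sr tr ed E; have [_ _] := gam_eq (box_d sr ed).
have [_ _] := gam_eq (box_d tr ed); rewrite E => -> /matrixP /(_ ord0 ord0).
by rewrite !mxE.
Qed.

Lemma branch_hyperbolic (e : R) : `|e| < d1 -> 'd g (xi e, e) (1, 0) != 0 ->
  ~ non_hyperbolic V (gam (xi e, e), e0 + e).
Proof.
move=> ed gs0 [z zJ z0]; have [xr _ _ _] := xiP ed.
have qd := box_d xr ed.
by have /eqP := hyperbolic (graph_point_near qd) (det_jac_x_neq0 qd gs0) zJ.
Qed.

Let slope (e : R) := m e *: 'd gam (xi e, e) (1, 0) + 'd gam (xi e, e) (0, 1).

Lemma branch_class_C1 (e1 kap : R) : `|kap| = 1 ->
  class_C 1 `]e1 - d1, e1 + d1[%classic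
    (fun e => gam (xi (kap * (e - e1)), kap * (e - e1))).
Proof.
apply: (@class_C1_curve _ _ (fun e => gam (xi e, e)) slope) => e ed.
have [xr _ [xd xE] mc] := xiP ed; have qd := box_d xr ed.
have [gd _] := gam_diff qd.
have xid : differentiable xi e by apply/derivable1_diffP.
have pd : differentiable (fun e => (xi e, e)) e.
  by apply: differentiable_pair; [exact: xid|exact: ex_diff].
have pair_c : {for e, continuous (fun e => (xi e, e))}.
  exact: differentiable_continuous pd.
have dE : 'd (fun e => (xi e, e)) e 1 = (m e, 1).
  have idd : differentiable (fun e : R => e) e by exact: ex_diff.
  by rewrite (diff_pair xid idd) /= -xE deriveE // diff_val.
split.
  apply: DeriveDef.
    by apply/derivable1_diffP; exact: (differentiable_comp pd gd).
  rewrite deriveE; last exact: (differentiable_comp pd gd).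
  apply: (etrans (congr1 (@^~ 1) (diff_comp pd gd))).
  apply: (etrans (congr1 ('d gam (xi e, e)) dE)).
  by apply: (etrans (diff_pairE _ _ _ _)); rewrite scale1r.
have c1 := continuous_comp pair_c (@diff_gam_continuous _ (1, 0) qd).
have c2 := continuous_comp pair_c (@diff_gam_continuous _ (0, 1) qd).
exact: (cvgD (cvgZ mc c1) c2).
Qed.

End Branch.

Let non_hyperbolic_p0 : non_hyperbolic V p0.
Proof.
exists (Complex 0 0) => //; apply/imaginary_eigenvalueP; exists v, 0.
split; first by split; rewrite ?vJ ?mul0mx ?oppr0 scale0r.
case=> vE _; move: vc; rewrite vE mul0mx => /matrixP /(_ ord0 ord0) /eqP.
by rewrite !mxE eq_sym oner_eq0.
Qed.

Lemma reduced_pitchfork_type (w : 'rV[R]_n * R) : 'd V p0 w = 0 ->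
  'd (fun p => \det (jac_x V p)) p0 w != 0 -> pitchfork_type Om V x0 e0.
Proof.
move=> Vw dw.
have [sigma [r1 [d1 [xi [m [sigma2 /andP[r10 r1d] /andP[d10 d1d]]]]]]] :=
  reduced_pitchfork erefl (reduced_mixed_neq0 Vw dw).
move=> [xiP xi0 uniq gs0 three].
have boxo := pitchfork_box_open r10.
have boxOm x e := @pitchfork_box_Om r1 d1 d1d x e.
have boxz x e := @pitchfork_box_zeros r1 d1 r1d d1d x e.
have inj s t e := @gam_injective r1 d1 r1d d1d s t e.
have hyp e (ed : `|e| < d1) (e1 : e != 0) :=
  branch_hyperbolic r1d d1d xiP ed (gs0 e ed e1).
have curve := branch_class_C1 r1d d1d xiP.
have x00 : gam (xi 0, 0) = x0 by rewrite xi0 reduced_gam0.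
(* The sign [sigma] tells on which side of [e0] the additional zeros appear: 1 gives the forward
   pitchfork, -1 that of the reversed family. *)
have /orP[/eqP sE|/eqP sE] : (sigma == 1) || (sigma == -1).
  by rewrite -sqrf_eq1 expr2 sigma2.
- left; apply: (@forward_pitchfork_of_branches _ _ _ _ _ _ (pitchfork_box r1) r1 d1
    (fun s e => gam (s, e)) (fun s e => g (s, e)) xi) => //.
  + by move=> e /xiP[].
  + by move=> s e sr ed se; apply: uniq => //; rewrite sE mul1r.
  + by move=> e ed e0'; apply: three => //; rewrite sE mul1r.
  + have -> : (fun e => gam (xi (e - e0), e - e0)) =
        fun e => gam (xi (1 * (e - e0)), 1 * (e - e0)).
      by apply/funext => e; rewrite mul1r.
    exact: curve (normr1 _).
- right; apply: (@forward_pitchfork_of_branches _ _ _ _ _ _ (pitchfork_box r1) r1 d1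
    (fun s e => gam (s, - e)) (fun s e => g (s, - e)) (fun e => xi (- e))).
  + exact: d10.
  + exact: boxo.
  + move=> x e Ux ed; rewrite /= /reverse_param /= opprD opprK.
    by apply: boxOm => //; rewrite normrN.
  + move=> x e ed; rewrite /= /reverse_param /= opprD opprK.
    by apply: boxz; rewrite normrN.
  + by move=> s t e sr tr ed; apply: inj => //; rewrite normrN.
  + by rewrite oppr0 xi0; exact: reduced_gam0.
  + by move=> e; rewrite -normrN => /xiP[].
  + move=> s e sr ed se; apply: uniq; rewrite ?normrN //.
    by rewrite sE mulrNN mul1r.
  + move=> e ed se; apply: three; rewrite ?normrN //.
    by rewrite sE mulrNN mul1r.
  + rewrite /non_hyperbolic /= -[jac_x _ _]/(jac_x V (x0, - - e0)) opprK.
    exact: non_hyperbolic_p0.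
  + move=> e ed e1; rewrite /non_hyperbolic.
    rewrite -[jac_x _ _]/(jac_x V (gam (xi (- e), - e), - (- e0 + e))).
    by rewrite opprD opprK; apply: hyp; rewrite ?normrN // oppr_eq0.
  + have -> : (fun e => gam (xi (- (e - - e0)), - (e - - e0))) =
        fun e => gam (xi (-1 * (e - - e0)), -1 * (e - - e0)).
      by apply/funext => e; rewrite mulN1r.
    exact: curve (normrN1 _).
Qed.

End ReducedFunction.

Lemma unitmx_near (R : realType) (n : nat) (T : topologicalType) (x : T)
    (f : T -> 'M[R]_n) : {for x, continuous f} -> f x \in unitmx ->
  \forall y \near x, f y \in unitmx.
Proof.
move=> /continuous_det fc; rewrite unitmxE unitfE => fx.
have dx := @cvgr_neq0 _ _ _ (nbhs x) (nbhs_filter x) _ _ fc fx.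
by apply: (@filterS _ _ (nbhs_filter x)) dx => y; rewrite unitmxE unitfE.
Qed.

Lemma param_derivE (R : realType) (n : nat) (Om : set ('rV[R]_n * R))
    (V : 'rV[R]_n * R -> 'rV[R]_n) (x0 : 'rV[R]_n) (e0 : R) :
  class_C 2 Om V -> Om (x0, e0) ->
  param_deriv V (x0, e0) = 'D_1 (fun e => V (x0, e)) e0.
Proof.
move=> V_C2 Omp; have Vd := family_diff V_C2 Omp.
have lE t : (x0, 0) + t *: (0, 1) = (x0, t) :> 'rV[R]_n * R.
  by rewrite -[LHS]/(x0 + t *: 0, 0 + t * 1) scaler0 mulr1 addr0 add0r.
have := @is_derive_line R _ _ V (x0, 0) (0, 1) e0.
rewrite lE (_ : (fun s => _) = fun e => V (x0, e)); last first.
  by apply/funext => t; rewrite lE.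
by move=> /(_ Vd) [_ ->].
Qed.

Theorem theorem1p1 (R : realType) (n : nat)
  (Om : set ('rV[R]_n * R)) (V : 'rV[R]_n * R -> 'rV[R]_n)
  (x0 : 'rV[R]_n) (e0 : R)
  (Om_nbhs : open_nbhs (x0, e0) Om)
  (V_C2 : class_C 2 Om V)
  (V_zero : V (x0, e0) = 0)
  (P0_isolated : \forall x \near x0, V (x, e0) = 0 -> x = x0)
  (P0_simple : simple_non_hyperbolic V (x0, e0))
  (P0_index : nonzero_index [set x | Om (x, e0)] (fun x => V (x, e0)) x0)
  (P1 : range ('d (fun x => V (x, e0)) x0) ('D_1 (fun e => V (x0, e)) e0))
  (P2 : exists w : 'rV[R]_n * R,
     [/\ 'd V (x0, e0) w = 0, w.2 != 0 &
         'd (fun p => \det (jac_x V p)) (x0, e0) w != 0]) :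
  pitchfork_type Om V x0 e0 /\ (one_to_k Om V x0 e0 \/ k_to_one Om V x0 e0).
Proof.
suff pf : pitchfork_type Om V x0 e0.
  split=> //; case: pf => [/forward_one_to_k|/backward_k_to_one]; first by left.
  by right.
have [Om_open Om_p0] := Om_nbhs.
have [mult hyp] := P0_simple.
have [v [c [vJ Jc vc M_unit]]] := simple_eigenvalue0_split mult.
have Jcont : {for (x0, e0), continuous (jac_x V)}.
  exact: differentiable_continuous (jac_x_differentiable Om_open V_C2 Om_p0).
(* (P1) puts the parameter derivative in the row space of [D_x V], which [c] annihilates. *)
have Vec : param_deriv V (x0, e0) *m c = 0.
  have [h _ hE] := P1.
  suff -> : param_deriv V (x0, e0) = h *m jac_x V (x0, e0).
    by rewrite -mulmxA Jc mulmx0.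
  rewrite /jac_x /jacobian mul_rV_lin1; apply: etrans (esym hE).
  exact: param_derivE V_C2 Om_p0.
(* At the base point [Jc] removes the projector, leaving the matrix of [M_unit]. *)
have N_unit : jac_x V (x0, e0) *m (1%:M - c *m v) + c *m v \in unitmx.
  by rewrite mulmxBr mulmx1 mulmxA Jc mul0mx subr0.
have cc (m l : nat) (M : 'M[R]_(m, l)) :
    {for (x0, e0), continuous (fun _ : 'rV[R]_n * R => M)}.
  exact: cvg_cst.
have N_cont : {for (x0, e0), continuous (fun p =>
    jac_x V p *m (1%:M - c *m v) + c *m v)}.
  exact: (cvgD (continuous_mulmx Jcont (cc _ _ (1%:M - c *m v)))
    (cc _ _ (c *m v))).
have N_near : \forall p \near (x0, e0),
    jac_x V p *m (1%:M - c *m v) + c *m v \in unitmx.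
  exact: unitmx_near N_cont N_unit.
have [r1 r10 rho_Om] := (near_norm _ _).1 (open_nbhs_nbhs Om_nbhs).
have [r2 r20 rho_N] := (near_norm _ _).1 N_near.
have [r3 r30 rho_hyp] := (near_norm _ _).1 (hyperbolic_near Jcont Jc M_unit hyp).
(* One radius for the domain of the family, the invertibility of the linear system, and the absence
   of imaginary eigenvalues where the determinant is nonzero. *)
pose rho := Num.min r1 (Num.min r2 r3).
have rho0 : 0 < rho by rewrite !lt_min r10 r20.
have rhoP (p : 'rV[R]_n * R) : `|p - (x0, e0)| < rho ->
    [/\ `|p - (x0, e0)| < r1, `|p - (x0, e0)| < r2 & `|p - (x0, e0)| < r3].
  by rewrite !lt_min => /and3P.
have {}rho_Om p : `|p - (x0, e0)| < rho -> Om p by move=> /rhoP[/rho_Om].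
have {}rho_N p : `|p - (x0, e0)| < rho ->
    jac_x V p *m (1%:M - c *m v) + c *m v \in unitmx.
  by move=> /rhoP[_ /rho_N].
have {}rho_hyp p : `|p - (x0, e0)| < rho -> \det (jac_x V p) != 0 ->
    forall z, complex_eigenvalue (jac_x V p) z -> complex.Re z != 0.
  by move=> /rhoP[_ _ /rho_hyp].
have [gam [r [d [/andP[r0 r_rho] /andP[d0 d_rho] gam_eq gam_uniq gam_diff]]]] :=
  reduced_curve Om_open V_C2 Om_p0 V_zero Jc vc M_unit rho0 rho_Om.
have [w [Vw _ dw]] := P2.
exact: (reduced_pitchfork_type Om_open V_C2 V_zero vJ Jc vc Vec d0 r0 r_rho d_rho
  rho_Om rho_N gam_eq gam_uniq gam_diff P0_isolated P0_index rho_hyp Vw dw).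
Qed.
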